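(* Let $s\in(0,1)$ and $0<\lambda\le\Lambda$. Let $K:\mathbb R^n\to[0,\infty]$ (not necessarily symmetric) satisfy, for all $y\ne0$, $\lambda|y|^{-n-2s}\le K(y)\le\Lambda|y|^{-n-2s}$ and $|\nabla K(y)|\le\Lambda|y|^{-1}K(y)$, and, if $s=1/2$, also $\int_{B_R\setminus B_r}yK(y)\,dy=0$ for all $R>r>0$. Let $$Lu(x)=\begin{cases}\int_{\mathbb R^n}(u(x)-u(y))K(x-y)\,dy,&s\in(0,1/2),\\ \mathrm{p.v.}\int_{\mathbb R^n}(u(x)-u(y))K(x-y)\,dy,&s=1/2,\\ \int_{\mathbb R^n}\big(u(x)-u(y)-\nabla u(x)\cdot(x-y)\big)K(x-y)\,dy,&s\in(1/2,1),\end{cases}$$ and let $b\in\mathbb R^n$ with $|b|\le\Lambda$. Let $\eta\in C^{1,1}(\mathbb R^n)$ be such that $\eta\ge0$ and $\eta^{2s}\in C^{0,1}(\mathbb R^n)$. Then there exists $\sigma_0=\sigma_0(n,s,\lambda,\Lambda,\|\eta\|_{C^{1,1}(\mathbb R^n)},\|\eta^{2s}\|_{C^{0,1}(\mathbb R^n)})>0$ such that for every $\sigma\ge\sigma_0$, every $e\in\mathbb S^{n-1}$ and all $u,v\in C^{1+2s+\varepsilon}_{loc}(\mathbb R^n)\cap L^\infty(\mathbb R^n)$ (for some $\varepsilon>0$), in $\mathbb R^n$, $$(L+b\cdot\nabla)\big(\eta^2(\partial_eu)^2+\sigma u^2\big)\le2\eta^2(L+b\cdot\nabla)(\partial_eu)\,\partial_eu+2\sigma(L+b\cdot\nabla)(u)\,u,$$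 $$(L+b\cdot\nabla)\big(\eta^2(\partial_ev)_+^2+\sigma v^2\big)\le2\eta^2(L+b\cdot\nabla)(\partial_ev)\,(\partial_ev)_++2\sigma(L+b\cdot\nabla)(v)\,v.$$
   Context: $B_r$ is the open ball of radius $r$ centered at $0$; $t_+=\max\{t,0\}$. The inequalities are pointwise, wherever the derivatives involved exist. Since $\partial_eu,\partial_ev$ need not be bounded on $\mathbb R^n$, the integrals defining $L$ are understood as limits of integrals over $\{r<|x-y|<R\}$ as $r\to0$, $R\to\infty$ (with the left-hand sides allowed to equal $-\infty$). *)

(* Defs.v *)
From HB Require Import structures.
From mathcomp Require Import all_boot all_order all_algebra.
From mathcomp Require Import all_classical all_reals all_analysis.
From mathcomp Require Import measurable_realfun.

Set Implicit Arguments.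
Unset Strict Implicit.
Unset Printing Implicit Defensive.
Import Order.TTheory GRing.Theory Num.Theory.
Import numFieldNormedType.Exports.
Local Open Scope classical_set_scope.
Local Open Scope ring_scope.

Section lebesgue_rV.
Variable R : realType.

(* R^n with its Borel sigma-algebra; the topology of 'rV[R]_n (defined from the
   sup norm) is the Euclidean one. *)
Definition borel_rV n := g_sigma_algebraType (@open 'rV[R]_n).

Definition consrV n (p : measurableTypeR R * borel_rV n) : borel_rV n.+1 :=
  row_mx (p.1%:M : 'M[R]_1) (p.2 : 'rV[R]_n).

(* Lebesgue measure on R^n, built on Borel sets as the n-fold product of
   lebesgue_measure; see lebesgue_rV_box below. *)
Fixpoint lebesgue_rV n : set (borel_rV n) -> \bar R :=
  match n with
  | 0 => @dirac _ (borel_rV 0) (0 : 'rV[R]_0) R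
  | m.+1 => pushforward (@lebesgue_measure R \x @lebesgue_rV m)%E (@consrV m)
  end.

Lemma measurable_fun_rV d (T : measurableType d) n (f : T -> 'rV[R]_n) :
  (forall i, measurable_fun setT (fun t => f t 0 i)) ->
  measurable_fun setT (f : T -> borel_rV n).
Proof.
move=> mf.
have mbox (c : 'rV[R]_n) (e : R) : measurable (f @^-1` ball c e).
  have [e0|e0] := ltP 0 e; last first.
    rewrite (_ : _ @^-1` _ = set0)// -subset0 => t [].
    by rewrite ltNge e0.
  rewrite [X in measurable X](_ : _ = \bigcap_(i in [set: 'I_n])
      ((fun t => f t 0 i) @^-1` ball (c 0 i) e)).
    apply: fin_bigcap_measurable => [|i _]; first exact: finite_finset.
    rewrite -[X in measurable X]setTI; apply: mf => //.
    by apply: open_measurable; exact: ball_open.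
  apply/seteqP; split => t /=; first by move=> [_ h] i _; exact: h.
  by move=> h; split => // i j; rewrite ord1; exact: h.
apply: (@measurability _ _ T (borel_rV n) setT f (@open 'rV[R]_n) erefl).
move=> _ [U oU <-].
rewrite setTI [X in measurable X](_ : _ =
    \bigcup_(p in [set p : 'rV[rat]_n * nat |
        ball (map_mx ratr p.1 : 'rV[R]_n) p.2.+1%:R^-1 `<=` U])
      (f @^-1` ball (map_mx ratr p.1 : 'rV[R]_n) p.2.+1%:R^-1)).
  rewrite bigcup_mkcond; apply: countable_bigcupT_measurable => [|p].
    exact: countableP.
  by case: ifP => // _; exact: mbox.
apply/seteqP; split => [t /= Uft|t [p /= pU /pU//]].
have /nbhs_ballP[e /= e0 eU] := open_nbhs_nbhs (conj oU Uft).
have [k ke] : exists k : nat, (0 : R) + k.+1%:R^-1 < e / 2.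
  by apply: ltr_add_invr; rewrite divr_gt0.
rewrite add0r in ke.
have k0 : (0 : R) < k.+1%:R^-1 by rewrite invr_gt0.
have q_ i : {q : rat | `|f t 0 i - ratr q| < k.+1%:R^-1}.
  apply/cid.
  have [|q] := @rat_in_itvoo R (f t 0 i - k.+1%:R^-1) (f t 0 i + k.+1%:R^-1).
    by rewrite ltrBlDr -addrA ltrDl addr_gt0.
  rewrite in_itv/= => /andP[q1 q2]; exists q.
  by rewrite distrC ltr_distl q1.
have qt : ball (map_mx ratr (\row_i sval (q_ i)) : 'rV[R]_n) k.+1%:R^-1 (f t).
  split => // i j; rewrite !mxE ord1 /ball/= distrC.
  by case: (q_ j).
exists (\row_i sval (q_ i), k) => //= v /= qv; apply: eU.
rewrite (splitr e); apply: (@ball_triangle _ _ (map_mx ratr (\row_i sval (q_ i)) : 'rV[R]_n)).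
  by apply: ball_sym; apply: le_ball qt; exact: ltW.
by apply: le_ball qv; exact: ltW.
Qed.

Lemma measurable_coord_rV n (i : 'I_n) :
  measurable_fun [set: borel_rV n] (fun x : borel_rV n => (x : 'rV[R]_n) 0 i).
Proof.
apply: (measurability _ (RGenOpens.measurableE R)).
move=> _ [_ [a [b ->]] <-]; rewrite setTI.
apply: sub_sigma_algebra.
apply: open_comp; last exact: interval_open.
by move=> x _; exact: coord_continuous.
Qed.

Lemma measurable_consrV n : measurable_fun setT (@consrV n).
Proof.
apply: measurable_fun_rV => i; rewrite /consrV.
rewrite -[i](@splitK 1 n); case: (fintype.split (i : 'I_(1 + n))) => j /=.
  apply: (eq_measurable_fun fst) => [p _|]; last exact: measurable_fst.
  by apply: esym; apply: etrans (row_mxEl _ _ _ _) _; rewrite ord1 mxE eqxx mulr1n.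
apply: (eq_measurable_fun
    ((fun x : borel_rV n => (x : 'rV[R]_n) 0 j) \o snd)) => [p _|].
  by apply: esym; exact: row_mxEr.
by apply: measurableT_comp; [exact: measurable_coord_rV|exact: measurable_snd].
Qed.

Section cons_measure.
Variables (n : nat) (m : {sigma_finite_measure set (borel_rV n) -> \bar R}).
Let P : {measure set (measurableTypeR R * borel_rV n)%type -> \bar R} :=
  (@lebesgue_measure R \x m)%E.
Let mu := pushforward P (@consrV n).

Let mu0 : mu set0 = 0%E.
Proof. by rewrite /mu /pushforward preimage_set0; exact: (measure0 P). Qed.

Let mu_ge0 A : (0 <= mu A)%E.
Proof. exact: (measure_ge0 P). Qed.

Let mpre A : measurable A -> measurable (@consrV n @^-1` A).
Proof. by move=> mA; rewrite -[X in measurable X]setTI; exact: measurable_consrV. Qed.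

Let mu_sigma_additive : semi_sigma_additive mu.
Proof.
move=> F mF tF mUF; rewrite /mu /pushforward preimage_bigcup.
apply: measure_semi_sigma_additive.
- by move=> k; exact: mpre.
- apply/trivIsetP => /= i j _ _ ij; rewrite -preimage_setI.
  by move/trivIsetP : tF => /(_ _ _ _ _ ij) ->//; rewrite preimage_set0.
- by rewrite -preimage_bigcup; exact: mpre.
Qed.

HB.instance Definition _ := isMeasure.Build _ _ _ mu
  mu0 mu_ge0 mu_sigma_additive.

Let uncons (x : borel_rV n.+1) : measurableTypeR R * borel_rV n :=
  ((x : 'rV[R]_n.+1) 0 0, rsubmx (x : 'rV[R]_(1 + n))).

Let consrVK : cancel (@consrV n) uncons.
Proof.
move=> [a v]; rewrite /uncons /consrV /= row_mxKr; congr pair.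
rewrite (_ : 0 = lshift n (0 : 'I_1)); last exact/val_inj.
by apply: etrans (row_mxEl _ _ _ _) _; rewrite mxE eqxx mulr1n.
Qed.

Let measurable_uncons : measurable_fun setT uncons.
Proof.
apply/measurable_fun_pairP; split; first exact: measurable_coord_rV.
apply: measurable_fun_rV => i.
apply: (eq_measurable_fun (fun x : borel_rV n.+1 =>
    (x : 'rV[R]_(1 + n)) 0 (rshift 1 i))) => [x _|]; first by rewrite mxE.
exact: measurable_coord_rV.
Qed.

Let P_sigma_finite : sigma_finite setT P.
Proof.
have /sigma_finiteP[F [TF ndF Foo]] := sigma_finiteT (@lebesgue_measure R).
have /sigma_finiteP[G [TG ndG Goo]] := sigma_finiteT m.
exists (fun k => F k `*` G k) => [|k].
  rewrite -setXTT TF TG predeqE => -[x y]; split; last first.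
    by move=> [k _ []/= ? ?]; split; exists k.
  move=> [/= [i _ Fix] [j _ Gjy]]; exists (maxn i j) => //; split.
  - by move: x Fix; exact/subsetPset/ndF/leq_maxl.
  - by move: y Gjy; exact/subsetPset/ndG/leq_maxr.
have [? ?] := Foo k; have [? ?] := Goo k.
split; first exact: measurableX.
by rewrite /P /= product_measure1E// lte_mul_pinfty// ge0_fin_numE.
Qed.

Let mu_sigma_finite : sigma_finite setT mu.
Proof.
have [F FT Foo] := P_sigma_finite.
exists (fun k => uncons @^-1` F k).
  by rewrite -preimage_bigcup -FT preimage_setT.
move=> k; have [mF Fk] := Foo k; split.
  by rewrite -[X in measurable X]setTI; exact: measurable_uncons.
rewrite /mu /pushforward -comp_preimage (_ : uncons \o _ = id)//.
by apply/funext => p /=; rewrite consrVK.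
Qed.

HB.instance Definition _ := Measure_isSigmaFinite.Build _ _ _ mu
  mu_sigma_finite.

Lemma cons_measure_sigma_finite :
  exists m' : {sigma_finite_measure set (borel_rV n.+1) -> \bar R},
    m' = mu :> (set _ -> _).
Proof. by exists mu. Qed.

End cons_measure.

Lemma lebesgue_rV_measure n :
  exists m : {sigma_finite_measure set (borel_rV n) -> \bar R},
    m = @lebesgue_rV n :> (set _ -> _).
Proof.
elim: n => [|n [m mE]].
  by exists (@dirac _ (borel_rV 0) (0 : 'rV[R]_0) R).
by rewrite /= -mE; exact: cons_measure_sigma_finite.
Qed.

Let lebesgue_rV0 n : @lebesgue_rV n set0 = 0%E.
Proof. by have [m <-] := lebesgue_rV_measure n; rewrite measure0. Qed.

Let lebesgue_rV_ge0 n A : (0 <= @lebesgue_rV n A)%E.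
Proof. by have [m <-] := lebesgue_rV_measure n; exact: measure_ge0. Qed.

Let lebesgue_rV_sigma_additive n : semi_sigma_additive (@lebesgue_rV n).
Proof.
have [m <-] := lebesgue_rV_measure n; exact: measure_semi_sigma_additive.
Qed.

HB.instance Definition _ n := isMeasure.Build _ _ _ (@lebesgue_rV n)
  (@lebesgue_rV0 n) (@lebesgue_rV_ge0 n) (@lebesgue_rV_sigma_additive n).

Let lebesgue_rV_sigma_finite n : sigma_finite setT (@lebesgue_rV n).
Proof. have [m <-] := lebesgue_rV_measure n; exact: sigma_finiteT. Qed.

HB.instance Definition _ n := Measure_isSigmaFinite.Build _ _ _
  (@lebesgue_rV n) (@lebesgue_rV_sigma_finite n).

Lemma measurable_box_rV n (a b : 'rV[R]_n) :
  measurable ([set x : 'rV[R]_n | forall i, a 0 i <= x 0 i <= b 0 i]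
    : set (borel_rV n)).
Proof.
rewrite [X in measurable X](_ : _ = \bigcap_(i in [set: 'I_n])
    ((fun x : borel_rV n => (x : 'rV[R]_n) 0 i) @^-1` `[a 0 i, b 0 i])).
  apply: fin_bigcap_measurable => [|i _]; first exact: finite_finset.
  by rewrite -[X in measurable X]setTI; apply: measurable_coord_rV.
apply/seteqP; split => x /= h i; first by move=> _; rewrite /= in_itv/= h.
by have := h i I; rewrite ?in_itv.
Qed.

Lemma lebesgue_rV_box n (a b : 'rV[R]_n) : (forall i, a 0 i <= b 0 i) ->
  @lebesgue_rV n [set x : 'rV[R]_n | forall i, a 0 i <= x 0 i <= b 0 i] =
  (\prod_(i < n) (b 0 i - a 0 i))%:E.
Proof.
elim: n => [|n IHn] in a b *.
  move=> _; rewrite big_ord0 /= diracE mem_set//= => -[]//.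
move=> ab; have a0i i : a 0 (lift 0 i) = (rsubmx (a : 'rV[R]_(1 + n))) 0 i.
  by rewrite mxE; congr (a _ _); exact/val_inj.
have b0i i : b 0 (lift 0 i) = (rsubmx (b : 'rV[R]_(1 + n))) 0 i.
  by rewrite mxE; congr (b _ _); exact/val_inj.
have c0 p : (consrV p : 'rV[R]_n.+1) 0 0 = p.1.
  rewrite (_ : 0 = lshift n (0 : 'I_1)); last exact/val_inj.
  by apply: etrans (row_mxEl _ _ _ _) _; rewrite mxE eqxx mulr1n.
have ci p i : (consrV p : 'rV[R]_n.+1) 0 (lift 0 i) = (p.2 : 'rV[R]_n) 0 i.
  rewrite (_ : lift 0 i = rshift 1 i); last exact/val_inj.
  exact: row_mxEr.
rewrite big_ord_recl /= /pushforward [X in (_ \x _)%E X](_ : _ =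
    [set` `[a 0 0, b 0 0]] `*` [set x : 'rV[R]_n | forall i,
      (rsubmx (a : 'rV[R]_(1 + n))) 0 i <= x 0 i
        <= (rsubmx (b : 'rV[R]_(1 + n))) 0 i]).
  rewrite product_measure1E//; last exact: measurable_box_rV.
  rewrite EFinM; congr (_ * _)%E.
    apply: etrans (lebesgue_measure_itv _) _; rewrite /= lte_fin.
    case: ltP => // ba.
    have -> : a 0 ord0 = b 0 ord0 by apply/le_anti; rewrite ba ab.
    by rewrite subrr.
  apply: etrans (IHn _ _ _) _ => [i|]; first by rewrite -a0i -b0i.
  by congr EFin; apply: eq_bigr => i _; rewrite a0i b0i.
apply/seteqP; split => [p /= h|p /= [h0 h] i].
  split; first by have := h 0; rewrite in_itv/= c0.
  by move=> i; have := h (lift 0 i); rewrite ci a0i b0i.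
have [j ->|->] := unliftP 0 i; first by rewrite ci a0i b0i.
by move: h0; rewrite ?in_itv/= c0.
Qed.

End lebesgue_rV.

Section euclidean.
Variables (R : realType) (n : nat).
Implicit Types (x y u v : 'rV[R]_n) (f : 'rV[R]_n -> R).

Definition dot u v : R := \sum_(i < n) u 0 i * v 0 i.

(* The norm `|x| of the library on 'rV[R]_n is the sup norm, hence this one. *)
Definition enorm x : R := Num.sqrt (dot x x).

Definition eball (r : R) : set 'rV[R]_n := [set x | enorm x < r].

Definition grad f x : 'rV[R]_n := \row_i 'D_(delta_mx 0 i) f x.

End euclidean.

Section function_spaces.
Variables (R : realType) (n : nat).
Implicit Types f : 'rV[R]_n -> R.

(* For maps into R or R^m, N being the Euclidean norm of the target. *)
Definition sup_norm (V : Type) (N : V -> R) (f : 'rV[R]_n -> V) : \bar R :=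
  ereal_sup [set (N (f x))%:E | x in [set: 'rV[R]_n]].

Definition lip_seminorm (V : zmodType) (N : V -> R) (f : 'rV[R]_n -> V)
    : \bar R :=
  ereal_sup [set (N (f p.1 - f p.2) / enorm (p.1 - p.2))%:E |
              p in [set p : 'rV[R]_n * 'rV[R]_n | p.1 != p.2]].

Definition C01_norm f : \bar R :=
  (sup_norm (fun t : R => `|t|%R) f + lip_seminorm (fun t : R => `|t|%R) f)%E.

Definition C01 f : Prop := (C01_norm f < +oo)%E.

Definition C11_norm f : \bar R :=
  (sup_norm (fun t : R => `|t|%R) f + sup_norm (@enorm R n) (grad f)
   + lip_seminorm (@enorm R n) (grad f))%E.

Definition C11 f : Prop :=
  (forall x, differentiable f x) /\ (C11_norm f < +oo)%E.

(* f is C^k and its partial derivatives of order k are a-Hoelder continuous on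
   every ball (no further condition if a = 0). *)
Fixpoint Ck_holder_loc (k : nat) (a : R) f : Prop :=
  match k with
  | 0 => continuous f /\
      forall r : R, exists C : R, forall x y, eball r x -> eball r y ->
        `|f x - f y| <= C * enorm (x - y) `^ a
  | j.+1 => (forall x, differentiable f x) /\
      forall i : 'I_n, Ck_holder_loc j a ('D_(delta_mx 0 i) f)
  end.

(* C^beta_loc for beta >= 0: C^{k,a}_loc with beta = k + a, k integer and
   0 <= a < 1. *)
Definition holder_loc (beta : R) f : Prop :=
  Ck_holder_loc (Num.truncn beta) (beta - (Num.truncn beta)%:R) f.

End function_spaces.

Section operator.
Variables (R : realType) (n : nat).
Implicit Types (K : 'rV[R]_n -> \bar R) (f : 'rV[R]_n -> R) (x y b : 'rV[R]_n).
Local Open Scope ereal_scope.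

Record kernel_class (s lam Lam : R) K : Prop := {
  kernel_ge0 : forall y, 0 <= K y ;
  kernel_bounds : forall y, y != 0%R ->
    (lam * enorm y `^ (- n%:R - 2 * s))%:E <= K y
    /\ K y <= (Lam * enorm y `^ (- n%:R - 2 * s))%:E ;
  kernel_differentiable : forall y, y != 0%R -> differentiable (fine \o K) y ;
  kernel_grad : forall y, y != 0%R ->
    (enorm (grad (fine \o K) y))%:E <= (Lam * (enorm y)^-1)%:E * K y ;
  kernel_cancel : s = 2^-1%R -> forall r r' : R, (0 < r)%R -> (r < r')%R ->
    forall i : 'I_n,
    \int[@lebesgue_rV R n]_(y in eball r' `\` eball r)
      (((y : 'rV[R]_n) 0%R i)%:E * K y) = 0 }.

Definition L_integrand (s : R) f x y : R :=
  if (2^-1 < s)%R then (f x - f y - dot (grad f x) (x - y))%R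
  else (f x - f y)%R.

Definition L_trunc s K f x (r r' : R) : \bar R :=
  \int[@lebesgue_rV R n]_(y in [set y : 'rV[R]_n |
                                  (r < enorm (x - y)%R < r')%R])
    ((L_integrand s f x y)%:E * K (x - y)%R).

(* r -> 0+ and r' -> +oo, jointly *)
Definition L_filter : set_system (R * R) :=
  filter_prod (at_right (0 : R)%R) (pinfty_nbhs R).

Definition L s K f x : \bar R :=
  lim ((fun p : R * R => L_trunc s K f x p.1 p.2) @ L_filter).

(* the limit defining L f x exists in [-oo, +oo] *)
Definition L_exists s K f x : Prop :=
  cvg ((fun p : R * R => L_trunc s K f x p.1 p.2) @ L_filter).

Definition L_finite s K f x : Prop :=
  L_exists s K f x /\ L s K f x \is a fin_num.

(* L + b . grad, where b . grad is the derivative in the direction b *)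
Definition Lb s K b f x : \bar R := L s K f x + ('D_b f x)%:E.

End operator.

(* Main.v *)
(* Put w = D_e u and z = x - y, and drop the arguments x. Then
   L(eta^2 w^2) - 2 eta^2 w L w is the integral against K of
     T = - eta^2 w^2 - eta(y)^2 w(y)^2 + 2 eta^2 w w(y) - [s > 1/2] w^2 grad(eta^2) . z,
   while L(u^2) - 2 u L u = - int (u - u(y))^2 K. Fix the radius tau = k eta(x), with k small,
   and a Lipschitz cutoff psi vanishing for |z| <= tau/2 and equal to 1 for |z| >= tau.
   Close to x, T is at most w^2 times the second order difference of eta^2 plus O(|z|^2)
   (first order if s < 1/2, while the linear part cancels if s = 1/2). Far from x,
   T - 2 eta^2 w w(y) <= - eta^2 w^2 + [s > 1/2] O(eta |z|) w^2. Hence the integral of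
   T - 2 eta^2 psi w w(y) is at most - c k^(-2s) eta^(2-2s) w^2 for k small. The remaining
   term, 2 eta^2 w int psi w(y) K, is integrated by parts, as w(y) = D_e u(y) and
   |grad K| <= C |z|^-1 K; by Young's inequality it is at most a fraction of the gain plus
   sigma int (u - u(y))^2 K when sigma is large. Finally |b . grad(eta^2)| w^2 is at most
   C eta^(2-2s) w^2, because eta^(2s) is Lipschitz, and it is absorbed as well.
   For w_+ instead of w, the product w_+ w(y) <= w_+ w_+(y) has the right sign near x, and far
   from x the linear quantity w(y) itself is kept, so that it can still be integrated by parts.
   The estimates are carried out on the annuli r < |z| < R, and the inequality follows as
   r -> 0 and R -> oo. *)

Require Import Defs.
From HB Require Import structures.
From mathcomp Require Import all_boot all_order all_algebra.
From mathcomp Require Import all_classical all_reals all_analysis.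
From mathcomp Require Import measurable_realfun lra ring.

Set Implicit Arguments.
Unset Strict Implicit.
Unset Printing Implicit Defensive.
Import Order.TTheory GRing.Theory Num.Theory.
Import numFieldNormedType.Exports.
Local Open Scope classical_set_scope.
Local Open Scope ring_scope.

(** * Invariance of Lebesgue measure *)

(** Two difficulties shape the proof. First, the growth of ['D_e u] is not controlled, so its
    product with the kernel need not be absolutely integrable at infinity: its tails converge only
    thanks to integration by parts, while the operator applied to the nonnegative energy may be -oo.
    All estimates are therefore made on annuli with real-valued integrals, up to an error of order
    r'^(-1-2s), and the joint limit is cut at |z| = 1. Second, [sigma0] must not depend on the value
    eta(x), which can be arbitrarily small. This dictates tau = k eta(x): in the unit Z = eta(x)^2
    tau^(-2s), and up to the factor a(x)^2, the gain is c Z, the variation of the weight costs C k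
    Z, the drift at most 2 Cb k^(2s) Z, and Young's inequality 4 del C6 k^(-2) Z, with coefficients
    free of eta(x). So k is fixed by the first two losses, then [del] by the third, and [sigma0] is
    [(del * lam)^-1]. Where eta(x) = 0 there is no scale, but the losses vanish as well and the sign
    is immediate. *)

Section affine_invariance.
Variables (R : realType) (n : nat).
Local Notation mu := (@lebesgue_rV R n).

(** No order between [a] and [b] is required: with empty boxes included, the family is closed under
    intersection, as the pi-lambda argument demands. *)
Definition box (a b : 'rV[R]_n) : set (borel_rV R n) :=
  [set x : 'rV[R]_n | forall i, a 0 i <= x 0 i <= b 0 i].

Definition boxes : set (set (borel_rV R n)) :=
  [set A | exists a b, A = box a b].

Lemma boxI (a b c d : 'rV[R]_n) :
  box a b `&` box c d =
  box (\row_i Num.max (a 0 i) (c 0 i)) (\row_i Num.min (b 0 i) (d 0 i)).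
Proof.
apply/seteqP; split => x /=.
  move=> [h1 h2] i; rewrite !mxE ge_max le_min.
  by have /andP[-> ->] := h1 i; have /andP[-> ->] := h2 i.
by move=> h; split => i; have := h i; rewrite !mxE ge_max le_min;
   move=> /andP[/andP[? ?] /andP[? ?]]; apply/andP.
Qed.

(* Uses the identity map and the coordinate criterion [measurable_fun_rV]. *)
Lemma measurable_boxes : @measurable _ (borel_rV R n) = <<s boxes >>.
Proof.
apply/seteqP; split; last first.
  apply: smallest_sub; first exact: sigma_algebra_measurable.
  by move=> _ [a [b ->]]; exact: measurable_box_rV.
move=> A mA.
pose T := g_sigma_algebraType boxes.
suff : measurable_fun setT ((fun x : T => x : 'rV[R]_n) : T -> borel_rV R n).
  move=> /(_ measurableT A mA); rewrite setTI.
  exact.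
apply: measurable_fun_rV => i.
apply: (measurability _ (RGenCInfty.measurableE R)).
move=> _ [_ [a ->] <-]; rewrite setTI.
(* The half-space x_i >= a is exhausted by boxes with side [a, k] in direction i and [-k, k] in the
   others. *)
rewrite [X in measurable X](_ : _ = \bigcup_k (box
   (\row_j if j == i then a else - k%:R) (\row_j k%:R) : set T)).
  apply: bigcupT_measurable => k; apply: sub_sigma_algebra.
  by do 2 eexists.
apply/seteqP; split => [x /=|x [k _ /(_ i)]] /=; rewrite in_itv/= andbT; last first.
  by rewrite !mxE eqxx => /andP[].
move=> ax.
have [k hk] : exists k : nat, forall j, `|(x : 'rV[R]_n) 0 j| <= k%:R.
  exists (Num.truncn (\sum_j `|(x : 'rV[R]_n) 0 j|)).+1 => j.
  apply: ltW; apply: le_lt_trans (truncnS_gt _).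
  rewrite (bigD1 j)//= lerDl; exact: sumr_ge0.
exists k => // j; rewrite !mxE; have := hk j; rewrite ler_norml => /andP[h1 h2].
by case: eqP => [ji|_]; rewrite ?h1 h2 // ji ax.
Qed.

(** Boxes generate the Borel sets and are closed under intersection, and the cubes of half-side k
    have finite measure and exhaust the space. A box with a reversed side is empty, so the
    hypothesis need only treat ordered ones. *)
Lemma lebesgue_rV_unique (hn : (0 < n)%N) (m : {measure set (borel_rV R n) -> \bar R})
    (A : set (borel_rV R n)) :
  (forall a b : 'rV[R]_n, (forall i, a 0 i <= b 0 i) -> m (box a b) = mu (box a b)) ->
  measurable A -> m A = mu A.
Proof.
move=> h mA.
have hb a b : m (box a b) = mu (box a b).
  have [ab|] := pselect (forall i, a 0 i <= b 0 i); first exact: h.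
  move=> /existsNP[i] /negP; rewrite -ltNge => ba.
  rewrite (_ : box a b = set0) ?measure0//.
  rewrite -subset0 => x /(_ i) /andP[h1 h2].
  by have := le_lt_trans (le_trans h1 h2) ba; rewrite ltxx.
apply: (measure_unique boxes (fun k => box (\row_j - k%:R) (\row_j k%:R))) => //.
- exact: measurable_boxes.
- by move=> _ _ [a [b ->]] [c [d ->]]; rewrite boxI; do 2 eexists.
- by move=> k; do 2 eexists.
- rewrite -subTset => x _.
  exists (Num.truncn (\sum_j `|(x : 'rV[R]_n) 0 j|)).+1 => // j; rewrite !mxE.
  rewrite -ler_norml.
  apply: ltW; apply: le_lt_trans (truncnS_gt _).
  rewrite (bigD1 j)//= lerDl; exact: sumr_ge0.
- by move=> _ [a [b ->]]; exact: hb.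
- move=> k; rewrite /= hb /box lebesgue_rV_box ?ltry// => i; rewrite !mxE.
  by rewrite lerNl (le_trans _ (ler0n _ k))// oppr_le0.
Qed.

(** A single family for translations (t = 1), dilations (c = 0) and the reflection y -> x - y (c =
    x, t = -1). *)
Definition affmap (c : 'rV[R]_n) (t : R) : borel_rV R n -> borel_rV R n :=
  fun y => (c + t *: (y : 'rV[R]_n) : 'rV[R]_n).

Lemma measurable_affmap c t : measurable_fun setT (affmap c t).
Proof.
apply: measurable_fun_rV => i; rewrite /affmap.
under eq_fun do rewrite !mxE.
apply: measurable_funD; first exact: measurable_cst.
apply: measurable_funM; first exact: measurable_cst.
exact: measurable_coord_rV.
Qed.

Definition pushforward_affmap c t : {measure set (borel_rV R n) -> \bar R} :=
  measure_function_pushforward__canonical__measure_function_Measure mu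
    (measurable_affmap c t).

(** The pushforward multiplied by |t|^n agrees with Lebesgue measure on boxes, hence on all Borel
    sets. The preimage of a box is a box, whose end points trade places when t < 0. *)
Lemma affmap_lebesgue (hn : (0 < n)%N) c t (A : set (borel_rV R n)) : t != 0 ->
  measurable A ->
  mu (affmap c t @^-1` A) = ((`|t|^-1 ^+ n)%:E * mu A)%E.
Proof.
move=> t0 mA.
have tn0 : 0 <= `|t| ^+ n by rewrite exprn_ge0.
have [m mE] : exists m : {measure set (borel_rV R n) -> \bar R},
    m = mscale (NngNum tn0) (pushforward_affmap c t) :> (set _ -> _).
  by exists (mscale (NngNum tn0) (pushforward_affmap c t)).
have : m A = mu A.
  apply: lebesgue_rV_unique => // a b ab.
  rewrite mE /mscale/= /pushforward.
  have -> : affmap c t @^-1` box a b =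
     box (\row_i (((if 0 < t then a 0 i else b 0 i) - c 0 i) / t))
         (\row_i (((if 0 < t then b 0 i else a 0 i) - c 0 i) / t)).
    apply/seteqP; split => x /= h i; have := h i; rewrite !mxE.
      move=> /andP[h1 h2]; case: ltP => t0'.
        by rewrite ler_pdivrMr// ler_pdivlMr// lerBlDl lerBrDl mulrC h1.
      have {}t0' : t < 0 by rewrite lt_neqAle t0.
      by rewrite ler_ndivrMr// ler_ndivlMr// lerBlDl lerBrDl mulrC h1 h2.
    case: ltP => t0'.
      by rewrite ler_pdivrMr// ler_pdivlMr// lerBlDl lerBrDl mulrC => /andP[-> ->].
    have {}t0' : t < 0 by rewrite lt_neqAle t0.
    by rewrite ler_ndivrMr// ler_ndivlMr// lerBlDl lerBrDl mulrC => /andP[-> ->].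
  rewrite /box !lebesgue_rV_box//; last first.
    move=> i; rewrite !mxE; case: ltP => t0'.
      by rewrite ler_pM2r ?invr_gt0// lerD2r.
    have {}t0' : t < 0 by rewrite lt_neqAle t0.
    by rewrite ler_nM2r ?invr_lt0// lerD2r.
  rewrite -EFinM; congr EFin.
  have -> : `|t| ^+ n = \prod_(i < n) `|t| by rewrite prodr_const card_ord.
  rewrite -big_split/=; apply: eq_bigr => i _; rewrite !mxE.
  case: ltP => t0'; first by rewrite gtr0_norm//; field.
  by rewrite ler0_norm//; field.
rewrite mE /mscale/= /pushforward => <-.
rewrite muleA -EFinM -exprMn mulVf ?normr_eq0// expr1n mul1e//.
Qed.

Lemma ge0_integral_affmap (hn : (0 < n)%N) c t (D : set (borel_rV R n))
    (f : borel_rV R n -> \bar R) : t != 0 -> measurable D ->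
  measurable_fun D f -> (forall y, D y -> (0 <= f y)%E) ->
  (\int[mu]_(y in D) f y =
   (`|t| ^+ n)%:E * \int[mu]_(y in affmap c t @^-1` D) f (affmap c t y))%E.
Proof.
move=> t0 mD mf f0.
have tn0 : 0 <= `|t| ^+ n by rewrite exprn_ge0.
rewrite -[X in (_ * X)%E](@ge0_integral_pushforward _ _ _ _ _ _ (measurable_affmap c t) mu)//; last first.
  by move=> y; rewrite inE; exact: f0.
rewrite -(@ge0_integral_mscale _ _ _ (pushforward_affmap c t) _ mD (NngNum tn0))//.
apply: eq_measure_integral => B mB _.
apply/esym; transitivity ((`|t| ^+ n)%:E * mu (affmap c t @^-1` B))%E; first by [].
rewrite (affmap_lebesgue hn c t0 mB) muleA -EFinM -exprMn mulfV ?normr_eq0// expr1n mul1e//.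
Qed.

(** Signed integrands, for Jacobian 1 only: this serves the translations and the reflection. *)
Lemma integral_affmap (hn : (0 < n)%N) c t (D : set (borel_rV R n))
    (f : borel_rV R n -> R) : `|t| = 1 -> measurable D ->
  measurable_fun setT f -> mu.-integrable (affmap c t @^-1` D) (EFin \o (f \o affmap c t)) ->
  (\int[mu]_(y in D) (f y)%:E =
   \int[mu]_(y in affmap c t @^-1` D) (f (affmap c t y))%:E)%E.
Proof.
move=> t1 mD mf intf.
transitivity (\int[pushforward_affmap c t]_(y in D) (f y)%:E)%E.
  apply: eq_measure_integral => B mB _.
  have t0 : t != 0 by rewrite -normr_eq0 t1 oner_neq0.
  have := affmap_lebesgue hn c t0 mB.
  rewrite t1 invr1 expr1n mul1e => h. exact: esym h.
apply: (integral_pushforward (measurable_affmap c t) (f := EFin \o f)) => //.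
exact/measurable_EFinP.
Qed.

End affine_invariance.

(** * Euclidean norm and integrals over annuli *)

Section euclidean_norm.
Variables (R : realType) (n : nat).
Implicit Types (x y z u v : 'rV[R]_n).

Lemma dotC u v : dot u v = dot v u.
Proof. by apply: eq_bigr => i _; rewrite mulrC. Qed.

Lemma dotDl u v w : dot (u + v) w = dot u w + dot v w.
Proof. by rewrite /dot -big_split/=; apply: eq_bigr => i _; rewrite mxE mulrDl. Qed.

Lemma dotZl t u v : dot (t *: u) v = t * dot u v.
Proof. by rewrite /dot mulr_sumr; apply: eq_bigr => i _; rewrite mxE mulrA. Qed.

Lemma dotNl u v : dot (- u) v = - dot u v.
Proof. by rewrite -scaleN1r dotZl mulN1r. Qed.

Lemma dotDr u v w : dot w (u + v) = dot w u + dot w v.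
Proof. by rewrite dotC dotDl !(dotC w). Qed.

Lemma dotZr t u v : dot v (t *: u) = t * dot v u.
Proof. by rewrite dotC dotZl dotC. Qed.

Lemma dotNr u v : dot v (- u) = - dot v u.
Proof. by rewrite dotC dotNl dotC. Qed.

Lemma dot_ge0 u : 0 <= dot u u.
Proof. by apply: sumr_ge0 => i _; rewrite -expr2 sqr_ge0. Qed.

Lemma enorm_ge0 u : 0 <= enorm u.
Proof. exact: sqrtr_ge0. Qed.

Lemma sqr_enorm u : enorm u ^+ 2 = dot u u.
Proof. by rewrite sqr_sqrtr// dot_ge0. Qed.

Lemma coord_le_enorm u i : `|u 0 i| <= enorm u.
Proof.
rewrite -ler_sqr ?nnegrE ?enorm_ge0// sqr_enorm real_normK ?num_real//.
by rewrite /dot (bigD1 i)//= -expr2 lerDl; apply: sumr_ge0 => j _; rewrite -expr2 sqr_ge0.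
Qed.

Lemma enorm0 : enorm (0 : 'rV[R]_n) = 0.
Proof. by rewrite /enorm /dot big1 ?sqrtr0// => i _; rewrite mxE mul0r. Qed.

Lemma enorm_eq0 u : (enorm u == 0) = (u == 0).
Proof.
apply/idP/eqP => [/eqP u0|->]; last by rewrite enorm0.
apply/rowP => i; rewrite mxE; apply/normr0_eq0/le_anti.
by rewrite normr_ge0 andbT -u0 coord_le_enorm.
Qed.

Lemma enorm_gt0 u : (0 < enorm u) = (u != 0).
Proof. by rewrite lt_neqAle enorm_ge0 andbT eq_sym enorm_eq0. Qed.

Lemma enormZ t u : enorm (t *: u) = `|t| * enorm u.
Proof. by rewrite /enorm dotZl dotZr mulrA -expr2 sqrtrM ?sqr_ge0// sqrtr_sqr. Qed.

Lemma enormN u : enorm (- u) = enorm u.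
Proof. by rewrite -scaleN1r enormZ normrN1 mul1r. Qed.

Lemma enormB u v : enorm (u - v) = enorm (v - u).
Proof. by rewrite -opprB enormN. Qed.

Lemma dot_le u v : `|dot u v| <= enorm u * enorm v.
Proof.
rewrite -ler_sqr ?nnegrE ?mulr_ge0 ?enorm_ge0// real_normK ?num_real//.
rewrite exprMn !sqr_enorm.
have [a0|a0] := eqVneq (dot u u) 0.
  have /eqP : enorm u == 0 by rewrite /enorm a0 sqrtr0.
  move/eqP; rewrite enorm_eq0 => /eqP ->.
  by rewrite -(scale0r (0 : 'rV[R]_n)) !dotZl !mul0r expr0n.
have {}a0 : 0 < dot u u by rewrite lt_neqAle eq_sym a0 dot_ge0.
(* Cauchy-Schwarz: this square expands to [a * (a * c - b ^+ 2)] in the notation set below. *)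
have := dot_ge0 (dot u u *: v - dot u v *: u).
rewrite !(dotDl, dotDr, dotNl, dotNr, dotZl, dotZr) (dotC v u).
set a := dot u u; set b := dot u v; set c := dot v v => h.
have : 0 <= a * (a * c - b ^+ 2) by move: h; nra.
by rewrite pmulr_rge0// subr_ge0.
Qed.

Lemma enormD u v : enorm (u + v) <= enorm u + enorm v.
Proof.
rewrite -ler_sqr ?nnegrE ?addr_ge0 ?enorm_ge0// sqrrD !sqr_enorm.
rewrite !(dotDl, dotDr) (dotC v u).
have := le_trans (ler_norm _) (dot_le u v).
lra.
Qed.

Lemma enormB_le u v : `|enorm u - enorm v| <= enorm (u - v).
Proof.
have := enormD (u - v) v; have := enormD (v - u) u.
rewrite !subrK (enormB v u) ler_norml => ? ?; apply/andP; split; lra.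
Qed.

Lemma norm_le_enorm u : `|u| <= enorm u.
Proof.
rewrite [leLHS]/Num.norm/= mx_normrE; apply/bigmax_leP => /=; split; first exact: enorm_ge0.
by move=> [i j] _ /=; rewrite ord1 coord_le_enorm.
Qed.

Lemma coord_le_norm u i : `|u 0 i| <= `|u|.
Proof.
rewrite [leRHS]/Num.norm /= mx_normrE; apply/bigmax_geP; right => /=.
by exists (0, i).
Qed.

Lemma enorm_le_norm u : enorm u <= n%:R * `|u|.
Proof.
rewrite -ler_sqr ?nnegrE ?mulr_ge0 ?enorm_ge0// sqr_enorm exprMn.
apply: (@le_trans _ _ (n%:R * `|u| ^+ 2)).
  rewrite /dot; apply: (@le_trans _ _ (\sum_(i < n) `|u| ^+ 2)).
    apply: ler_sum => i _; rewrite -expr2 -[leLHS]real_normK ?num_real//.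
    by rewrite ler_sqr ?nnegrE// coord_le_norm.
  by rewrite sumr_const card_ord mulr_natl lexx.
rewrite ler_wpM2r ?sqr_ge0//; case: n => [|k]; first by rewrite expr0n.
by rewrite expr2 ler_peMr// ler1n.
Qed.

Lemma enorm_continuous : continuous (@enorm R n).
Proof.
move=> x; apply/(@cvgrPdist_lt _ _ _ (nbhs (x : 'rV[R]_n)) (nbhs_filter _)) => e e0.
have d0 : 0 < e / n.+1%:R by rewrite divr_gt0.
apply: (filterS _ (nbhsx_ballx x _ d0)) => y; rewrite -ball_normE/= => h.
apply: le_lt_trans (enormB_le _ _) _.
apply: le_lt_trans (enorm_le_norm _) _.
move: h; rewrite ltr_pdivlMr// mulrC => h.
by apply: le_lt_trans h; rewrite ler_wpM2r// ler_nat.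
Qed.

End euclidean_norm.

Section rV_measurable.
Variables (R : realType) (n : nat).

Definition rV_measurable (f : 'rV[R]_n -> R) :=
  measurable_fun [set: borel_rV R n] (f : borel_rV R n -> R).

Lemma continuous_rV_measurable f : continuous f -> rV_measurable f.
Proof.
move=> cf; apply: (measurability _ (RGenOpens.measurableE R)).
move=> _ [_ [a [b ->]] <-]; rewrite setTI.
apply: sub_sigma_algebra; apply: open_comp; last exact: interval_open.
by move=> x _; exact: cf.
Qed.

Lemma rV_measurable_enorm : rV_measurable (@enorm R n).
Proof. by apply: continuous_rV_measurable; exact: enorm_continuous. Qed.

(** Half-open, so that consecutive annuli partition their union; the strict truncation in [L_trunc]
    differs from it by a null sphere. *)
Definition ann (r r' : R) : set (borel_rV R n) :=
  [set z : 'rV[R]_n | r <= enorm z < r'].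

Lemma measurable_ann r r' : measurable (ann r r').
Proof.
have := @rV_measurable_enorm measurableT `[r, r'[%classic.
rewrite setTI; move=> /(_ _) h.
rewrite (_ : ann r r' = (@enorm R n : borel_rV R n -> R) @^-1` `[r, r'[%classic).
  by apply: h; exact: measurable_itv.
by apply/seteqP; split => z; rewrite /ann/= in_itv.
Qed.

Lemma lebesgue_ann_fin r r' : (@lebesgue_rV R n (ann r r') < +oo)%E.
Proof.
apply: (@le_lt_trans _ _ (@lebesgue_rV R n (box (\row_j - `|r'|) (\row_j `|r'|)))).
  apply: le_measure; rewrite ?inE; [exact: measurable_ann|exact: measurable_box_rV|].
  move=> z /= /andP[_ zr] i; rewrite !mxE -ler_norml.
  apply: le_trans (coord_le_enorm _ _) _.
  by apply: (le_trans (ltW zr)); exact: ler_norm.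
rewrite /box lebesgue_rV_box ?ltry// => i.
by rewrite !mxE lerNl (le_trans _ (normr_ge0 _))// oppr_le0.
Qed.

End rV_measurable.

Section tame.
Variables (R : realType) (n : nat).
Implicit Types (f g : 'rV[R]_n -> R).

Lemma continuous_ball_bound f (r : R) : continuous f ->
  exists2 M, 0 <= M & forall z, enorm z <= r -> `|f z| <= M.
Proof.
move=> cf; pose B := [set z : 'rV[R]_n | enorm z <= r].
have cB : compact B.
  apply: bounded_closed_compact.
    exists r; split; first exact: num_real.
    move=> M' hM' z /= hz; apply: (le_trans (norm_le_enorm z)).
    by rewrite (le_trans hz)// ltW.
  rewrite (_ : B = @enorm R n @^-1` [set t | t <= r])//.
  apply: closed_comp; last exact: closed_le.
  by move=> x _; exact: enorm_continuous.
have : compact ((fun z => `|f z|) @` B).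
  apply: continuous_compact => //; apply: continuous_subspaceT => x.
  by apply: (@continuous_comp _ _ _ f (fun t => `|t|)); [exact: cf|exact: norm_continuous].
move=> /compact_bounded[N [_ hN]].
exists `|N + 1| => // z hz.
have := hN (N + 1); rewrite ltrDl ltr01 => /(_ erefl `|f z|).
move=> h; rewrite -[leLHS]normr_id; apply: le_trans (ler_norm _).
by apply: h; exists z.
Qed.

(** Functions that may be singular at the origin and arbitrarily large at infinity, yet integrable
    on every annulus of positive inner radius. The class contains the kernel and is closed under
    sums and products, so integrability is a matter of structure. *)
Definition tame f := rV_measurable f /\
  forall r r' : R, 0 < r -> exists M, forall z, r <= enorm z < r' -> `|f z| <= M.

Lemma tame_cst c : tame (fun=> c).
Proof. by split; [exact: measurable_cst|move=> *; exists `|c|]. Qed.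

Lemma tameD f g : tame f -> tame g -> tame (fun z => f z + g z).
Proof.
move=> [mf bf] [mg bg]; split; first exact: measurable_funD.
move=> r r' r0; have [M hM] := bf r r' r0; have [N hN] := bg r r' r0.
exists (M + N) => z hz; apply: le_trans (ler_normD _ _) _.
by rewrite lerD ?hM ?hN.
Qed.

Lemma tameM f g : tame f -> tame g -> tame (fun z => f z * g z).
Proof.
move=> [mf bf] [mg bg]; split; first exact: measurable_funM.
move=> r r' r0; have [M hM] := bf r r' r0; have [N hN] := bg r r' r0.
by exists (M * N) => z hz; rewrite normrM ler_pM ?hM ?hN.
Qed.

Lemma tameZ c f : tame f -> tame (fun z => c * f z).
Proof. by move=> tf; apply: tameM => //; exact: tame_cst. Qed.

Lemma tameN f : tame f -> tame (fun z => - f z).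
Proof. by move=> /(tameZ (-1)); under eq_fun do rewrite mulN1r. Qed.

Lemma tameB f g : tame f -> tame g -> tame (fun z => f z - g z).
Proof. by move=> tf /tameN; exact: tameD. Qed.

Lemma tameX f k : tame f -> tame (fun z => f z ^+ k).
Proof.
move=> tf; elim: k => [|k ih]; first exact: tame_cst.
by under eq_fun do rewrite exprS; exact: tameM.
Qed.

Lemma tame_norm f : tame f -> tame (fun z => `|f z|).
Proof.
move=> [mf bf]; split; first exact: measurableT_comp.
move=> r r' r0; have [M hM] := bf r r' r0; exists M => z hz.
by rewrite normr_id hM.
Qed.

Lemma tame_indic (A : set (borel_rV R n)) : measurable A -> tame (\1_A).
Proof.
move=> mA; split; first exact/measurable_indicP.
by exists 1 => z _; rewrite ger0_norm// indicE; case: (_ \in _).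
Qed.

Lemma tame_continuous f : continuous f -> tame f.
Proof.
move=> cf; split; first exact: continuous_rV_measurable.
move=> r r' r0; have [M _ hM] := continuous_ball_bound r' cf.
by exists M => z /andP[_ /ltW]; exact: hM.
Qed.

Lemma tame_powR p : tame (fun z => enorm z `^ p).
Proof.
split.
  apply: (measurableT_comp (@measurable_powR R p)); exact: rV_measurable_enorm.
move=> r r' r0; exists (Num.max (r `^ p) (r' `^ p)) => z /andP[rz zr'].
rewrite ger0_norm ?powR_ge0// le_max.
have z0 := lt_le_trans r0 rz.
have [p0|p0] := leP 0 p.
  apply/orP; right; apply: ge0_ler_powR => //; rewrite ?nnegrE ?ltW//.
  exact: lt_trans zr'.
apply/orP; left; rewrite -(opprK p) (powRN r) (powRN (enorm z)).
rewrite lef_pV2 ?posrE ?powR_gt0//; apply: ge0_ler_powR => //.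
- by rewrite oppr_ge0 ltW.
- by rewrite nnegrE ltW.
- by rewrite nnegrE ltW.
Qed.

Lemma tame_ext f g : (forall z, f z = g z) -> tame f -> tame g.
Proof. by move=> /funext ->. Qed.

Lemma tame_integrable f r r' : 0 < r -> tame f ->
  (@lebesgue_rV R n).-integrable (ann r r') (EFin \o f).
Proof.
move=> r0 [mf bf]; apply: measurable_bounded_integrable.
- exact: measurable_ann.
- exact: lebesgue_ann_fin.
- exact: measurable_funTS.
have [M hM] := bf r r' r0; exists M; split; first exact: num_real.
by move=> N MN z /= hz; rewrite (le_trans (hM z hz))// ltW.
Qed.

End tame.

Section annulus_integral.
Variables (R : realType) (n : nat).
Implicit Types (f g : 'rV[R]_n -> R) (r : R).
Local Notation mu := (@lebesgue_rV R n).

Definition Iann r r' f : R := \int[mu]_(z in ann r r') f z.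

Lemma eq_Iann r r' f g : (forall z, r <= enorm z < r' -> f z = g z) ->
  Iann r r' f = Iann r r' g.
Proof. by move=> fg; apply: eq_Rintegral => z; rewrite inE; exact: fg. Qed.

Lemma IannD r r' f g : 0 < r -> tame f -> tame g ->
  Iann r r' (fun z => f z + g z) = Iann r r' f + Iann r r' g.
Proof.
move=> r0 tf tg; apply: RintegralD; [exact: measurable_ann| |];
  exact: tame_integrable.
Qed.

Lemma IannB r r' f g : 0 < r -> tame f -> tame g ->
  Iann r r' (fun z => f z - g z) = Iann r r' f - Iann r r' g.
Proof.
move=> r0 tf tg; apply: RintegralB; [exact: measurable_ann| |];
  exact: tame_integrable.
Qed.

Lemma IannZ r r' c f : 0 < r -> tame f ->
  Iann r r' (fun z => c * f z) = c * Iann r r' f.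
Proof.
move=> r0 tf; apply: RintegralZl; [exact: measurable_ann|exact: tame_integrable].
Qed.

Lemma le_Iann r r' f g : 0 < r -> tame f -> tame g ->
  (forall z, r <= enorm z < r' -> f z <= g z) -> Iann r r' f <= Iann r r' g.
Proof.
move=> r0 tf tg fg; apply: le_Rintegral => //; [exact: measurable_ann| |];
  exact: tame_integrable.
Qed.

Lemma Iann_ge0 r r' f :
  (forall z, r <= enorm z < r' -> 0 <= f z) -> 0 <= Iann r r' f.
Proof. by move=> f0; apply: Rintegral_ge0 => z; exact: f0. Qed.

Lemma normr_Iann r r' f : 0 < r -> tame f ->
  `|Iann r r' f| <= Iann r r' (fun z => `|f z|).
Proof.
move=> r0 tf; apply: le_normr_Rintegral; [exact: measurable_ann|exact: tame_integrable].
Qed.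

Lemma Iann_split r m r' f : 0 < r -> r <= m -> m <= r' -> tame f ->
  Iann r r' f = Iann r m f + Iann m r' f.
Proof.
move=> r0 rm mr' tf; rewrite /Iann.
have E : ann r r' = ann r m `|` ann m r' :> set (borel_rV R n).
  apply/seteqP; split => z /=; rewrite /ann/=.
    by move=> /andP[rz zr']; have [mz|mz] := leP m (enorm z); [right|left]; apply/andP.
  move=> [|] /andP[h1 h2]; apply/andP; split => //; first exact: lt_le_trans mr'.
  exact: le_trans h1.
rewrite E; apply: Rintegral_setU; [exact: measurable_ann|exact: measurable_ann| |].
  by rewrite -E; exact: tame_integrable.
apply/disj_setPS => z [] /= /andP[_ zm] /andP[mz _].
by have := le_lt_trans mz zm; rewrite ltxx.
Qed.

Lemma Iann_cst r r' c : Iann r r' (fun=> c) = c * fine (mu (ann r r')).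
Proof. by apply: Rintegral_cst; exact: measurable_ann. Qed.

Lemma Iann_set0 r r' f : r' <= r -> Iann r r' f = 0.
Proof.
move=> rr'; rewrite /Iann (_ : ann r r' = set0) ?Rintegral_set0//.
rewrite -subset0 => z /andP[h1 h2].
by have := lt_le_trans (le_lt_trans h1 h2) rr'; rewrite ltxx.
Qed.

Lemma Iann_scale (hn : (0 < n)%N) t r r' f : 0 < r -> 0 < t -> tame f ->
    (forall z, 0 <= f z) ->
  Iann (t * r) (t * r') f = t ^+ n * Iann r r' (fun z => f (t *: z)).
Proof.
move=> r0 t0 tf f0.
have [mf _] := tf.
have mft : rV_measurable (fun z => f (t *: z)).
  apply: eq_measurable_fun (measurableT_comp mf (measurable_affmap (0 : 'rV[R]_n) t)) => z _ /=.
  by rewrite /affmap add0r.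
have tt : tame (fun z => f (t *: z)).
  split => // a b a0; have [|M hM] := tf.2 (t * a) (t * b); first exact: mulr_gt0.
  exists M => z /andP[az zb]; apply: hM.
  by rewrite enormZ gtr0_norm// ler_pM2l// ltr_pM2l// az zb.
have -> : t ^+ n = fine (t ^+ n)%:E by [].
rewrite /Iann /Rintegral -fineM//; last first.
  by apply: integrable_fin_num; [exact: measurable_ann|exact: tame_integrable].
congr fine.
rewrite (ge0_integral_affmap hn 0 (t := t))//.
- rewrite gtr0_norm//; congr (_ * _)%E; rewrite (_ : _ @^-1` _ = ann r r').
    by apply: eq_integral => z _; rewrite /affmap add0r.
  apply/seteqP; split => z; rewrite /ann /affmap/= add0r enormZ gtr0_norm//;
    by rewrite ler_pM2l// ltr_pM2l.
- by rewrite gt_eqF.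
- exact: measurable_ann.
- by apply/measurable_EFinP; exact: measurable_funTS.
- by move=> y _; rewrite lee_fin.
Qed.

End annulus_integral.

Lemma one_powR (R : realType) (p : R) : 1 `^ p = 1.
Proof. by rewrite powR1. Qed.

(** * Power integrals over annuli, volumes of shells and spheres *)

Section radial.
Variables (R : realType) (n : nat).
Hypothesis hn : (0 < n)%N.
Implicit Types (q r t : R).
Local Notation mu := (@lebesgue_rV R n).
Local Notation P q := (fun z : 'rV[R]_n => enorm z `^ q).

(** The measure |z|^(-n) dz is invariant under dilations, which leaves the factor t^q. *)
Lemma Iann_powR_scale q t r r' : 0 < r -> 0 < t ->
  Iann (t * r) (t * r') (P (q - n%:R)) = t `^ q * Iann r r' (P (q - n%:R)).
Proof.
move=> r0 t0; rewrite (Iann_scale hn _ r0 t0 (tame_powR n _)); last first.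
  by move=> z; exact: powR_ge0.
have -> : t `^ q = t ^+ n * t `^ (q - n%:R).
  rewrite -powR_mulrn ?ltW// -powRD; last by rewrite (gt_eqF t0) implybT.
  by rewrite addrC subrK.
rewrite -mulrA; congr (_ * _); rewrite -IannZ//; last exact: tame_powR.
apply: eq_Iann => z _; rewrite enormZ gtr0_norm// powRM ?enorm_ge0// ltW//.
Qed.

Lemma Iann_powR_ge0 q r r' : 0 <= Iann r r' (P q).
Proof. by apply: Iann_ge0 => z _; exact: powR_ge0. Qed.

(* Let I be the integral. By scaling, the integral over half the annulus is 2^-q I, whence
   I <= 2^-q I + (integral over rho/2 <= |z| < rho); no dyadic sum is needed. *)
Lemma Iann_powR_inner q : 0 < q -> exists2 C, 0 <= C &
  forall r rho, 0 < r -> 0 < rho -> Iann r rho (P (q - n%:R)) <= C * rho `^ q.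
Proof.
move=> q0; pose c0 := Iann 2^-1 1 (P (q - n%:R)).
have h1 : (2^-1 : R) `^ q < 1.
  rewrite -[ltRHS](one_powR q); apply: gt0_ltr_powR; rewrite ?nnegrE//; lra.
exists (c0 / (1 - 2^-1 `^ q)).
  by rewrite divr_ge0 ?Iann_powR_ge0// subr_ge0 ltW.
move=> r rho r0 rho0; have [rr|rr] := leP rho r.
  rewrite Iann_set0// mulr_ge0 ?powR_ge0// divr_ge0 ?Iann_powR_ge0//.
  by rewrite subr_ge0 ltW.
rewrite mulrAC ler_pdivlMr ?subr_gt0// mulrBr mulr1 lerBlDr.
have t := tame_powR n (q - n%:R).
have r20 : 0 < 2^-1 * r by rewrite mulr_gt0.
have E1 : Iann (2^-1 * r) rho (P (q - n%:R)) =
    Iann (2^-1 * r) r (P (q - n%:R)) + Iann r rho (P (q - n%:R)).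
  by apply: Iann_split => //; lra.
have E2 : Iann (2^-1 * r) rho (P (q - n%:R)) =
    Iann (2^-1 * r) (2^-1 * rho) (P (q - n%:R)) + Iann (2^-1 * rho) rho (P (q - n%:R)).
  by apply: Iann_split => //; lra.
have E3 := Iann_powR_scale q rho r0 (_ : 0 < 2^-1).
have E4 : Iann (2^-1 * rho) rho (P (q - n%:R)) = rho `^ q * c0.
  by rewrite -Iann_powR_scale// mulr1 mulrC.
have := Iann_powR_ge0 (q - n%:R) (2^-1 * r) r.
rewrite E3// E4 in E2; move: E1 E2; lra.
Qed.

(** The same argument with doubling outwards: the integral I over r <= |z| < r' is at most 2^(-q) I
    plus the integral over r <= |z| < 2r. *)
Lemma Iann_powR_outer q : 0 < q -> exists2 C, 0 <= C &
  forall r r', 0 < r -> Iann r r' (P (- q - n%:R)) <= C * r `^ (- q).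
Proof.
move=> q0; pose c0 := Iann 1 2 (P (- q - n%:R)).
have h1 : (2 : R) `^ (- q) < 1.
  rewrite powRN invf_lt1 ?powR_gt0// -[ltLHS](one_powR q).
  by apply: gt0_ltr_powR; rewrite ?nnegrE//; lra.
exists (c0 / (1 - 2 `^ (- q))).
  by rewrite divr_ge0 ?Iann_powR_ge0// subr_ge0 ltW.
move=> r r' r0; have [rr|rr] := leP r' r.
  rewrite Iann_set0// mulr_ge0 ?powR_ge0// divr_ge0 ?Iann_powR_ge0//.
  by rewrite subr_ge0 ltW.
rewrite mulrAC ler_pdivlMr ?subr_gt0// mulrBr mulr1 lerBlDr.
have t := tame_powR n (- q - n%:R).
have r20 : 0 < 2 * r by rewrite mulr_gt0.
have E1 : Iann r (2 * r') (P (- q - n%:R)) =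
    Iann r r' (P (- q - n%:R)) + Iann r' (2 * r') (P (- q - n%:R)).
  by apply: Iann_split => //; lra.
have E2 : Iann r (2 * r') (P (- q - n%:R)) =
    Iann r (2 * r) (P (- q - n%:R)) + Iann (2 * r) (2 * r') (P (- q - n%:R)).
  by apply: Iann_split => //; lra.
have E3 := Iann_powR_scale (- q) r' r0 (_ : 0 < 2).
have E4 : Iann r (2 * r) (P (- q - n%:R)) = r `^ (- q) * c0.
  by rewrite -Iann_powR_scale// mulr1 mulrC.
have := Iann_powR_ge0 (- q - n%:R) r' (2 * r').
rewrite E3// E4 in E2; move: E1 E2; lra.
Qed.

Lemma lebesgue_shell_gt0 : 0 < fine (mu (@ann R n 1 2)).
Proof.
rewrite fine_gt0// lebesgue_ann_fin andbT.
pose i0 := Ordinal hn.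
(* The box [1, 3/2] x [0, 1/n]^(n-1) lies in the shell: its points have squared norm at most 9/4 + 1
   < 4. *)
pose a : 'rV[R]_n := \row_i (i == i0)%:R.
pose b : 'rV[R]_n := \row_i (if i == i0 then 3 / 2 else n%:R^-1).
have ab i : a 0 i < b 0 i.
  rewrite !mxE; case: eqP => _ /=; first lra.
  by rewrite invr_gt0 ltr0n.
have n0 : 0 < n%:R :> R by rewrite ltr0n.
apply: (@lt_le_trans _ _ (mu (box a b))).
  rewrite /box lebesgue_rV_box; last by move=> i; exact: ltW.
  by rewrite lte_fin; apply: prodr_gt0 => i _; rewrite subr_gt0.
apply: le_measure; rewrite ?inE; [exact: measurable_box_rV|exact: measurable_ann|].
move=> z zab; have zi i : 0 <= (z : 'rV[R]_n) 0 i.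
  by have /andP[h _] := zab i; apply: le_trans h; rewrite mxE.
have /andP[h1 h2] := zab i0; rewrite !mxE eqxx/= in h1 h2.
apply/andP; split.
  apply: le_trans (coord_le_enorm _ i0); rewrite ger0_norm//.
rewrite -ltr_sqr ?nnegrE ?enorm_ge0// sqr_enorm /dot (bigD1 i0)//= -expr2.
apply: (@le_lt_trans _ _ ((3/2)^+2 + 1)); last by lra.
rewrite lerD// ?ler_sqr ?nnegrE//.
apply: (@le_trans _ _ (\sum_(i < n | i != i0) n%:R^-1)).
  apply: ler_sum => i ii0; have /andP[_] := zab i; rewrite !mxE (negbTE ii0) => h.
  rewrite -[leRHS]mulr1 ler_pM//; apply: (le_trans h).
  by rewrite invf_le1// ler1n.
apply: (@le_trans _ _ (\sum_(i < n) n%:R^-1)).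
  by rewrite [leRHS](bigD1 i0)//= lerDr invr_ge0 ltW.
by rewrite sumr_const card_ord -[X in X <= _]mulr_natl mulfV ?gt_eqF.
Qed.

(** Scaling gives the equality; the constant is positive because the power is bounded below on the
    unit shell, which has positive measure. Such a shell is the source of the gain. *)
Lemma Iann_powR_shell q : exists2 c, 0 < c &
  forall r, 0 < r -> Iann r (2 * r) (P (q - n%:R)) = c * r `^ q.
Proof.
exists (Iann 1 2 (P (q - n%:R))); last first.
  by move=> r r0; rewrite [RHS]mulrC -Iann_powR_scale// mulr1 (mulrC r 2).
have [m m0 hm] : exists2 m, 0 < m &
    forall z : 'rV[R]_n, 1 <= enorm z < 2 -> m <= enorm z `^ (q - n%:R).
  have [p0|p0] := leP 0 (q - n%:R).
    exists 1 => // z /andP[z1 _]; rewrite -[leLHS](one_powR (q - n%:R)).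
    by apply: ge0_ler_powR => //; rewrite nnegrE// enorm_ge0.
  exists (2 `^ (q - n%:R)); first exact: powR_gt0.
  move=> z /andP[z1 z2]; rewrite -(opprK (q - n%:R)) (powRN 2) (powRN (enorm z)).
  have z0 : 0 < enorm z by rewrite (lt_le_trans ltr01).
  rewrite lef_pV2 ?posrE ?powR_gt0//.
  by apply: ge0_ler_powR; rewrite ?nnegrE ?oppr_ge0 ?ltW.
apply: (@lt_le_trans _ _ (Iann 1 2 (fun _ : 'rV[R]_n => m))).
  by rewrite Iann_cst mulr_gt0// lebesgue_shell_gt0.
by apply: le_Iann => //; [exact: tame_cst|exact: tame_powR].
Qed.

Lemma lebesgue_ball_scale r : 0 < r ->
  mu (@ann R n 0 r) = ((r ^+ n)%:E * mu (@ann R n 0 1))%E.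
Proof.
move=> r0.
have rV : r^-1 != 0 by rewrite invr_eq0 gt_eqF.
have := affmap_lebesgue hn 0 rV (@measurable_ann R n 0 1).
rewrite (_ : _ @^-1` _ = @ann R n 0 r); last first.
  apply/seteqP; split => z; rewrite /ann /affmap/= add0r enormZ !enorm_ge0/=;
    rewrite ?mulr_ge0 ?enorm_ge0//= gtr0_norm ?invr_gt0// mulrC ltr_pdivrMr// mul1r//.
by rewrite gtr0_norm ?invr_gt0// invrK.
Qed.

Lemma lebesgue_annE r r' : 0 < r -> r <= r' ->
  fine (mu (@ann R n r r')) = (r' ^+ n - r ^+ n) * fine (mu (@ann R n 0 1)).
Proof.
move=> r0 rr'; have r'0 := lt_le_trans r0 rr'.
have fm a b : mu (@ann R n a b) \is a fin_num.
  by rewrite ge0_fin_numE ?measure_ge0// lebesgue_ann_fin.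
have : mu (@ann R n 0 r') = (mu (@ann R n 0 r) + mu (@ann R n r r'))%E.
  rewrite -measureU; [|exact: measurable_ann|exact: measurable_ann|].
    congr (mu _); apply/seteqP; split => z; rewrite /ann/= !enorm_ge0/=.
      by move=> ->; have [mz|mz] := leP r (enorm z); [right|left].
    by move=> [h|/andP[]//]; exact: lt_le_trans rr'.
  rewrite -subset0 => z [] /= /andP[_ zm] /andP[mz _].
  by have := le_lt_trans mz zm; rewrite ltxx.
rewrite (lebesgue_ball_scale r0) (lebesgue_ball_scale r'0).
rewrite -(fineK (fm 0 1)) -(fineK (fm r r')) -!EFinM -EFinD => /(congr1 fine)/= E.
by rewrite mulrBl E addrC addKr.
Qed.

(** (r + h)^n - (r - h)^n is 2h times a sum of n products of n - 1 factors, each factor being at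
    most r + h <= 2r. *)
Lemma lebesgue_thin : exists2 C, 0 <= C & forall r h, 0 < h -> 2 * h <= r ->
  fine (mu (@ann R n (r - h) (r + h))) <= C * h * r `^ (n%:R - 1).
Proof.
exists (n%:R * 2 ^+ n * fine (mu (@ann R n 0 1))).
  by rewrite mulr_ge0 ?fine_ge0// mulr_ge0// ?exprn_ge0.
move=> r h h0 hr; have r0 : 0 < r by lra.
rewrite lebesgue_annE; [|lra|lra].
rewrite mulrC mulrAC (mulrC (_ * _) (fine _)) -!mulrA ler_wpM2l ?fine_ge0//.
have -> : r `^ (n%:R - 1) = r ^+ n.-1.
  by rewrite -powR_mulrn ?ltW// -{1}(prednK hn) -natr1 addrK.
rewrite subrXX.
have -> : r + h - (r - h) = 2 * h by ring.
rewrite -!mulrA [leRHS](_ : _ = 2 * (h * (n%:R * (2 ^+ n.-1 * r ^+ n.-1)))); last first.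
  by rewrite -{2}(prednK hn) exprS; ring.
rewrite ler_wpM2l// ler_wpM2l ?(ltW h0)//.
apply: (@le_trans _ _ (\sum_(i < n) (2 * r) ^+ n.-1)); last first.
  by rewrite sumr_const card_ord exprMn [leRHS]mulr_natl lexx.
apply: ler_sum => i _.
have -> : n.-1 = (n.-1 - i + i)%N by rewrite subnK// -ltnS prednK.
rewrite exprD addnK ler_pM ?exprn_ge0//; [lra|lra| |];
  by rewrite lerXn2r ?nnegrE//; lra.
Qed.

(** The sphere lies in every [ann r r'] with r < r', and the measure of these annuli tends to 0 as
    r' decreases to r. *)
Lemma lebesgue_sphere r : 0 < r -> mu [set z | enorm (z : 'rV[R]_n) = r] = 0%E.
Proof.
move=> r0; set S := [set z | _].
have mS : measurable (S : set (borel_rV R n)).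
  have := @rV_measurable_enorm R n measurableT [set r] (measurable_set1 r).
  by rewrite setTI.
have hS r' : r < r' -> (mu S <= mu (@ann R n r r'))%E.
  move=> rr'; apply: le_measure; rewrite ?inE//; first exact: measurable_ann.
  by move=> z /= zr; rewrite /ann/= zr lexx.
have fS : mu S \is a fin_num.
  rewrite ge0_fin_numE ?measure_ge0//.
  by apply: le_lt_trans (hS (r + 1) _) (lebesgue_ann_fin _ _ _); rewrite ltrDl.
apply/le_anti; rewrite measure_ge0 andbT -(fineK fS) lee_fin.
set w := fine (mu (@ann R n 0 1)).
apply/ler_addgt0Pr => e e0; rewrite add0r.
have w0 : 0 <= w by rewrite fine_ge0.
have cont : ((fun t : R => (t ^+ n - r ^+ n) * w) t @[t --> r]) --> (r ^+ n - r ^+ n) * w.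
  apply: cvgM; last exact: cvg_cst.
  apply: cvgB; last exact: cvg_cst.
  exact: exprn_continuous.
move: cont; rewrite subrr mul0r => /cvgrPdist_le /(_ e e0) [d /= d0 hd].
have rd : r < r + d / 2 by rewrite ltrDl divr_gt0.
have := hd (r + d / 2); rewrite /ball_/= opprD addNKr normrN gtr0_norm ?divr_gt0//.
rewrite ltr_pdivrMr// ltr_pMr// ltr1n => /(_ isT).
rewrite sub0r normrN ler_norml => /andP[_]; apply: le_trans.
rewrite -(lebesgue_annE r0 (ltW rd)) -lee_fin !fineK//; first exact: hS.
by rewrite ge0_fin_numE ?measure_ge0// lebesgue_ann_fin.
Qed.

End radial.

(** * The kernel *)

Section line_calculus.
Variables (R : realType) (n : nat).
Implicit Types (f : 'rV[R]_n -> R) (x z e v : 'rV[R]_n) (t : R).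

Lemma is_derive_line f z e t : derivable f (z + t *: e) e ->
  is_derive t 1 (fun t => f (z + t *: e)) ('D_e f (z + t *: e)).
Proof.
move=> df.
have E : (fun h : R => h^-1 *: (((fun t => f (z + t *: e)) \o shift t) (h *: 1) -
      f (z + t *: e))) =
    (fun h : R => h^-1 *: ((f \o shift (z + t *: e)) (h *: e) - f (z + t *: e))).
  apply/funext => h /=; congr (_ *: (f _ - _)).
  by rewrite scalerDl /= -[h *: 1]/(h * 1) mulr1 addrCA.
by split; rewrite /derivable /derive E.
Qed.

Lemma MVT_line f z e :
  (forall t, 0 <= t <= 1 -> derivable f (z + t *: e) e) ->
  exists2 c, 0 <= c <= 1 & f (z + e) - f z = 'D_e f (z + c *: e).
Proof.
move=> df.
have [||c] := @MVT R (fun t => f (z + t *: e)) (fun t => 'D_e f (z + t *: e)) 0 1 ltr01.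
- move=> t; rewrite in_itv/= => /andP[t0 t1]; apply: is_derive_line.
  by apply: df; rewrite !ltW.
- apply: derivable_within_continuous => t; rewrite in_itv/= => t01.
  by have [] := is_derive_line (df _ t01).
rewrite in_itv/= => /andP[c0 c1]; rewrite scale1r scale0r addr0 subr0 mulr1 => E.
by exists c => //; rewrite !ltW.
Qed.

Lemma derive_grad f x v : differentiable f x -> 'D_v f x = dot (grad f x) v.
Proof.
move=> df; rewrite deriveE// {1}(row_sum_delta v) linear_sum /dot.
by apply: eq_bigr => i _; rewrite linearZ/= mxE deriveE// mulrC.
Qed.

End line_calculus.

Section powR_extra.
Variable R : realType.
Implicit Types x y p q : R.

Lemma powR_anti p x y : p <= 0 -> 0 < x -> x <= y -> y `^ p <= x `^ p.
Proof.
move=> p0 x0 xy; have y0 := lt_le_trans x0 xy.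
rewrite -(opprK p) (powRN y) (powRN x) lef_pV2 ?posrE ?powR_gt0//.
by apply: ge0_ler_powR; rewrite ?nnegrE ?oppr_ge0//; exact: ltW.
Qed.

Lemma mul_powR p q x : 0 < x -> x `^ p * x `^ q = x `^ (p + q).
Proof. by move=> x0; rewrite powRD// (gt_eqF x0) implybT. Qed.

Lemma mulr_powR p x : 0 < x -> x * x `^ p = x `^ (1 + p).
Proof. by move=> x0; rewrite -mul_powR// powRr1// ltW. Qed.

End powR_extra.

Section kernel.
Variables (R : realType) (n : nat) (s lam Lam : R) (K : 'rV[R]_n -> \bar R).
Hypotheses (hn : (0 < n)%N) (hs : 0 < s < 1) (hlam : 0 < lam) (hLam : lam <= Lam).
Hypothesis hK : kernel_class s lam Lam K.
Local Notation mu := (@lebesgue_rV R n).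
Local Notation P q := (fun z : 'rV[R]_n => enorm z `^ (q - n%:R)).

(* K with its irrelevant, possibly infinite, value at 0 replaced by 0; powers of the norm
   also vanish at 0, so the kernel bounds hold everywhere. *)
Definition regk (z : 'rV[R]_n) : R := if z == 0 then 0 else fine (K z).

Let n0 : 0 < n%:R :> R.
Proof. by rewrite ltr0n. Qed.

Let pE : - n%:R - 2 * s = - (2 * s) - n%:R :> R.
Proof. by rewrite addrC. Qed.

Lemma kernel_fineK z : z != 0 -> K z = (fine (K z))%:E.
Proof.
move=> z0; rewrite fineK// ge0_fin_numE; last exact: kernel_ge0 hK z.
by have [_ h] := kernel_bounds hK z0; apply: le_lt_trans h _; rewrite ltry.
Qed.

Lemma regkE z : z != 0 -> K z = (regk z)%:E.
Proof. by move=> z0; rewrite /regk (negbTE z0); exact: kernel_fineK. Qed.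

Lemma powR_enorm0 : enorm (0 : 'rV[R]_n) `^ (- (2 * s) - n%:R) = 0.
Proof.
rewrite enorm0 powR0//; apply: ltr0_neq0; move: hs n0 => /andP[? ?] ?; lra.
Qed.

Lemma regk_ge z : lam * enorm z `^ (- (2 * s) - n%:R) <= regk z.
Proof.
rewrite /regk; case: eqVneq => [->|z0]; first by rewrite powR_enorm0 mulr0.
by have [h _] := kernel_bounds hK z0; rewrite -lee_fin -kernel_fineK// -pE.
Qed.

Lemma regk_le z : regk z <= Lam * enorm z `^ (- (2 * s) - n%:R).
Proof.
rewrite /regk; case: eqVneq => [->|z0]; first by rewrite powR_enorm0 mulr0.
by have [_ h] := kernel_bounds hK z0; rewrite -lee_fin -kernel_fineK// -pE.
Qed.

Lemma regk_ge0 z : 0 <= regk z.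
Proof. by apply: le_trans (regk_ge z); rewrite mulr_ge0 ?powR_ge0// ltW. Qed.

Let Lam0 : 0 < Lam.
Proof. exact: lt_le_trans hLam. Qed.

(** Regularity of K is known off the origin only: there the preimage of an open interval is open,
    and the origin belongs to the preimage exactly when the interval contains 0. *)
Lemma rV_measurable_regk : rV_measurable regk.
Proof.
apply: (measurability _ (RGenOpens.measurableE R)).
move=> _ [_ [a [b ->]] <-]; rewrite setTI.
rewrite [X in measurable X](_ : _ =
  ([set z | z != 0] `&` (fine \o K) @^-1` `]a, b[) `|`
  (if a < 0 < b then [set z | enorm z = 0] else set0)).
  apply: measurableU; last first.
    case: ifP => _ //.
    have := @rV_measurable_enorm R n measurableT [set 0] (measurable_set1 0).
    by rewrite setTI.
  apply: sub_sigma_algebra; rewrite openE => z [z0 fz].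
  have nz0 : \forall y \near z, y != 0.
    have z0' : 0 < enorm (z : 'rV[R]_n) by rewrite enorm_gt0.
    have /cvgrPdist_lt /(_ _ z0') := @enorm_continuous R n z.
    apply: filterS => y; rewrite -enorm_gt0 ltr_distl => /andP[_].
    lra.
  have fz' : \forall y \near z, (fine \o K) y \in `]a, b[.
    have := differentiable_continuous (kernel_differentiable hK z0).
    move=> /(_ [set` `]a, b[]); apply.
    apply: open_nbhs_nbhs; split => //; exact: interval_open.
  apply: filterS2 nz0 fz' => y; split => //.
apply/seteqP; split => z; rewrite /regk/=.
  case: eqVneq => [->|z0]; rewrite in_itv/= => h; last by left.
  by right; rewrite h/= enorm0.
move=> [[z0 h]|]; first by rewrite (negbTE z0).
case: ifP => //= ab; move=> /eqP; rewrite enorm_eq0 => /eqP ->.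
by rewrite eqxx in_itv.
Qed.

Lemma tame_regk : tame regk.
Proof.
split; first exact: rV_measurable_regk.
move=> r r' r0; have [M hM] := (tame_powR n (- (2 * s) - n%:R)).2 r r' r0.
exists (Lam * M) => z hz; rewrite ger0_norm ?regk_ge0//.
apply: le_trans (regk_le z) _; rewrite ler_wpM2l ?(ltW Lam0)//.
by apply: le_trans (hM z hz); exact: ler_norm.
Qed.

(** Here |z + y| >= |z| / 2, and 2^(2s+n) is the price of the halved radius. At z = 0 the hypothesis
    forces y = 0. *)
Lemma regk_shift_le z y : 2 * enorm y <= enorm z ->
  regk (z + y) <= Lam * 2 `^ (2 * s + n%:R) * enorm z `^ (- (2 * s) - n%:R).
Proof.
have [->|z0] := eqVneq z 0.
  rewrite enorm0 => y0; have : enorm y == 0 by rewrite eq_le enorm_ge0 andbT; lra.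
  rewrite enorm_eq0 => /eqP ->; rewrite addr0 /regk eqxx.
  by rewrite !mulr_ge0 ?powR_ge0 ?(ltW Lam0).
move=> yz; have ez : 0 < enorm z by rewrite enorm_gt0.
apply: le_trans (regk_le _) _; rewrite -mulrA ler_wpM2l ?(ltW Lam0)//.
apply: (@le_trans _ _ ((2^-1 * enorm z) `^ (- (2 * s) - n%:R))).
  apply: powR_anti; [by move: hs n0 => /andP[? ?] ?; lra|lra|].
  have := enormB_le (z + y) z; have := ler_norm (enorm z - enorm (z + y)).
  by rewrite distrC (addrC z) addrK; lra.
rewrite powRM ?invr_ge0// ?(ltW ez)//.
rewrite -(powR_inv1 (ltW (ltr0Sn R 1))) -powRrM mulN1r opprD !opprK//.
Qed.

(** Mean value theorem on the segment from z to z + y, which keeps a distance of at least |z| / 2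
    from the origin. One [Lam] comes from the gradient bound, the other from the size of K. *)
Lemma regk_lip z y : 2 * enorm y <= enorm z ->
  `|regk (z + y) - regk z| <=
   Lam ^+ 2 * 2 `^ (1 + 2 * s + n%:R) * enorm y * enorm z `^ (- (1 + 2 * s) - n%:R).
Proof.
have [->|z0] := eqVneq z 0.
  rewrite enorm0 => y0; have : enorm y == 0 by rewrite eq_le enorm_ge0 andbT; lra.
  rewrite enorm_eq0 => /eqP ->; rewrite addr0 subrr normr0.
  by rewrite enorm0 mulr0 mul0r.
move=> yz; have ez : 0 < enorm z by rewrite enorm_gt0.
have hy t : 0 <= t <= 1 -> 2^-1 * enorm z <= enorm (z + t *: y).
  move=> /andP[t0 t1].
  have := enormB_le (z + t *: y) z; have := ler_norm (enorm z - enorm (z + t *: y)).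
  rewrite distrC (addrC z) addrK enormZ (ger0_norm t0).
  have : t * enorm y <= enorm y by rewrite ler_piMl ?enorm_ge0.
  lra.
have hy0 t : 0 <= t <= 1 -> z + t *: y != 0.
  by move=> /hy h; rewrite -enorm_gt0; apply: lt_le_trans h; rewrite mulr_gt0.
have [|c c01 E] := @MVT_line R n (fine \o K) z y.
  by move=> t /hy0 h; apply: diff_derivable; exact: kernel_differentiable hK _ h.
have -> : regk (z + y) - regk z = (fine \o K) (z + y) - (fine \o K) z.
  rewrite /regk (negbTE z0) ifF//; apply/negbTE; rewrite -[y]scale1r hy0//.
  by rewrite ler01 lexx.
have hc := hy0 c c01.
rewrite E derive_grad; last exact: kernel_differentiable hK _ hc.
apply: le_trans (dot_le _ _) _; rewrite [leRHS]mulrAC ler_wpM2r ?enorm_ge0//.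
have := kernel_grad hK hc; rewrite (kernel_fineK hc) -EFinM lee_fin.
move=> /le_trans; apply.
have Ec : 0 < enorm (z + c *: y) by rewrite enorm_gt0.
rewrite expr2 -!mulrA ler_wpM2l ?(ltW Lam0)//.
have -> : fine (K (z + c *: y)) = regk (z + c *: y) by rewrite /regk (negbTE hc).
apply: (@le_trans _ _ ((enorm (z + c *: y))^-1 * (Lam * enorm (z + c *: y) `^ (- (2 * s) - n%:R)))).
  by rewrite ler_wpM2l ?invr_ge0 ?enorm_ge0// regk_le.
rewrite [leLHS]mulrCA ler_wpM2l ?(ltW Lam0)//.
rewrite -powR_inv1 ?enorm_ge0// mul_powR//.
apply: (@le_trans _ _ ((2^-1 * enorm z) `^ (- (1 + 2 * s) - n%:R))).
  rewrite (_ : -1 + _ = - (1 + 2 * s) - n%:R); last by ring.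
  apply: powR_anti; [by move: hs n0 => /andP[? ?] ?; lra|lra|exact: hy].
rewrite powRM ?invr_ge0// ?(ltW ez)//.
by rewrite -(powR_inv1 (ltW (ltr0Sn R 1))) -powRrM mulN1r opprD !opprK.
Qed.

(** [kernel_cancel] speaks of single coordinates; their linear combinations follow by induction on a
    list of coordinates, with tameness carried along for additivity. *)
Lemma regk_cancel r r' v : s = 2^-1 -> 0 < r ->
  Iann r r' (fun z => dot v z * regk z) = 0.
Proof.
move=> s2 r0; have [rr|rr] := leP r' r; first by rewrite Iann_set0.
have tc i : tame (fun z : 'rV[R]_n => z 0 i * regk z).
  apply: tameM; last exact: tame_regk.
  by apply: tame_continuous; exact: coord_continuous.
have hi i : Iann r r' (fun z => z 0 i * regk z) = 0.
  rewrite /Iann /Rintegral; have <- : fine (0 : \bar R) = 0 by [].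
  rewrite -(kernel_cancel hK s2 r0 rr i); congr fine.
  rewrite (_ : ann r r' = eball r' `\` eball r).
    apply: eq_integral => z; rewrite inE => -[_ /negP]; rewrite -leNgt => zr.
    rewrite regkE ?EFinM// -enorm_gt0; exact: lt_le_trans zr.
  apply/seteqP; split => z; rewrite /ann /eball/=.
    by move=> /andP[h1 h2]; split => //; apply/negP; rewrite -leNgt.
  by move=> [h1 /negP]; rewrite -leNgt => ->.
rewrite (@eq_Iann _ _ _ _ _ (fun z => \sum_(i < n) v 0 i * (z 0 i * regk z))); last first.
  by move=> z _; rewrite mulr_suml; apply: eq_bigr => i _; rewrite mulrA.
suff h : forall l : seq 'I_n,
    tame (fun z => \sum_(i <- l) v 0 i * (z 0 i * regk z)) /\
    Iann r r' (fun z => \sum_(i <- l) v 0 i * (z 0 i * regk z)) = 0.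
  by have [_ ->] := h (index_enum _).
elim=> [|i l [t1 E]].
  split.
    by apply: (@tame_ext _ _ (fun=> 0)); [move=> z; rewrite big_nil|exact: tame_cst].
  rewrite (@eq_Iann _ _ _ _ _ (fun=> 0)); first by rewrite Iann_cst mul0r.
  by move=> z _; rewrite big_nil.
have t2 := tameZ (v 0 i) (tc i).
split.
  by apply: (tame_ext _ (tameD t2 t1)) => z; rewrite big_cons.
rewrite (@eq_Iann _ _ _ _ _ (fun z => v 0 i * (z 0 i * regk z) +
   \sum_(i <- l) v 0 i * (z 0 i * regk z))); last by move=> z _; rewrite big_cons.
by rewrite IannD// E IannZ// hi mulr0 addr0.
Qed.

End kernel.

(** * Integration by parts *)

Section supported_integrals.
Variables (R : realType) (n : nat).
Hypothesis hn : (0 < n)%N.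
Implicit Types (f : 'rV[R]_n -> R) (r : R).
Local Notation mu := (@lebesgue_rV R n).

Lemma integrable_supported a b f : 0 < a -> tame f ->
  (forall z, ~~ (a <= enorm z < b) -> f z = 0) -> mu.-integrable setT (EFin \o f).
Proof.
move=> a0 tf f0; have := tame_integrable b a0 tf.
rewrite integrable_mkcond; last exact: measurable_ann.
apply: eq_integrable => // z _; rewrite /patch; case: ifPn => //.
by rewrite notin_setE /ann/= => /negP /f0 ->.
Qed.

Lemma Iann_supported a b f :
  (forall z, ~~ (a <= enorm z < b) -> f z = 0) -> \int[mu]_z f z = Iann a b f.
Proof.
move=> f0; rewrite /Iann [RHS]Rintegral_mkcond; apply: eq_Rintegral => z _.
rewrite /patch; case: ifPn => //.
by rewrite notin_setE /ann/= => /negP /f0 ->.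
Qed.

Lemma continuous_aff_comp f (v : 'rV[R]_n) (t : R) :
  continuous f -> continuous (fun z : 'rV[R]_n => f (v + t *: z)).
Proof.
move=> cf z; apply: continuous_comp; last exact: cf.
apply: (@continuousD _ _ _ (fun=> v) (fun z : 'rV[R]_n => t *: z)); first exact: cst_continuous.
exact: scaler_continuous.
Qed.

Lemma rV_measurable_aff f (v : 'rV[R]_n) (t : R) :
  rV_measurable f -> rV_measurable (fun z : 'rV[R]_n => f (v + t *: z)).
Proof.
move=> mf.
by apply: eq_measurable_fun (measurableT_comp mf (measurable_affmap v t)) => z _ /=.
Qed.

(** Both sides are integrals over the whole space, where translation invariance applies; this is why
    both functions have to vanish off the annulus. *)
Lemma Iann_translate a b f v : 0 < a -> tame f -> tame (fun z => f (v + z)) ->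
  (forall z, ~~ (a <= enorm z < b) -> f z = 0) ->
  (forall z, ~~ (a <= enorm z < b) -> f (v + z) = 0) ->
  Iann a b (fun z => f (v + z)) = Iann a b f.
Proof.
move=> a0 tf tf' f0 f0'; rewrite -Iann_supported// -[RHS]Iann_supported//.
rewrite /Rintegral; congr fine.
rewrite (@integral_affmap R n hn v 1 setT f)//.
- rewrite preimage_setT; apply: eq_integral => z _.
  by rewrite /affmap scale1r.
- by rewrite normr1.
- exact: tf.1.
- rewrite preimage_setT; apply: eq_integrable (integrable_supported a0 tf' f0') => // z _ /=.
  by rewrite /affmap scale1r.
Qed.

Lemma Iann_cvg a b (f_ : nat -> 'rV[R]_n -> R) f M : 0 < a ->
  (forall j, tame (f_ j)) -> tame f ->
  (forall j z, a <= enorm z < b -> `|f_ j z| <= M) ->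
  (forall z, a <= enorm z < b -> f_ j z @[j --> \oo] --> f z) ->
  Iann a b (f_ j) @[j --> \oo] --> Iann a b f.
Proof.
move=> a0 tf_ tf hM cf.
have [|||||_ _ h] := @dominated_convergence _ _ _ mu (ann a b) (measurable_ann a b)
  (fun j => EFin \o f_ j) (EFin \o f) (fun=> M%:E).
- by move=> j; exact: measurable_int (tame_integrable b a0 (tf_ j)).
- exact: measurable_int (tame_integrable b a0 tf).
- by apply: aeW => z hz; apply: cvg_EFin; [exact: nearW|exact: cf].
- exact: (tame_integrable b a0 (tame_cst n M)).
- by apply: aeW => z j hz; rewrite lee_fin; exact: hM.
apply: fine_cvg; rewrite fineK//.
by apply: integrable_fin_num; [exact: measurable_ann|exact: tame_integrable].
Qed.

End supported_integrals.

Section integration_by_parts.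
Variables (R : realType) (n : nat).
Hypothesis hn : (0 < n)%N.
Implicit Types (f k u : 'rV[R]_n -> R) (x e z : 'rV[R]_n) (r : R).

Lemma tame_comp_sub f x : continuous f -> tame (fun z => f (x - z)).
Proof.
move=> cf; apply: (tame_ext (f := fun z => f (x + (-1) *: z))).
  by move=> z; rewrite scaleN1r.
by apply: tame_continuous; exact: (@continuous_aff_comp R n f x (-1) cf).
Qed.

Lemma ball_bound_supported k r0 R0 : 0 < r0 -> tame k ->
  (forall z, ~~ (r0 <= enorm z < R0) -> k z = 0) ->
  exists2 M, 0 <= M & forall z, `|k z| <= M.
Proof.
move=> r00 tk k0; have [M hM] := tk.2 r0 R0 r00.
exists `|M| => // z; have [hz|/k0 ->] := boolP (r0 <= enorm z < R0).
  by apply: le_trans (hM z hz) _; exact: ler_norm.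
by rewrite normr0.
Qed.

Lemma derive_quotient u y e (h_ : nat -> R) : derivable u y e ->
  (forall j, h_ j != 0) -> h_ j @[j --> \oo] --> 0 ->
  (h_ j)^-1 * (u (y + h_ j *: e) - u y) @[j --> \oo] --> 'D_e u y.
Proof.
move=> du h0 hc.
have /cvgr_dnbhsP /(_ h_ (conj h0 hc)) := du.
by under [in X in _ -> X]eq_fun do rewrite [y + _]addrC.
Qed.

Lemma derive_scale u y e (h : R) : differentiable u y -> 'D_(h *: e) u y = h * 'D_e u y.
Proof. by move=> du; rewrite !derive_grad// dotZr. Qed.

(* D_e u is replaced by a difference quotient, whose increment is moved to k by translation
   invariance; no divergence theorem on balls is needed. *)
Lemma integration_by_parts_le u x e k r0 R0 B h0 : 0 < r0 -> 0 < h0 -> enorm e = 1 ->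
  (forall y, differentiable u y) -> continuous ('D_e u) -> tame k ->
  (forall z, ~~ (r0 <= enorm z < R0) -> k z = 0) ->
  (forall h, 0 < h -> h < h0 ->
     Iann (r0 / 2) (R0 + r0) (fun z => `|u (x - z) - u x| * `|k (h *: e + z) - k z|)
       <= h * B) ->
  `|Iann r0 R0 (fun z => 'D_e u (x - z) * k z)| <= B.
Proof.
move=> r00 h00 e1 du cw tk k0 hB.
(* A wider annulus, in which the support of [k] remains after a shift of length less than r0 / 2. *)
set a := r0 / 2; set b := R0 + r0.
have a0 : 0 < a by rewrite divr_gt0.
have ka z : ~~ (a <= enorm z < b) -> k z = 0.
  move=> hz; apply: k0; apply: contra hz => /andP[h1 h2].
  by rewrite /a /b; apply/andP; split; lra.
have -> : Iann r0 R0 (fun z => 'D_e u (x - z) * k z) =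
          Iann a b (fun z => 'D_e u (x - z) * k z).
  rewrite -Iann_supported; last by move=> z /k0 ->; rewrite mulr0.
  by rewrite -Iann_supported// => z /ka ->; rewrite mulr0.
have cu : continuous u by move=> y; exact: differentiable_continuous.
have [Kb Kb0 hKb] := ball_bound_supported r00 tk k0.
have [Mw Mw0 hMw] := continuous_ball_bound (enorm x + b + r0) cw.
pose h1 := Num.min h0 a / 2.
have h10 : 0 < h1 by rewrite divr_gt0// lt_min h00.
have m0 : 0 < Num.min h0 a by rewrite lt_min h00.
have [ma mb] : Num.min h0 a <= h0 /\ Num.min h0 a <= a.
  by rewrite !ge_min !lexx orbT.
have h1h0 : h1 < h0 by rewrite /h1; lra.
have h1a : h1 < a by rewrite /h1; lra.
(* Increments h1 / (j + 1): dominated convergence is applied along a sequence, all of whose terms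
   stay below [h0] and [a]. *)
pose h_ j := h1 * @harmonic R j.
have h_0 j : 0 < h_ j by rewrite mulr_gt0// invr_gt0.
have h_1 j : h_ j <= h1.
  by rewrite /h_ ler_piMr ?(ltW h10)// /harmonic/= invf_le1// ler1n.
have h_c : h_ j @[j --> \oo] --> 0.
  by rewrite -(mulr0 h1); apply: cvgMr; exact: cvg_harmonic.
pose f_ j z := (h_ j)^-1 * (u (x - z + h_ j *: e) - u (x - z)) * k z.
have tk' h : tame (fun z => k (h *: e + z)).
  split.
    have := rV_measurable_aff (h *: e) 1 tk.1.
    by under eq_fun do rewrite scale1r.
  by move=> *; exists Kb => z _; exact: hKb.
have tu' h : tame (fun z => u (x - z + h *: e)).
  have := tame_comp_sub (x + h *: e) cu.
  by apply: tame_ext => z; rewrite addrAC.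
have tu : tame (fun z => u (x - z)) by exact: tame_comp_sub.
have tf_ j : tame (f_ j).
  by apply: tameM => //; apply: tameZ; apply: tameB.
have ke h z : 0 < h -> h <= h1 -> ~~ (a <= enorm z < b) -> k (h *: e + z) = 0.
  move=> hp hh1 hz; apply: k0; apply: contra hz => /andP[g1 g2].
  have := enormB_le (h *: e + z) z; rewrite addrK enormZ e1 mulr1 (gtr0_norm hp).
  rewrite ler_norml => /andP[l1 l2].
  by move: h1a; rewrite /a /b => ?; apply/andP; split; lra.
have cv := @Iann_cvg R n a b f_ (fun z => 'D_e u (x - z) * k z) (Mw * Kb) a0 tf_.
have {}cv : Iann a b (f_ j) @[j --> \oo] --> Iann a b (fun z => 'D_e u (x - z) * k z).
  apply: cv.
  - by apply: tameM => //; exact: (tame_comp_sub x cw).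
  - move=> j z /andP[_ zb]; rewrite normrM ler_pM//.
    (* The mean value theorem bounds the difference quotient by the maximum of the derivative on a
       large ball, uniformly in j. *)
    have [|c /andP[c0 c1] ->] := @MVT_line R n u (x - z) (h_ j *: e).
      by move=> t _; apply: diff_derivable; exact: du.
    rewrite derive_scale// mulKf ?gt_eqF//; apply: hMw.
    apply: (le_trans (enormD _ _)).
    have := enormD x (- z); rewrite enormN scalerA enormZ e1 mulr1.
    have ch : 0 <= c * h_ j by apply: mulr_ge0 => //; exact: ltW.
    rewrite (ger0_norm ch).
    have : c * h_ j <= h_ j by rewrite ler_piMl ?(ltW (h_0 j)).
    have := h_1 j; move: h1a; rewrite /a; lra.
  - move=> z _; apply: cvgM; last exact: cvg_cst.
    apply: derive_quotient => //.
      by apply: diff_derivable; exact: du.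
    by move=> j; rewrite gt_eqF.
have bnd j : `|Iann a b (f_ j)| <= B.
  have hj0 := h_0 j; have hj1 := h_1 j.
  set h := h_ j in hj0 hj1 *.
  pose U z := u (x - z) - u x.
  have tU : tame U by apply: tameB => //; exact: tame_cst.
  have tU' : tame (fun z => u (x - z + h *: e) - u x) by apply: tameB => //; exact: tame_cst.
  (* Subtracting [u x] from both values of u is free, and translating the first term by [h *: e]
     leaves the increment on [k]. The presence of [u x] is what later allows a bound by the energy
     of u. *)
  have -> : Iann a b (f_ j) = h^-1 * Iann a b (fun z => U z * (k (h *: e + z) - k z)).
    rewrite (@eq_Iann _ _ _ _ (f_ j) (fun z => h^-1 * ((u (x - z + h *: e) - u x) * k z - U z * k z))); last first.
      by move=> z _; rewrite /f_ /U -/h; ring.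
    rewrite IannZ//; last by apply: tameB; apply: tameM.
    congr (_ * _); rewrite IannB//; [|exact: tameM|exact: tameM].
    rewrite (@eq_Iann _ _ _ _ (fun z => U z * (k (h *: e + z) - k z)) (fun z => U z * k (h *: e + z) - U z * k z)); last first.
      by move=> z _; rewrite mulrBr.
    rewrite IannB//; [|exact: tameM|exact: tameM].
    congr (_ - _).
    pose F z := (u (x - z + h *: e) - u x) * k z.
    have FE z : F (h *: e + z) = U z * k (h *: e + z).
      by rewrite /F /U (_ : x - _ + _ = x - z)// opprD addrA addrAC subrK.
    rewrite -(@Iann_translate _ _ hn a b F (h *: e))//.
    - by apply: eq_Iann => z _; rewrite FE.
    - exact: tameM.
    - by apply: (tame_ext (f := fun z => U z * k (h *: e + z))); [move=> z; rewrite FE|exact: tameM].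
    - by move=> z /ka; rewrite /F => ->; rewrite mulr0.
    - by move=> z hz; rewrite FE ke ?mulr0.
  rewrite normrM ger0_norm ?invr_ge0 ?(ltW hj0)// ler_pdivrMl//.
  apply: le_trans (hB h hj0 (le_lt_trans hj1 h1h0)).
  apply: le_trans (normr_Iann _ a0 _) _; first by apply: tameM => //; exact: tameB.
  apply: le_Iann => //.
  - by apply: tame_norm; apply: tameM => //; exact: tameB.
  - by apply: tameM; apply: tame_norm => //; exact: tameB.
  - by move=> z _; rewrite normrM.
have /cvg_norm := cv.
move=> /cvgr_to_le; apply.
exact: nearW.
Qed.

End integration_by_parts.

(** * The radial cutoff and its product with the kernel *)

Section cutoff.
Variables (R : realType) (n : nat).
Implicit Types (t r h : R) (x y z : 'rV[R]_n).

(** The psi of the overview at scale t: a ramp in |z| of slope 2 / t between the radii t / 2 and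
    t. *)
Definition cutoff t z : R := Num.min 1 (Num.max 0 (2 * enorm z / t - 1)).

Lemma cutoff_ge0 t z : 0 <= cutoff t z.
Proof. by rewrite /cutoff le_min ler01 le_max lexx. Qed.

Lemma cutoff_le1 t z : cutoff t z <= 1.
Proof. by rewrite /cutoff ge_min lexx. Qed.

Lemma cutoff0 t z : 0 < t -> enorm z <= t / 2 -> cutoff t z = 0.
Proof.
move=> t0 zt; rewrite /cutoff max_l; first by rewrite min_r.
by rewrite lerBlDr add0r ler_pdivrMr// mul1r; lra.
Qed.

Lemma cutoff1 t z : 0 < t -> t <= enorm z -> cutoff t z = 1.
Proof.
move=> t0 zt; rewrite /cutoff min_l// le_max; apply/orP; right.
by rewrite lerBrDr ler_pdivlMr//; lra.
Qed.

Lemma max0_lip (p q : R) : `|Num.max 0 p - Num.max 0 q| <= `|p - q|.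
Proof.
have := ler_norm (p - q); have := ler_norm (q - p); rewrite (distrC q) ler_norml.
by case: (leP 0 p) => ?; case: (leP 0 q) => ? ? ?; apply/andP; split; lra.
Qed.

Lemma min1_lip (p q : R) : `|Num.min 1 p - Num.min 1 q| <= `|p - q|.
Proof.
have := ler_norm (p - q); have := ler_norm (q - p); rewrite (distrC q) ler_norml.
by case: (leP 1 p) => ?; case: (leP 1 q) => ? ? ?; apply/andP; split; lra.
Qed.

Lemma cutoff_lip t z y : 0 < t -> `|cutoff t z - cutoff t y| <= 2 / t * enorm (z - y).
Proof.
move=> t0.
have h1 : `|2 * enorm z / t - 1 - (2 * enorm y / t - 1)| <= 2 / t * enorm (z - y).
  rewrite (_ : _ - _ = 2 / t * (enorm z - enorm y)); last by ring.
  rewrite normrM ger0_norm ?divr_ge0 ?(ltW t0)// ler_wpM2l ?divr_ge0 ?(ltW t0)//.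
  exact: enormB_le.
apply: le_trans h1; rewrite /cutoff.
exact: le_trans (min1_lip _ _) (max0_lip _ _).
Qed.

Lemma tame_cutoff t : tame (cutoff t).
Proof.
have te : tame (fun z : 'rV[R]_n => 2 * enorm z / t - 1).
  apply: tameB; last exact: tame_cst.
  apply: tameM; last exact: tame_cst.
  by apply: tameZ; apply: tame_continuous; exact: enorm_continuous.
split; last by move=> *; exists 1 => z _; rewrite ger0_norm ?cutoff_ge0// cutoff_le1.
apply: measurable_minr; first exact: measurable_cst.
by apply: measurable_maxr; [exact: measurable_cst|exact: te.1].
Qed.

Definition ind r r' z : R := if r <= enorm z < r' then 1 else 0.

Lemma tame_ind r r' : tame (ind r r').
Proof.
apply: (tame_ext _ (tame_indic (measurable_ann r r'))) => z.
by rewrite indicE /ind; case: ifPn => h; [rewrite mem_set|rewrite memNset//=; exact/negP].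
Qed.

Lemma Iann_ind a b r r' f : 0 < a -> a <= r -> r <= r' -> r' <= b -> tame f ->
  Iann a b (fun z => ind r r' z * f z) = Iann r r' f.
Proof.
move=> a0 ar rr rb tf.
have t1 : tame (fun z => ind r r' z * f z) by apply: tameM => //; exact: tame_ind.
rewrite (@Iann_split _ _ a r b)//; last exact: le_trans rb.
rewrite (@Iann_split _ _ r r' b)//; last exact: lt_le_trans ar.
rewrite (@eq_Iann _ _ a r _ (fun=> 0)); last first.
  by move=> z /andP[_ h]; rewrite /ind leNgt h mul0r.
rewrite (@eq_Iann _ _ r' b _ (fun=> 0)); last first.
  by move=> z /andP[h _]; rewrite /ind (ltNge _ r') h andbF mul0r.
rewrite (@eq_Iann _ _ r r' _ f); last by move=> z h; rewrite /ind h mul1r.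
by rewrite !Iann_cst !mul0r add0r addr0.
Qed.

End cutoff.

Section cutoff_kernel.
Variables (R : realType) (n : nat) (s lam Lam : R).
Hypotheses (hn : (0 < n)%N) (hs : 0 < s < 1) (hlam : 0 < lam) (hLam : lam <= Lam).
Implicit Types (u : 'rV[R]_n -> R) (x e z : 'rV[R]_n) (t h : R).

Let Lam0 : 0 < Lam.
Proof. exact: lt_le_trans hLam. Qed.

Definition c_shift : R := Lam * 2 `^ (2 * s + n%:R).

(** The two terms of a product rule: the slope of the cutoff against the size of the kernel, then
    the increment of the kernel as in [regk_lip]. *)
Definition c_lip : R := 4 * c_shift + Lam ^+ 2 * 2 `^ (1 + 2 * s + n%:R).

Lemma c_shift_ge0 : 0 <= c_shift.
Proof. by rewrite mulr_ge0 ?powR_ge0// ltW. Qed.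

Lemma c_lip_ge0 : 0 <= c_lip.
Proof. by rewrite addr_ge0// mulr_ge0 ?c_shift_ge0 ?powR_ge0 ?exprn_ge0// ltW. Qed.

Lemma cutoff_kernel_lip K t z y : kernel_class s lam Lam K -> 0 < t ->
  8 * enorm y <= t ->
  `|cutoff t (y + z) * regk K (y + z) - cutoff t z * regk K z| <=
  enorm y * c_lip * enorm z `^ (- (1 + 2 * s) - n%:R).
Proof.
move=> hK t0 yt; have y0 := enorm_ge0 y.
(* Below t / 4 the shifted point still has norm at most t / 2, and both cutoffs vanish. *)
have [zt|zt] := ltP (enorm z) (t / 4).
  rewrite !cutoff0//; [|lra|by apply: le_trans (enormD _ _) _; lra].
  by rewrite !mul0r subrr normr0 !mulr_ge0 ?c_lip_ge0 ?powR_ge0.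
have z0 : 0 < enorm z by lra.
have yz : 2 * enorm y <= enorm z by lra.
rewrite (_ : _ - _ = (cutoff t (y + z) - cutoff t z) * regk K (y + z) +
   cutoff t z * (regk K (y + z) - regk K z)); last by ring.
apply: le_trans (ler_normD _ _) _.
rewrite /c_lip (mulrDr (enorm y)) mulrDl; apply: lerD; last first.
  rewrite normrM ger0_norm ?cutoff_ge0// (addrC y).
  apply: (@le_trans _ _ (`|regk K (z + y) - regk K z|)).
    by rewrite ler_piMl// cutoff_le1.
  apply: le_trans (regk_lip hn hs hlam hLam hK yz) _.
  by rewrite le_eqVlt; apply/orP; left; apply/eqP; ring.
rewrite normrM (ger0_norm (regk_ge0 hn hs hlam hK _)).
(* The slope 2 / t is at most 4 / |z| as long as |z| <= 2t; beyond, both cutoffs are 1. *)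
have h1 : `|cutoff t (y + z) - cutoff t z| <= 4 * enorm y * (enorm z)^-1.
  have [zt2|zt2] := leP (enorm z) (2 * t).
    apply: le_trans (cutoff_lip _ _ t0) _; rewrite addrK.
    rewrite (_ : 4 * _ * _ = 4 / enorm z * enorm y); last by ring.
    rewrite ler_wpM2r// ler_pdivrMr// mulrAC ler_pdivlMr//; lra.
  rewrite !cutoff1// ?subrr ?normr0; [by rewrite !mulr_ge0 ?invr_ge0 ?enorm_ge0|lra|].
  by have := enormB_le (y + z) z; rewrite addrK ler_norml => /andP[]; lra.
apply: (@le_trans _ _ (4 * enorm y * (enorm z)^-1 * (c_shift * enorm z `^ (- (2 * s) - n%:R)))).
  apply: ler_pM => //; first exact: regk_ge0 hK _.
  by rewrite (addrC y); exact: regk_shift_le hK _ _ yz.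
have -> : enorm z `^ (- (1 + 2 * s) - n%:R) = (enorm z)^-1 * enorm z `^ (- (2 * s) - n%:R).
  rewrite -powR_inv1 ?enorm_ge0// mul_powR//; congr (_ `^ _); ring.
by rewrite le_eqVlt; apply/orP; left; apply/eqP; ring.
Qed.

(* The last term comes from the sharp truncation |z| < r, which is crossed on a shell of
   width 2h. *)
Lemma cutoff_parts : exists2 C, 0 <= C & forall K u x e Mu t r,
  kernel_class s lam Lam K -> enorm e = 1 ->
  (forall y, differentiable u y) -> continuous ('D_e u) ->
  (forall y, `|u y| <= Mu) -> 0 < t -> t <= r ->
  `|Iann (t / 2) r (fun z => 'D_e u (x - z) * (cutoff t z * regk K z))| <=
  c_lip * Iann (t / 4) r (fun z => `|u (x - z) - u x| * enorm z `^ (- (1 + 2 * s) - n%:R))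
  + C * Mu * r `^ (- (1 + 2 * s)).
Proof.
have [C1 C10 hC1] := lebesgue_thin R hn.
exists (2 * c_shift * 2 `^ (2 * s + n%:R) * C1).
  apply: mulr_ge0 => //; apply: mulr_ge0; last exact: powR_ge0.
  by apply: mulr_ge0 => //; exact: c_shift_ge0.
move=> K u x e Mu t r hK e1 du cw uM t0 tr.
have Mu0 : 0 <= Mu by apply: le_trans (uM 0).
have r0 : 0 < r by exact: lt_le_trans tr.
pose kap z := cutoff t z * regk K z.
have tk : tame kap by apply: tameM; [exact: tame_cutoff|exact: tame_regk hK].
pose k z := ind (t / 2) r z * kap z.
have cu : continuous u by move=> y; exact: differentiable_continuous.
have tu := tame_comp_sub x cu; have tw := tame_comp_sub x cw.
have tkk : tame k by apply: tameM => //; exact: tame_ind.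
rewrite (@eq_Iann _ _ _ _ _ (fun z => 'D_e u (x - z) * k z)); last first.
  by move=> z hz; rewrite /k /ind hz mul1r.
have tU : tame (fun z => `|u (x - z) - u x|).
  by apply: tame_norm; apply: tameB => //; exact: tame_cst.
have tP := tame_powR n (- (1 + 2 * s) - n%:R) : tame _.
have kap0 z : enorm z < t / 2 -> kap z = 0.
  by move=> h; rewrite /kap cutoff0 ?mul0r// ltW.
have kapE z : k z = (if enorm z < r then kap z else 0).
  rewrite /k /ind; have [zr|zr] := ltP (enorm z) r; last by rewrite andbF mul0r.
  by rewrite andbT; case: leP => h; rewrite ?mul1r// kap0 ?mul0r.
(* Bounds the increment of u times the kernel near the sphere |z| = r, where |z| >= r / 2. *)
pose cb := 2 * Mu * (c_shift * (2^-1 * r) `^ (- (2 * s) - n%:R)).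
have cb0 : 0 <= cb.
  apply: mulr_ge0; first exact: mulr_ge0.
  by apply: mulr_ge0; [exact: c_shift_ge0|exact: powR_ge0].
apply: (@integration_by_parts_le R n hn u x e k (t / 2) r _ (t / 8)) => //.
- by rewrite divr_gt0.
- by rewrite divr_gt0.
- by move=> z hz; rewrite /k /ind (negbTE hz) mul0r.
move=> h h0 ht.
have -> : t / 2 / 2 = t / 4 by field.
have th v : tame (fun z => k (v + z)).
  split.
    have := rV_measurable_aff v 1 tkk.1.
    by under eq_fun do rewrite scale1r.
  have [||Kb Kb0 hKb] := @ball_bound_supported R n k (t / 2) r _ tkk.
  - by rewrite divr_gt0.
  - by move=> z hz; rewrite /k /ind (negbTE hz) mul0r.
  by move=> *; exists Kb => z _; exact: hKb.
(* If z and [h *: e + z] both lie inside the truncation, [c_lip] controls the increment; if exactly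
   one does, z is within h of the sphere and the full size [cb] is paid. *)
apply: (@le_trans _ _ (Iann (t / 4) (r + t / 2)
    (fun z => h * c_lip * (ind (t / 4) r z * (`|u (x - z) - u x| * enorm z `^ (- (1 + 2 * s) - n%:R)))
      + cb * (ind (r - h) (r + h) z * 1)))).
  apply: le_Iann; first by rewrite divr_gt0.
  - by apply: tameM => //; apply: tame_norm; apply: tameB.
  - apply: tameD; apply: tameZ; apply: tameM; try exact: tame_ind; last exact: tame_cst.
    exact: tameM.
  move=> z /andP[z1 z2].
  have he : enorm (h *: e) = h by rewrite enormZ e1 mulr1 gtr0_norm.
  have U0 := normr_ge0 (u (x - z) - u x).
  have UM : `|u (x - z) - u x| <= 2 * Mu.
    apply: le_trans (ler_normB _ _) _; have := uM (x - z); have := uM x; lra.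
  have dz := enormB_le (h *: e + z) z; rewrite addrK he ler_norml in dz.
  have hl := @cutoff_kernel_lip K t z (h *: e) hK t0; rewrite he in hl.
  have {}hl := hl ltac:(lra).
  have p0 : 0 <= enorm z `^ (- (1 + 2 * s) - n%:R) by exact: powR_ge0.
  have T2 : 0 <= cb * (ind (r - h) (r + h) z * 1).
    by rewrite /ind; case: ifP; rewrite ?mul0r ?mulr0 ?mulr1.
  have T1 : 0 <= h * c_lip * (ind (t / 4) r z * (`|u (x - z) - u x| * enorm z `^ (- (1 + 2 * s) - n%:R))).
    rewrite !mulr_ge0 ?c_lip_ge0 ?(ltW h0)//.
    by rewrite /ind; case: ifP.
  rewrite !kapE.
  have bk y : `|kap (y)| <= regk K y.
    rewrite /kap normrM !ger0_norm ?cutoff_ge0 ?(regk_ge0 hn hs hlam hK)//.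
    by rewrite ler_piMl ?(regk_ge0 hn hs hlam hK)// cutoff_le1.
  have far y : enorm y <= h -> r - h <= enorm z ->
      `|u (x - z) - u x| * regk K (y + z) <= cb.
    move=> yh zr; apply: ler_pM => //; first exact: regk_ge0 hK _.
    rewrite (addrC y); apply: le_trans (regk_shift_le hn hs hlam hLam hK _) _; first lra.
    rewrite -/c_shift ler_wpM2l ?c_shift_ge0//; apply: powR_anti; [|lra|lra].
    have : 0 < n%:R :> R by rewrite ltr0n.
    move: hs => /andP[? ?] ?; lra.
  have farb y : enorm y <= h -> r - h <= enorm z < r + h ->
      `|u (x - z) - u x| * `|kap (y + z)| <= cb * (ind (r - h) (r + h) z * 1).
    move=> yh /andP[zr zr2]; rewrite /ind zr zr2 !mulr1.
    by apply: le_trans (far y yh zr); rewrite ler_wpM2l.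
  have [z'r|z'r] := ltP (enorm (h *: e + z)) r; have [zr|zr] := ltP (enorm z) r.
  - rewrite -[leLHS]addr0; apply: lerD => //.
    rewrite /ind z1 zr mul1r mulrCA ler_wpM2l//.
  - rewrite subr0 -[leLHS]add0r; apply: lerD => //.
    by apply: farb; rewrite ?he//; move: dz zr z'r; clear => /andP[? ?] ? ?; apply/andP; split; lra.
  - rewrite sub0r normrN -[leLHS]add0r; apply: lerD => //.
    have := farb 0; rewrite add0r enorm0; apply; first exact: ltW.
    by move: dz zr z'r; clear => /andP[? ?] ? ?; apply/andP; split; lra.
  - by rewrite subrr normr0 mulr0 addr_ge0.
have t4 : 0 < t / 4 by rewrite divr_gt0.
have tUP : tame (fun z => `|u (x - z) - u x| * enorm z `^ (- (1 + 2 * s) - n%:R)) by exact: tameM.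
rewrite IannD//; last 2 first.
- by apply: tameZ; apply: tameM => //; exact: tame_ind.
- by apply: tameZ; apply: tameM; [exact: tame_ind|exact: tame_cst].
rewrite IannZ//; last by apply: tameM => //; exact: tame_ind.
rewrite IannZ//; last by apply: tameM; [exact: tame_ind|exact: tame_cst].
rewrite Iann_ind//; [|lra|lra].
rewrite Iann_ind//; [|lra|lra|lra|exact: tame_cst].
rewrite Iann_cst mul1r [leRHS]mulrDr [X in _ <= X + _]mulrA lerD2l.
(* The shell has measure O(h r^(n-1)): one factor h, as the difference quotient requires, and
   r^(-2s-n) r^(n-1) = r^(-1-2s). *)
apply: (@le_trans _ _ (cb * (C1 * h * r `^ (n%:R - 1)))).
  by rewrite ler_wpM2l// hC1//; lra.
rewrite /cb powRM ?invr_ge0// ?(ltW r0)//.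
have -> : (2^-1 : R) `^ (- (2 * s) - n%:R) = 2 `^ (2 * s + n%:R).
  by rewrite -(powR_inv1 (ltW (ltr0Sn R 1))) -powRrM mulN1r opprD !opprK.
have -> : r `^ (- (1 + 2 * s)) = r `^ (- (2 * s) - n%:R) * r `^ (n%:R - 1).
  rewrite mul_powR//; congr (_ `^ _); ring.
by rewrite le_eqVlt; apply/orP; left; apply/eqP; ring.
Qed.

End cutoff_kernel.

(** * Limits of truncated integrals *)

Section radial_limits.
Variables (R : realType) (n : nat).
Implicit Types (g : 'rV[R]_n -> R) (r C beta l : R).

(** Cauchy criterion: two truncated integrals differ by the integral over an annulus of small outer
    radius. *)
Lemma cvg_Iann_inner g C beta : tame g -> 0 < beta ->
  (forall r r', 0 < r -> r < r' -> r' <= 1 -> `|Iann r r' g| <= C * r' `^ beta) ->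
  exists l, Iann r 1 g @[r --> 0^'+] --> l.
Proof.
move=> tg b0 hC.
suff /cauchy_cvgP h : cauchy (Iann r 1 g @[r --> 0^'+]).
  by exists (lim (Iann r 1 g @[r --> 0^'+])).
apply: cauchy_exP => e e0.
have C1 : 0 < `|C| + 1 by rewrite ltr_wpDl.
(* Chosen with (|C| + 1) d^beta <= e; the added 1 yields a strict inequality and a nonzero
   denominator. *)
pose d := Num.min 1 ((e / (`|C| + 1)) `^ beta^-1).
have d0 : 0 < d by rewrite lt_min ltr01/= powR_gt0// divr_gt0.
have d1 : d <= 1 by rewrite ge_min lexx.
exists (Iann d 1 g).
suff : \forall r \near 0^'+, ball (Iann d 1 g) e (Iann r 1 g) by [].
near=> r.
have r0 : 0 < r by near: r; exact: nbhs_right_gt.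
have rd : r < d by near: r; exact: nbhs_right_lt.
rewrite /ball/= (Iann_split r0 (ltW rd) d1 tg) opprD addrCA subrr addr0 normrN.
apply: le_lt_trans (hC r d r0 rd d1) _.
apply: (@le_lt_trans _ _ (`|C| * d `^ beta)).
  by rewrite ler_wpM2r ?powR_ge0// ler_norm.
apply: (@lt_le_trans _ _ ((`|C| + 1) * d `^ beta)).
  by rewrite ltr_pM2r ?powR_gt0// ltrDl.
rewrite -ler_pdivlMl// mulrC.
apply: (@le_trans _ _ (((e / (`|C| + 1)) `^ beta^-1) `^ beta)).
  apply: ge0_ler_powR; rewrite ?nnegrE ?(ltW b0) ?(ltW d0) ?powR_ge0//.
  by rewrite ge_min lexx orbT.
by rewrite -powRrM mulVf ?gt_eqF// powRr1// divr_ge0 ?(ltW e0) ?(ltW C1).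
Unshelve. all: by end_near. Qed.

Lemma cvg_powRN C beta : 0 < beta -> (C * r `^ (- beta)) @[r --> +oo] --> 0.
Proof.
move=> b0; apply/cvgrPdist_lt => e e0.
have C1 : 0 < `|C| + 1 by rewrite ltr_wpDl.
pose d := (e / (`|C| + 1)) `^ (- beta^-1).
near=> r.
have r0 : 0 < r by near: r; exact: nbhs_pinfty_gt.
have rd : d < r by near: r; apply: nbhs_pinfty_gt; exact: num_real.
rewrite sub0r normrN normrM (ger0_norm (powR_ge0 _ _)).
apply: (@lt_le_trans _ _ ((`|C| + 1) * r `^ (- beta))).
  by rewrite ltr_pM2r ?powR_gt0// ltrDl.
rewrite -ler_pdivlMl// mulrC.
have ec : 0 < e / (`|C| + 1) by rewrite divr_gt0.
apply: (@le_trans _ _ (d `^ (- beta))).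
  by apply: powR_anti; [rewrite oppr_le0 ltW|rewrite powR_gt0|exact: ltW].
by rewrite /d -powRrM mulrNN mulVf ?gt_eqF// powRr1// ltW.
Unshelve. all: by end_near. Qed.

Lemma cvg_Iann_outer g C beta : tame g -> 0 < beta ->
  (forall r r', 1 <= r -> r <= r' -> `|Iann r r' g| <= C * r `^ (- beta)) ->
  exists l, Iann 1 r g @[r --> +oo] --> l.
Proof.
move=> tg b0 hC.
suff /cauchy_cvgP h : cauchy (Iann 1 r g @[r --> +oo]).
  by exists (lim (Iann 1 r g @[r --> +oo])).
apply: cauchy_exP => e e0.
have /cvgrPdist_lt /(_ e e0) := cvg_powRN C b0.
move=> /(pinfty_ex_gt (num_real (1 : R))) [d d1]; rewrite sub0r normrN => hd.
exists (Iann 1 d g).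
suff : \forall r \near +oo, ball (Iann 1 d g) e (Iann 1 r g) by [].
near=> r.
have rd : d <= r by near: r; apply: nbhs_pinfty_ge; exact: num_real.
rewrite /ball/= (Iann_split ltr01 (ltW d1) rd tg) opprD addrA subrr sub0r normrN.
apply: le_lt_trans hd; apply: le_trans (hC d r (ltW d1) rd) _; exact: ler_norm.
Unshelve. all: by end_near. Qed.

Global Instance L_filter_proper : ProperFilter (@L_filter R).
Proof. exact: filter_prod_proper. Qed.

Lemma near_L_filter (r0 R0 : R) : 0 < r0 ->
  \forall p \near @L_filter R, 0 < p.1 /\ p.1 < r0 /\ R0 < p.2.
Proof.
move=> r00; exists ([set r | 0 < r /\ r < r0], [set r | R0 < r]); last first.
  by move=> [a b] [/= [? ?] ?].
split => /=.
  by near=> r; split; near: r; [exact: nbhs_right_gt|exact: nbhs_right_lt].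
by near=> r; near: r; apply: nbhs_pinfty_gt; exact: num_real.
Unshelve. all: by end_near. Qed.

(** Cutting at |z| = 1 separates the joint limit into two limits in one variable. Only the outer one
    may be infinite, so the sum is defined. *)
Lemma cvg_Iann_ereal g (l0 : R) (l1 : \bar R) : tame g ->
  Iann r 1 g @[r --> 0^'+] --> l0 ->
  (Iann 1 r g)%:E @[r --> +oo] --> l1 ->
  (Iann p.1 p.2 g)%:E @[p --> @L_filter R] --> (l0%:E + l1)%E.
Proof.
move=> tg c0 c1.
have : ((Iann p.1 1 g)%:E + (Iann 1 p.2 g)%:E)%E @[p --> @L_filter R] --> (l0%:E + l1)%E.
  apply: cvgeD => //.
    apply: cvg_EFin; first exact: nearW.
    exact: (cvg_comp _ _ (@cvg_fst _ _ _ _ _) c0).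
  exact: (cvg_comp _ _ (@cvg_snd _ _ _ _ _) c1).
apply: cvg_trans; apply: near_eq_cvg.
apply: filterS (near_L_filter 1 ltr01) => -[a b] /= [a0 [a1 b1]].
by rewrite -EFinD -Iann_split// ltW.
Qed.

Lemma cvg_Iann_fin g (l0 l1 : R) : tame g ->
  Iann r 1 g @[r --> 0^'+] --> l0 -> Iann 1 r g @[r --> +oo] --> l1 ->
  (Iann p.1 p.2 g)%:E @[p --> @L_filter R] --> (l0 + l1)%:E.
Proof.
move=> tg c0 c1; rewrite EFinD; apply: cvg_Iann_ereal => //.
by apply: cvg_EFin; first exact: nearW.
Qed.

Lemma cvg_Iann_nonneg g : tame g -> (forall z, 0 <= g z) ->
  exists2 l : \bar R, (0 <= l)%E & (Iann 1 r g)%:E @[r --> +oo] --> l.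
Proof.
move=> tg g0.
have nd : nondecreasing_fun (fun r => (Iann 1 r g)%:E).
  move=> a b ab; rewrite lee_fin; have [a1|a1] := leP a 1.
    by rewrite (Iann_set0 g a1); apply: Iann_ge0.
  by rewrite (Iann_split ltr01 (ltW a1) ab tg) lerDl; apply: Iann_ge0.
have := nondecreasing_cvge nd; set l := ereal_sup _ => cl.
exists l => //; apply: (ereal_sup_ubound _); exists 1 => //.
by rewrite Iann_set0.
Qed.

End radial_limits.

Section kernel_integrals.
Variables (R : realType) (n : nat) (s lam Lam : R).
Hypotheses (hn : (0 < n)%N) (hs : 0 < s < 1) (hlam : 0 < lam) (hLam : lam <= Lam).
Implicit Types (f g u : 'rV[R]_n -> R) (x e z v : 'rV[R]_n) (r al B : R).
Implicit Types (K : 'rV[R]_n -> \bar R).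
Local Notation mu := (@lebesgue_rV R n).

Let Lam0 : 0 < Lam.
Proof. exact: lt_le_trans hLam. Qed.

Lemma Iann_kernel_le K g al B r r' : kernel_class s lam Lam K -> tame g -> 0 < r ->
  (forall z, r <= enorm z < r' -> `|g z| <= B * enorm z `^ al) ->
  `|Iann r r' (fun z => g z * regk K z)| <=
  Lam * B * Iann r r' (fun z : 'rV[R]_n => enorm z `^ (al - 2 * s - n%:R)).
Proof.
move=> hK tg r0 gB; have tK := tame_regk hn hs hlam hLam hK.
have tgK : tame (fun z => g z * regk K z) by exact: tameM.
apply: le_trans (normr_Iann _ r0 tgK) _.
rewrite -IannZ//; last exact: tame_powR.
apply: le_Iann => //; [exact: tame_norm|by apply: tameZ; exact: tame_powR|].
move=> z hz; have z0 : 0 < enorm z by case/andP: hz => h _; exact: lt_le_trans h.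
rewrite normrM (ger0_norm (regk_ge0 hn hs hlam hK z)).
apply: (@le_trans _ _ (B * enorm z `^ al * (Lam * enorm z `^ (- (2 * s) - n%:R)))).
  by apply: ler_pM => //; [exact: (regk_ge0 hn hs hlam hK)|exact: gB|exact: (regk_le hn hs hK)].
rewrite (_ : al - _ - _ = al + (- (2 * s) - n%:R)); last by ring.
by rewrite -mul_powR// le_eqVlt; apply/orP; left; apply/eqP; ring.
Qed.

Lemma Iann_kernel_inner al : 2 * s < al -> exists2 C, 0 <= C &
  forall K g B r r', kernel_class s lam Lam K -> tame g -> 0 < r -> 0 < r' -> 0 <= B ->
  (forall z, r <= enorm z < r' -> `|g z| <= B * enorm z `^ al) ->
  `|Iann r r' (fun z => g z * regk K z)| <= C * B * r' `^ (al - 2 * s).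
Proof.
move=> hal; have [|C C0 hC] := @Iann_powR_inner R n hn (al - 2 * s).
  by rewrite subr_gt0.
exists (Lam * C); first by rewrite mulr_ge0// ltW.
move=> K g B r r' hK tg r0 r'0 B0 gB.
apply: le_trans (Iann_kernel_le hK tg r0 gB) _.
rewrite [leRHS](_ : _ = Lam * B * (C * r' `^ (al - 2 * s))); last by ring.
by rewrite ler_wpM2l ?hC// mulr_ge0// ltW.
Qed.

Lemma Iann_kernel_outer al : al < 2 * s -> exists2 C, 0 <= C &
  forall K g B r r', kernel_class s lam Lam K -> tame g -> 0 < r -> 0 <= B ->
  (forall z, r <= enorm z < r' -> `|g z| <= B * enorm z `^ al) ->
  `|Iann r r' (fun z => g z * regk K z)| <= C * B * r `^ (- (2 * s - al)).
Proof.
move=> hal; have [|C C0 hC] := @Iann_powR_outer R n hn (2 * s - al).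
  by rewrite subr_gt0.
exists (Lam * C); first by rewrite mulr_ge0// ltW.
move=> K g B r r' hK tg r0 B0 gB.
apply: le_trans (Iann_kernel_le hK tg r0 gB) _.
rewrite [leRHS](_ : _ = Lam * B * (C * r `^ (- (2 * s - al)))); last by ring.
rewrite (_ : al - 2 * s - n%:R = - (2 * s - al) - n%:R); last by ring.
by rewrite ler_wpM2l ?hC// mulr_ge0// ltW.
Qed.

(* The integral is the difference of two integrals against the cutoff at scale r, extending
   up to r' and up to r. *)
Lemma tail_parts : exists2 C, 0 <= C & forall K u x e Mu r r',
  kernel_class s lam Lam K -> enorm e = 1 ->
  (forall y, differentiable u y) -> continuous ('D_e u) ->
  (forall y, `|u y| <= Mu) -> 0 < r -> r <= r' ->
  `|Iann r r' (fun z => 'D_e u (x - z) * regk K z)| <= C * Mu * r `^ (- (1 + 2 * s)).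
Proof.
have [C C0 hC] := cutoff_parts hn hs hlam hLam.
have q0 : 0 < 1 + 2 * s by move: hs => /andP[? ?]; lra.
have [D D0 hD] := Iann_powR_outer hn q0.
have cl0 := c_lip_ge0 n s hlam hLam.
pose E := c_lip n s Lam * (2 * (D * 4^-1 `^ (- (1 + 2 * s)))) + C.
have E0 : 0 <= E.
  apply: addr_ge0 => //; apply: mulr_ge0 => //; apply: mulr_ge0 => //.
  by apply: mulr_ge0 => //; exact: powR_ge0.
exists (2 * E); first exact: mulr_ge0.
move=> K u x e Mu r r' hK e1 du cw uM r0 rr'.
have Mu0 : 0 <= Mu by apply: le_trans (uM 0).
have cu : continuous u by move=> y; exact: differentiable_continuous.
have tu := tame_comp_sub x cu; have tw := tame_comp_sub x cw.
have tK := tame_regk hn hs hlam hLam hK.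
have tc := tame_cutoff n r.
have tU : tame (fun z => `|u (x - z) - u x|).
  by apply: tame_norm; apply: tameB => //; exact: tame_cst.
have r4 : 0 < r / 4 by rewrite divr_gt0.
have main t : r <= t ->
    `|Iann (r / 2) t (fun z => 'D_e u (x - z) * (cutoff r z * regk K z))| <=
    E * Mu * r `^ (- (1 + 2 * s)).
  move=> rt; apply: le_trans (hC K u x e Mu r t hK e1 du cw uM r0 rt) _.
  rewrite (_ : E * _ * _ = c_lip n s Lam * (2 * Mu * (D * (4^-1 `^ (- (1 + 2 * s)) *
      r `^ (- (1 + 2 * s))))) + C * Mu * r `^ (- (1 + 2 * s))); last by rewrite /E; ring.
  apply: lerD.
    apply: ler_wpM2l => //.
    apply: (@le_trans _ _ (2 * Mu * Iann (r / 4) t (fun z : 'rV[R]_n => enorm z `^ (- (1 + 2 * s) - n%:R)))).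
      rewrite -IannZ//; last exact: tame_powR.
      apply: le_Iann => //.
      - by apply: tameM => //; exact: tame_powR.
      - by apply: tameZ; exact: tame_powR.
      move=> z _; rewrite ler_wpM2r ?powR_ge0//.
      apply: le_trans (ler_normB _ _) _; have := uM (x - z); have := uM x; lra.
    apply: ler_wpM2l; first exact: mulr_ge0.
    apply: le_trans (hD _ _ r4) _.
    by rewrite (mulrC r) powRM ?invr_ge0 ?(ltW r0)//.
  rewrite ler_wpM2l ?mulr_ge0//; apply: powR_anti => //.
  by rewrite oppr_le0 ltW.
have r2 : 0 < r / 2 by rewrite divr_gt0.
have tF : tame (fun z => 'D_e u (x - z) * (cutoff r z * regk K z)).
  by apply: tameM => //; exact: tameM.
have r2r : r / 2 <= r by lra.
have -> : Iann r r' (fun z => 'D_e u (x - z) * regk K z) =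
    Iann (r / 2) r' (fun z => 'D_e u (x - z) * (cutoff r z * regk K z)) -
    Iann (r / 2) r (fun z => 'D_e u (x - z) * (cutoff r z * regk K z)).
  rewrite (Iann_split r2 r2r rr' tF) addrAC subrr add0r.
  by apply: eq_Iann => z /andP[rz _]; rewrite cutoff1// mul1r.
apply: le_trans (ler_normB _ _) _.
have := main r' rr'; have := main r (lexx _); lra.
Qed.

Definition Lint f x z : R :=
  if 2^-1 < s then f x - f (x - z) - dot (grad f x) z else f x - f (x - z).

Lemma tame_dot v : tame (dot v).
Proof.
(* Polarization, which reduces the claim to the continuity of the norm. *)
apply: (tame_ext (f := fun z => 2^-1 * (enorm (v + 1 *: z) ^+ 2 - enorm z ^+ 2 - enorm v ^+ 2))).
  by move=> z; rewrite scale1r !sqr_enorm !(dotDl, dotDr) (dotC z v); field.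
have te := tame_continuous (@enorm_continuous R n).
apply: tameZ; apply: tameB; last exact: tame_cst.
apply: tameB; last exact: tameX.
by apply: tameX; apply: tame_continuous; apply: continuous_aff_comp; exact: enorm_continuous.
Qed.

Lemma tame_Lint f x : continuous f -> tame (Lint f x).
Proof.
move=> cf; have tf := tame_comp_sub x cf; rewrite /Lint.
have t1 : tame (fun z => f x - f (x - z)) by apply: tameB => //; exact: tame_cst.
by case: (2^-1 < s) => //; apply: tameB => //; exact: tame_dot.
Qed.

(** Substitute y = x - z, add the null sphere |z| = r to reach the half-open annulus, and replace K
    by [regk K], which can differ from it only at the origin. *)
Lemma L_truncE K f x r r' : kernel_class s lam Lam K -> continuous f -> 0 < r ->
  L_trunc s K f x r r' = (Iann r r' (fun z => Lint f x z * regk K z))%:E.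
Proof.
move=> hK cf r0.
pose g z := Lint f x z * regk K z.
have tg : tame g by apply: tameM; [exact: tame_Lint|exact: tame_regk hK].
pose D : set (borel_rV R n) := [set y : 'rV[R]_n | r < enorm (x - y) < r'].
pose D0 : set (borel_rV R n) := [set z : 'rV[R]_n | r < enorm z < r'].
pose S : set (borel_rV R n) := [set z | enorm (z : 'rV[R]_n) = r].
have mS : measurable S.
  have := @rV_measurable_enorm R n measurableT [set r] (measurable_set1 r).
  by rewrite setTI.
have D0E : D0 = ann r r' `\` S.
  apply/seteqP; split => z; rewrite /D0 /ann /S/=.
    move=> /andP[h1 h2]; split; first by rewrite ltW.
    by move=> zr; rewrite zr ltxx in h1.
  move=> [/andP[h1 h2] h3]; rewrite h2 andbT lt_neqAle h1 andbT.
  by apply/eqP => rz; apply: h3.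
have mD0 : measurable D0 by rewrite D0E; apply: measurableD => //; exact: measurable_ann.
have affE z : affmap x (-1) z = x - (z : 'rV[R]_n) by rewrite /affmap scaleN1r.
have DE : D = affmap x (-1) @^-1` D0.
  by apply/seteqP; split => y /=; rewrite /D /D0/= affE.
have mD : measurable D.
  by rewrite DE -[X in measurable X]setTI; exact: measurable_affmap.
have D0E' : affmap x (-1) @^-1` D = D0.
  by apply/seteqP; split => y /=; rewrite /D /D0/= affE opprB addrC subrK.
have intg : mu.-integrable (ann r r') (EFin \o g) by exact: tame_integrable.
have intg0 : mu.-integrable D0 (EFin \o g).
  apply: integrableS intg => //; first exact: measurable_ann.
  by rewrite D0E; exact: subDsetl.
rewrite /L_trunc -/D.
transitivity (\int[mu]_(y in D) (g (affmap x (-1) y))%:E)%E.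
  apply: eq_integral => y; rewrite inE => /andP[yr _].
  have y0 : x - y != 0 by rewrite -enorm_gt0 (lt_trans r0).
  rewrite affE /g EFinM -(regkE hK y0); congr (_%:E * _)%E.
  by rewrite /L_integrand /Lint opprB [x + (y - x)]addrC subrK.
have mga : measurable_fun setT (fun y : borel_rV R n => g (affmap x (-1) y)).
  exact: measurableT_comp tg.1 (measurable_affmap x (-1)).
rewrite (@integral_affmap R n hn x (-1) D (fun y => g (affmap x (-1) y)))//.
- rewrite D0E'.
  transitivity (\int[mu]_(y in D0) (EFin \o g) y)%E.
    by apply: eq_integral => z _; rewrite !affE opprB [x + (z - x)]addrC subrK.
  rewrite D0E -negligible_integral//; [|exact: measurable_ann|exact: lebesgue_sphere].
  rewrite /Iann /Rintegral fineK//.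
  by apply: integrable_fin_num => //; exact: measurable_ann.
- by rewrite normrN1.
- rewrite D0E'; apply: eq_integrable intg0 => // z _ /=.
  by rewrite !affE opprB [x + (z - x)]addrC subrK.
Qed.

Lemma L_cvg K f x l : kernel_class s lam Lam K -> continuous f ->
  (Iann p.1 p.2 (fun z => Lint f x z * regk K z))%:E @[p --> @L_filter R] --> l ->
  L_exists s K f x /\ L s K f x = l.
Proof.
move=> hK cf cl.
have c : (fun p : R * R => L_trunc s K f x p.1 p.2) @ @L_filter R --> l.
  apply: cvg_trans cl; apply: near_eq_cvg.
  apply: filterS (near_L_filter 1 ltr01) => -[a b] /= [a0 _].
  by rewrite (L_truncE x b hK cf a0).
split; first by apply/cvg_ex; exists l.
exact: cvg_lim.
Qed.

End kernel_integrals.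

(** * Regularity of the functions and of the weight *)

Section regularity.
Variables (R : realType) (n : nat).
Implicit Types (f g u : 'rV[R]_n -> R) (x e z v : 'rV[R]_n) (a al : R).
Local Notation del i := (delta_mx 0 i : 'rV[R]_n).

Definition C1 f : Prop :=
  (forall x, differentiable f x) /\ forall i, continuous ('D_(del i) f).

(** Only increments of length at most 1 from the fixed point x are measured: this suffices for
    integrability at the origin and asserts nothing about growth. *)
Definition holder_at al f x : Prop := exists2 C : R, 0 <= C &
  forall z, enorm z <= 1 -> `|f x - f (x - z)| <= C * enorm z `^ al.

(** Directional derivatives are linear combinations of partial derivatives; this scheme transfers
    each regularity property to them. *)
Lemma lincomb_ind (P : ('rV[R]_n -> R) -> Prop) (c : 'I_n -> R)
    (f : 'I_n -> 'rV[R]_n -> R) :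
  P (fun=> 0) -> (forall f g, P f -> P g -> P (fun x => f x + g x)) ->
  (forall c f, P f -> P (fun x => c * f x)) -> (forall i, P (f i)) ->
  P (fun x => \sum_i c i * f i x).
Proof.
move=> P0 PD PZ Pf; elim: (index_enum _) => [|i l ih].
  by under eq_fun do rewrite big_nil.
by under eq_fun do rewrite big_cons; apply: PD => //; exact: PZ.
Qed.

Lemma C1_continuous f : C1 f -> continuous f.
Proof. by move=> [df _] x; exact: differentiable_continuous. Qed.

Lemma Ck_holder_continuous k a f : Ck_holder_loc k a f -> continuous f.
Proof.
by case: k => [[]//|k [df _]] x; exact: differentiable_continuous.
Qed.

Lemma Ck_holder_C1 k a f : Ck_holder_loc k.+1 a f -> C1 f.
Proof.
by move=> [df hf]; split => // i; apply: Ck_holder_continuous (hf i).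
Qed.

Lemma derive_dirE f e : (forall x, differentiable f x) ->
  'D_e f = fun x => \sum_i e 0 i * 'D_(del i) f x.
Proof.
move=> df; apply/funext => x; rewrite derive_grad// dotC.
by apply: eq_bigr => i _; rewrite mxE.
Qed.

Lemma continuous_lincomb (c : 'I_n -> R) (f : 'I_n -> 'rV[R]_n -> R) :
  (forall i, continuous (f i)) -> continuous (fun x => \sum_i c i * f i x).
Proof.
apply: (@lincomb_ind (fun f => continuous f)).
- by move=> x; exact: cst_continuous.
- by move=> g h cg ch x; apply: (@continuousD _ _ _ g h); [exact: cg|exact: ch].
- move=> d g cg x; apply: (@continuousM _ _ (fun=> d) g); last exact: cg.
  exact: cst_continuous.
Qed.

Lemma C1_dir_continuous f e : C1 f -> continuous ('D_e f).
Proof. by move=> [df cf]; rewrite derive_dirE//; exact: continuous_lincomb. Qed.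

Lemma grad_enorm_le f x C : 0 <= C -> (forall i, `|'D_(del i) f x| <= C) ->
  enorm (grad f x) <= n%:R * C.
Proof.
move=> C0 h; apply: le_trans (enorm_le_norm _) _; rewrite ler_wpM2l//.
rewrite [leLHS]/Num.norm/= mx_normrE; apply/bigmax_leP => /=; split => //.
by move=> [i j] _ /=; rewrite mxE.
Qed.

Lemma C1_lip f x : C1 f -> holder_at 1 f x.
Proof.
move=> [df cf].
pose m i := sval (cid2 (continuous_ball_bound (enorm x + 1) (cf i))).
have m0 i : 0 <= m i by rewrite /m; case: cid2.
have hm i y : enorm y <= enorm x + 1 -> `|'D_(del i) f y| <= m i.
  by rewrite /m; case: cid2 => //= M _; apply.
have ms i : m i <= \sum_i m i.
  by rewrite (bigD1 i)//= lerDl; exact: sumr_ge0.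
have S0 : 0 <= \sum_i m i by exact: sumr_ge0.
exists (n%:R * \sum_i m i); first exact: mulr_ge0.
move=> z z1; rewrite powRr1 ?enorm_ge0// distrC.
have [|c /andP[c0 c1] ->] := @MVT_line R n f x (- z).
  by move=> t _; exact: diff_derivable.
rewrite derive_grad//; apply: le_trans (dot_le _ _) _; rewrite enormN.
rewrite ler_wpM2r ?enorm_ge0//; apply: grad_enorm_le => // i.
apply: le_trans (ms i); apply: hm; apply: le_trans (enormD _ _) _.
rewrite lerD2l enormZ enormN ger0_norm//.
by rewrite -[leRHS]mulr1 ler_pM// enorm_ge0.
Qed.

(** By the mean value theorem the remainder is (grad f (x - c z) - grad f x) . z for some c in
    [0, 1]. *)
Lemma taylor1 f x al : 0 <= al -> (forall y, differentiable f y) ->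
  (forall i, holder_at al ('D_(del i) f) x) -> exists2 C : R, 0 <= C &
  forall z, enorm z <= 1 -> `|f x - f (x - z) - dot (grad f x) z| <= C * enorm z `^ (1 + al).
Proof.
move=> al0 df hf.
pose m i := sval (cid2 (hf i)).
have m0 i : 0 <= m i by rewrite /m; case: cid2.
have hm i z : enorm z <= 1 -> `|'D_(del i) f x - 'D_(del i) f (x - z)| <= m i * enorm z `^ al.
  by rewrite /m; case: cid2 => //= M _; apply.
have ms i : m i <= \sum_i m i.
  by rewrite (bigD1 i)//= lerDl; exact: sumr_ge0.
have S0 : 0 <= \sum_i m i by exact: sumr_ge0.
exists (n%:R * \sum_i m i); first exact: mulr_ge0.
move=> z z1; have [->|z0] := eqVneq z 0.
  rewrite subr0 subrr sub0r normrN (_ : dot _ 0 = 0) ?normr0.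
    by rewrite mulr_ge0 ?powR_ge0// mulr_ge0.
  by rewrite -(scale0r (0 : 'rV[R]_n)) dotZr mul0r.
have ez : 0 < enorm z by rewrite enorm_gt0.
have [|c /andP[c0 c1] E] := @MVT_line R n f x (- z).
  by move=> t _; exact: diff_derivable.
have -> : f x - f (x - z) - dot (grad f x) z = dot (grad f (x - c *: z) - grad f x) z.
  rewrite dotDl dotNl -[f x - f _]opprB E derive_grad// dotNr opprK.
  by rewrite scalerN.
apply: le_trans (dot_le _ _) _.
rewrite -mulr_powR// [leRHS](_ : _ = n%:R * ((\sum_i m i) * enorm z `^ al) * enorm z); last by ring.
rewrite ler_wpM2r ?enorm_ge0//.
apply: le_trans (enorm_le_norm _) _; rewrite ler_wpM2l//.
rewrite [leLHS]/Num.norm/= mx_normrE; apply/bigmax_leP => /=; split.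
  by rewrite mulr_ge0 ?powR_ge0.
move=> [i j] _ /=; rewrite !mxE distrC.
have czz : enorm (c *: z) <= enorm z by rewrite enormZ ger0_norm// ler_piMl ?enorm_ge0.
apply: le_trans (hm _ _ _) _; first exact: le_trans z1.
apply: ler_pM => //; first exact: powR_ge0.
by apply: ge0_ler_powR; rewrite ?nnegrE ?enorm_ge0.
Qed.

Lemma holder_atD al f g x : holder_at al f x -> holder_at al g x ->
  holder_at al (fun y => f y + g y) x.
Proof.
move=> [C C0 hC] [D D0 hD]; exists (C + D); first exact: addr_ge0.
move=> z z1; rewrite mulrDl (_ : _ - _ = (f x - f (x - z)) + (g x - g (x - z))); last by ring.
by apply: le_trans (ler_normD _ _) _; rewrite lerD ?hC ?hD.
Qed.

Lemma holder_atZ al c f x : holder_at al f x -> holder_at al (fun y => c * f y) x.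
Proof.
move=> [C C0 hC]; exists (`|c| * C); first exact: mulr_ge0.
by move=> z z1; rewrite -mulrBr normrM -mulrA ler_wpM2l// hC.
Qed.

Lemma holder_at0 al x : holder_at al (fun=> 0) x.
Proof. by exists 0 => // z _; rewrite subrr normr0 mul0r. Qed.

Lemma holder_ball f x a (hf : forall r : R, exists C : R,
    forall x y, eball r x -> eball r y -> `|f x - f y| <= C * enorm (x - y) `^ a) :
  holder_at a f x.
Proof.
(* x - z may have norm |x| + 1 and the balls are open, hence the radius |x| + 2. *)
have [C hC] := hf (enorm x + 2); exists `|C| => // z z1.
apply: (@le_trans _ _ (C * enorm z `^ a)); last first.
  by rewrite ler_wpM2r ?powR_ge0// ler_norm.
have {2}-> : z = x - (x - z) by rewrite opprB addrC subrK.
apply: hC; rewrite /eball/=; first by rewrite ltrDl.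
by apply: le_lt_trans (enormD _ _) _; rewrite enormN ltrD2l; lra.
Qed.

Definition C1_holder al f : Prop :=
  C1 f /\ forall x i, holder_at al ('D_(del i) f) x.

Lemma C1_holder_lincomb al (c : 'I_n -> R) (f : 'I_n -> 'rV[R]_n -> R) :
  (forall i, C1_holder al (f i)) -> C1_holder al (fun x => \sum_i c i * f i x).
Proof.
apply: (@lincomb_ind (C1_holder al)).
- have D0 i : 'D_(del i) (fun _ : 'rV[R]_n => 0 : R) = fun=> 0.
    by apply/funext => x; rewrite -[fun _ => 0]/(cst 0) derive_cst.
  split; [split => [x|i]|move=> x i]; [exact: differentiable_cst|rewrite D0|rewrite D0].
    by move=> x; exact: cst_continuous.
  exact: holder_at0.
- move=> g h [[dg cg] hg] [[dh ch] hh].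
  have DD i : 'D_(del i) (fun x => g x + h x) =
      fun x => 'D_(del i) g x + 'D_(del i) h x.
    by apply/funext => x; apply: deriveD; exact: diff_derivable.
  split; [split => [x|i]|move=> x i].
  + exact: (@differentiableD _ _ _ g h).
  + rewrite DD => x.
    by apply: (@continuousD _ _ _ ('D_(del i) g) ('D_(del i) h)); [exact: cg|exact: ch].
  + by rewrite DD; exact: holder_atD.
- move=> d g [[dg cg] hg].
  have DD i : 'D_(del i) (fun x => d * g x) = fun x => d * 'D_(del i) g x.
    by apply/funext => x; apply: deriveZ; exact: diff_derivable.
  split; [split => [x|i]|move=> x i].
  + exact: (@differentiableZ _ _ _ g d).
  + rewrite DD => x.
    apply: (@continuousM _ _ (fun=> d) ('D_(del i) g)); last exact: cg.
    exact: cst_continuous.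
  + by rewrite DD; exact: holder_atZ.
Qed.

Section holder_loc.
Variables (s eps : R) (u : 'rV[R]_n -> R).
Hypotheses (hs : 0 < s < 1) (he : 0 < eps) (hu : holder_loc (1 + 2 * s + eps) u).
Let beta : R := 1 + 2 * s + eps.
Let k := Num.truncn beta.
Let a := beta - k%:R.

Let beta1 : 1 < beta.
Proof. by rewrite /beta; move: hs => /andP[s0 _]; rewrite -addrA ltrDl addr_gt0// mulr_gt0. Qed.

Let hk : k%:R <= beta < k.+1%:R.
Proof. by apply: truncn_itv; exact: le_trans (ltW beta1). Qed.

Let huk : Ck_holder_loc k a u.
Proof. exact: hu. Qed.

Let kS : k = k.-1.+1.
Proof.
rewrite prednK//; case: k hk => // /andP[_]; have := beta1; lra.
Qed.

Lemma holder_loc_C1 : C1 u.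
Proof. by apply: (@Ck_holder_C1 k.-1 a); rewrite -kS. Qed.

Let du : forall x, differentiable u x.
Proof. by have [] := holder_loc_C1. Qed.

Let hui i : Ck_holder_loc k.-1 a ('D_(del i) u).
Proof. by move: huk; rewrite {1}kS => -[_ h]; exact: h. Qed.

Let dirE e : 'D_e u = fun x => \sum_i e 0 i * 'D_(del i) u x.
Proof. exact: derive_dirE. Qed.

(** As eps is arbitrary, the integer part k of the exponent is unknown. For k = 1 the Hoelder
    exponent is 2s + eps; for k >= 2 the partial derivatives are C^1 and 1 is an exponent. *)
Lemma holder_loc_low e x : s < 2^-1 ->
  exists2 al, 2 * s < al <= 1 & holder_at al ('D_e u) x.
Proof.
move=> s2; rewrite dirE; have := hui; have := hk.
case E : k => [|[|m]].
- by move: E; rewrite kS.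
- move=> /andP[_ b2] h; exists a.
    by rewrite /a E /beta; move: b2 he; rewrite /beta => b2 he'; apply/andP; split; lra.
  apply: (@lincomb_ind (fun f => holder_at a f x)).
  + exact: holder_at0.
  + by move=> f g; exact: holder_atD.
  + by move=> c f; exact: holder_atZ.
  + by move=> i; apply: holder_ball; have [] := h i.
- move=> _ h; exists 1; first by rewrite lexx andbT; lra.
  apply: (@lincomb_ind (fun f => holder_at 1 f x)).
  + exact: holder_at0.
  + by move=> f g; exact: holder_atD.
  + by move=> c f; exact: holder_atZ.
  + by move=> i; apply: C1_lip; exact: Ck_holder_C1 (h i).
Qed.

(** Now the total exponent exceeds 2, so k >= 2. For k = 2 the second derivatives have exponent 2s -
    1 + eps; for larger k they are C^1, hence locally Lipschitz. *)
Lemma holder_loc_high e : 2^-1 <= s ->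
  [/\ forall i, C1 ('D_(del i) u) &
  exists2 al, 2 * s < 1 + al /\ 0 <= al & C1_holder al ('D_e u)].
Proof.
move=> s2; rewrite dirE; have := hui; have := hk.
case E : k => [|[|[|m]]].
- by move: E; rewrite kS.
- by move=> /andP[_ b2]; move: b2 he; rewrite /beta; lra.
- move=> _ h; split; first by move=> i; exact: Ck_holder_C1 (h i).
  exists a; first by rewrite /a E /beta; move: he => he'; split; lra.
  apply: C1_holder_lincomb => i; split; first exact: Ck_holder_C1 (h i).
  by move=> x j; apply: holder_ball; have [_ /(_ j)[]] := h i.
- move=> _ h; split; first by move=> i; exact: Ck_holder_C1 (h i).
  exists 1; first by split => //; move: hs => /andP[? ?]; lra.
  apply: C1_holder_lincomb => i; split; first exact: Ck_holder_C1 (h i).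
  by move=> x j; apply: C1_lip; have [_ /(_ j)] := h i; exact: Ck_holder_C1.
Qed.

End holder_loc.
End regularity.

Section directional_derivatives.
Variables (R : realType) (n : nat).
Implicit Types (f g u : 'rV[R]_n -> R) (x e z v : 'rV[R]_n) (d : R).

(** Brings the one-variable chain rule to directional derivatives, with nothing assumed about other
    directions. *)
Lemma is_derive_lineP f x v d :
  is_derive x v f d <-> is_derive (0 : R) 1 (fun t => f (x + t *: v)) d.
Proof.
have E : (fun h : R => h^-1 *: (((fun t => f (x + t *: v)) \o shift 0) (h *: 1) -
      f (x + 0 *: v))) =
    (fun h : R => h^-1 *: ((f \o shift x) (h *: v) - f x)).
  apply/funext => h /=; rewrite scale0r !addr0; congr (_ *: (f _ - _)).
  by rewrite -[h *: 1]/(h * 1) mulr1 addrC.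
split => -[h1 h2].
  by split; [rewrite /derivable E|rewrite /derive E].
by split; [rewrite /derivable -E|rewrite /derive -E].
Qed.

Lemma is_derive_sq f x v d : is_derive x v f d ->
  is_derive x v (fun y => f y ^+ 2) (2 * f x * d).
Proof.
move=> df; have := is_deriveM df df.
move=> h; apply: is_derive_eq h _.
rewrite -[_ *: _]/(f x * d); ring.
Qed.

(** The square of the positive part is differentiable although the positive part is not: its
    first-order remainder is at most h^2. *)
Lemma is_derive_pos_sq1 (t : R) :
  is_derive t 1 (fun t => (Num.max t 0) ^+ 2) (2 * Num.max t 0).
Proof.
pose phi (t : R) := (Num.max t 0) ^+ 2.
have key h : `|phi (t + h) - phi t - 2 * Num.max t 0 * h| <= h ^+ 2.
  rewrite /phi ler_norml.
  have : 0 <= h ^+ 2 by exact: sqr_ge0.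
  by case: (leP t 0) => ht; case: (leP (t + h) 0) => hth h2; apply/andP; split; nra.
have cv : h^-1 *: ((phi \o shift t) (h *: 1) - phi t) @[h --> 0^'] --> 2 * Num.max t 0.
  apply/cvgrPdist_le => e e0; near=> h.
  have h0 : h != 0 by near: h; exact: nbhs_dnbhs_neq.
  have he : `|h| <= e.
    near: h; apply: dnbhs0_le => //.
  rewrite /= -[h *: 1]/(h * 1) mulr1 distrC (addrC h).
  rewrite -[_ *: _]/(h^-1 * _).
  rewrite (_ : _ - _ = h^-1 * (phi (t + h) - phi t - 2 * Num.max t 0 * h)); last by field.
  rewrite normrM normfV ler_pdivrMl ?normr_gt0//.
  apply: le_trans (key h) _; rewrite -real_normK ?num_real// expr2.
  by rewrite ler_wpM2l.
split; first by apply/cvg_ex; exists (2 * Num.max t 0).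
exact: cvg_lim.
Unshelve. all: by end_near. Qed.

Lemma is_derive_pos_sq f x v d : is_derive x v f d ->
  is_derive x v (fun y => (Num.max (f y) 0) ^+ 2) (2 * Num.max (f x) 0 * d).
Proof.
move=> /is_derive_lineP df; apply/is_derive_lineP.
have E0 : f (x + 0 *: v) = f x by rewrite scale0r addr0.
have h := is_derive_pos_sq1 (f (x + 0 *: v)).
have := @is_derive1_comp R (fun t => (Num.max t 0) ^+ 2) (fun t => f (x + t *: v)) 0 _ _ h df.
by rewrite E0.
Qed.

(** [A] stands for the square of a, which has a derivative even where a, possibly a positive part,
    has none. *)
Lemma derive_energy (eta A u : 'rV[R]_n -> R) x v (sigma a dw de du : R) :
  is_derive x v eta de -> is_derive x v A (2 * a * dw) -> is_derive x v u du ->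
  'D_v (fun y => eta y ^+ 2 * A y + sigma * u y ^+ 2) x =
  2 * eta x * de * A x + 2 * eta x ^+ 2 * a * dw + 2 * sigma * u x * du.
Proof.
move=> he hA hu.
have h1 := is_deriveM (is_derive_sq he) hA.
have h2 := is_deriveZ sigma (is_derive_sq hu).
have h3 := is_deriveD h1 h2.
have -> : (fun y => eta y ^+ 2 * A y + sigma * u y ^+ 2) =
  ((fun y => eta y ^+ 2) * A + sigma \*: (fun y => u y ^+ 2)) by [].
rewrite (@derive_val _ _ _ _ _ _ _ h3).
rewrite -![_ *: _]/(_ * _); ring.
Qed.

End directional_derivatives.

(** * Bounds on the weight extracted from its norms *)

Section weight.
Variables (R : realType) (n : nat).
Hypothesis hn : (0 < n)%N.
Implicit Types (eta f : 'rV[R]_n -> R) (x z b : 'rV[R]_n) (M s : R).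

Lemma sup_norm_le (V : Type) (N : V -> R) (f : 'rV[R]_n -> V) x :
  ((N (f x))%:E <= sup_norm N f)%E.
Proof. by apply: (ereal_sup_ubound _); exists x. Qed.

Lemma sup_norm_ge0 (V : Type) (N : V -> R) (f : 'rV[R]_n -> V) :
  (forall v, 0 <= N v) -> (0 <= sup_norm N f)%E.
Proof. by move=> N0; apply: le_trans (sup_norm_le N f 0); rewrite lee_fin. Qed.

Lemma lip_seminorm_le (V : zmodType) (N : V -> R) (f : 'rV[R]_n -> V) x y :
  x != y -> ((N (f x - f y) / enorm (x - y))%:E <= lip_seminorm N f)%E.
Proof. by move=> xy; apply: (ereal_sup_ubound _); exists (x, y). Qed.

(** Two distinct points must exist, as the supremum of the empty set is -oo; they come from the
    positive dimension. *)
Lemma lip_seminorm_ge0 (V : zmodType) (N : V -> R) (f : 'rV[R]_n -> V) :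
  (forall v, 0 <= N v) -> (0 <= lip_seminorm N f)%E.
Proof.
move=> N0; pose y : 'rV[R]_n := const_mx 1.
have y0 : y != 0.
  apply/eqP => /rowP /(_ (Ordinal hn)); rewrite !mxE => /eqP; rewrite oner_eq0//.
apply: le_trans (lip_seminorm_le N f y0).
by rewrite lee_fin divr_ge0 ?enorm_ge0.
Qed.

Lemma lip_seminorm_le_fin (V : zmodType) (N : V -> R) (f : 'rV[R]_n -> V) M x y :
  N 0 = 0 -> (lip_seminorm N f <= M%:E)%E -> N (f x - f y) <= M * enorm (x - y).
Proof.
move=> N00 h; have [->|xy] := eqVneq x y.
  by rewrite !subrr N00 enorm0 mulr0.
have := le_trans (lip_seminorm_le N f xy) h; rewrite lee_fin ler_pdivrMr//.
by rewrite enorm_gt0 subr_eq0.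
Qed.

Lemma C11_bounds eta M : C11_norm eta = M%:E ->
  [/\ forall x, `|eta x| <= M, forall x, enorm (grad eta x) <= M &
      forall x y, enorm (grad eta x - grad eta y) <= M * enorm (x - y)].
Proof.
rewrite /C11_norm; set A := sup_norm _ eta; set B := sup_norm _ _; set C := lip_seminorm _ _.
have A0 : (0 <= A)%E by apply: sup_norm_ge0 => v; exact: normr_ge0.
have B0 : (0 <= B)%E by apply: sup_norm_ge0 => v; exact: enorm_ge0.
have C0 : (0 <= C)%E by apply: lip_seminorm_ge0 => v; exact: enorm_ge0.
move=> E.
have AM : (A <= M%:E)%E by rewrite -E -addeA leeDl// adde_ge0.
have BM : (B <= M%:E)%E by rewrite -E addeAC leeDr// adde_ge0.
have CM : (C <= M%:E)%E by rewrite -E leeDr// adde_ge0.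
split => x.
- by rewrite -lee_fin; apply: le_trans AM; exact: (sup_norm_le (fun t : R => `|t|%R)).
- by rewrite -lee_fin; apply: le_trans BM; exact: sup_norm_le.
- by move=> y; exact: lip_seminorm_le_fin (enorm0 _ _) CM.
Qed.

Lemma C01_lip f M : C01_norm f = M%:E ->
  forall x y, `|f x - f y| <= M * enorm (x - y).
Proof.
rewrite /C01_norm; set A := sup_norm _ _; set C := lip_seminorm _ _ => E x y.
have A0 : (0 <= A)%E by apply: sup_norm_ge0 => v; exact: normr_ge0.
have CM : (C <= M%:E)%E by rewrite -E leeDr.
exact: (@lip_seminorm_le_fin _ (fun t : R => `|t|%R) f M x y (normr0 _) CM).
Qed.

Section bounds.
Variables (eta : 'rV[R]_n -> R) (M : R).
Hypotheses (de : forall x, differentiable eta x).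
Hypotheses (hg : forall x, enorm (grad eta x) <= M).
Hypotheses (hl : forall x y, enorm (grad eta x - grad eta y) <= M * enorm (x - y)).

Lemma weight_lip x z : `|eta x - eta (x - z)| <= M * enorm z.
Proof.
have [|c _ E] := @MVT_line R n eta x (- z).
  by move=> t _; exact: diff_derivable.
rewrite distrC E derive_grad//; apply: le_trans (dot_le _ _) _.
by rewrite enormN ler_wpM2r ?enorm_ge0.
Qed.

Lemma weight_taylor x z :
  `|eta x - eta (x - z) - dot (grad eta x) z| <= M * enorm z ^+ 2.
Proof.
have [|c /andP[c0 c1] E] := @MVT_line R n eta x (- z).
  by move=> t _; exact: diff_derivable.
have M0 : 0 <= M by exact: le_trans (enorm_ge0 _) (hg 0).
have -> : eta x - eta (x - z) - dot (grad eta x) z =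
    dot (grad eta (x - c *: z) - grad eta x) z.
  rewrite dotDl dotNl -[eta x - eta _]opprB E derive_grad// dotNr opprK.
  by rewrite scalerN.
apply: le_trans (dot_le _ _) _.
rewrite expr2 mulrA ler_wpM2r ?enorm_ge0//.
apply: le_trans (hl _ _) _; rewrite ler_wpM2l// addrAC subrr add0r enormN enormZ.
by rewrite ger0_norm// ler_piMl ?enorm_ge0.
Qed.

End bounds.

(** Along b the derivative of eta^(2s) is 2s eta^(2s-1) D_b eta, and it is at most the Lipschitz
    constant times |b|. The assumption on eta^(2s) enters the proof here only. *)
Lemma weight_drift eta M s b x : 0 < s -> differentiable eta x ->
  (forall x y, `|eta x `^ (2 * s) - eta y `^ (2 * s)| <= M * enorm (x - y)) ->
  0 < eta x ->
  eta x `^ (2 * s - 1) * `|'D_b eta x| <= M * enorm b / (2 * s).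
Proof.
move=> s0 de hl ex.
have s20 : 0 < 2 * s by rewrite mulr_gt0.
have dl : is_derive x b eta ('D_b eta x) by apply: derivableP; exact: diff_derivable.
move/is_derive_lineP : dl => dl.
have E0 : eta (x + 0 *: b) = eta x by rewrite scale0r addr0.
have dp := is_derive1_powR (2 * s) (_ : 0 < eta (x + 0 *: b)); rewrite E0 in dp.
have {}dp := dp ex; rewrite -E0 in dp.
have [] := @is_derive1_comp R _ (fun t => eta (x + t *: b)) 0 _ _ dp dl.
rewrite E0 => dv vE.
rewrite ler_pdivlMr// mulrC.
rewrite (_ : _ * (_ * _) = `|2 * s * eta x `^ (2 * s - 1) * 'D_b eta x|); last first.
  by rewrite normrM (ger0_norm (mulr_ge0 (ltW s20) (powR_ge0 _ _))) mulrA.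
rewrite -vE.
have h : h^-1 *: ((((fun t => t `^ (2 * s)) \o (fun t => eta (x + t *: b))) \o shift 0) (h *: 1) -
    ((fun t => t `^ (2 * s)) \o (fun t => eta (x + t *: b))) 0) @[h --> (0:R)^'] -->
   'D_1 ((fun t => t `^ (2 * s)) \o (fun t => eta (x + t *: b))) 0 := dv.
apply: (cvgr_to_le (cvg_norm h)).
near=> t.
have t0 : t != 0 by near: t; exact: nbhs_dnbhs_neq.
rewrite /= scale0r !addr0 -[t *: 1]/(t * 1) mulr1 -[_ *: (_ - _)]/(_ * (_ - _)).
rewrite normrM normfV ler_pdivrMl ?normr_gt0//.
apply: le_trans (hl _ _) _.
by rewrite [x + _]addrC addrK enormZ mulrCA.
Unshelve. all: by end_near. Qed.

End weight.

(** * The truncated Bernstein inequality *)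

Section pointwise.
Variable R : realType.
Implicit Types (p q a b w M t D E : R).

(* With w = D_e u, a = w or w_+, and F = eta^2 a^2 + sigma u^2, this is the
   integrand of L F - 2 eta^2 a L w - 2 sigma u L u without the term
   - sigma (u x - u y)^2; here p = eta x, q = eta y, a = a x, b = a y, w = w y, and D is
   grad eta x . (x - y) if s > 1/2, and 0 otherwise. *)
Definition bern p q a b w D : R :=
  - (p ^+ 2 * a ^+ 2) - q ^+ 2 * b ^+ 2 + 2 * p ^+ 2 * a * w - a ^+ 2 * (2 * p * D).

(** Only the nonpositive term in [q] is given up; [- p ^+ 2] on the right is what becomes the
    gain. *)
Lemma bern_outer p q a b w D :
  bern p q a b w D - 2 * p ^+ 2 * a * w <= a ^+ 2 * (- p ^+ 2 - 2 * p * D).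
Proof.
rewrite /bern; have : 0 <= q ^+ 2 * b ^+ 2 by rewrite mulr_ge0 ?sqr_ge0.
lra.
Qed.

(** The two values of the weight differ by at most p / 12, so p + q <= 3p. *)
Lemma weight_sq_diff p q M t : 0 <= M -> 0 <= t -> 12 * (M * t) <= p ->
  `|p - q| <= M * t -> `|p ^+ 2 - q ^+ 2| <= 3 * M * p * t.
Proof.
move=> M0 t0 h /[dup] h1; rewrite ler_norml => /andP[h2 h3].
have Mt : 0 <= M * t by exact: mulr_ge0.
rewrite subr_sqr normrM.
apply: (@le_trans _ _ (M * t * (3 * p))); last by rewrite le_eqVlt; apply/orP; left; apply/eqP; ring.
apply: ler_pM => //; rewrite ler_norml; apply/andP; split; lra.
Qed.

(** Write b = a + (b - a): the term - p^2 (b - a)^2 absorbs the square and the cross term produced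
    by [E * b ^+ 2], each using a quarter of it. The sign condition on [a * w] disposes of the
    rest. *)
Lemma bern_inner p q a b w D M t : 0 < p -> 0 <= M -> 0 <= t -> 12 * (M * t) <= p ->
  `|p - q| <= M * t -> a * w <= a * b ->
  bern p q a b w D <= a ^+ 2 * (36 * M ^+ 2 * t ^+ 2 + (p ^+ 2 - q ^+ 2) - 2 * p * D).
Proof.
move=> p0 M0 t0 h h1 aw; have hE := weight_sq_diff M0 t0 h h1.
set E := p ^+ 2 - q ^+ 2 in hE *.
have -> : bern p q a b w D = - (p ^+ 2 * (b - a) ^+ 2) + E * b ^+ 2
    - 2 * p ^+ 2 * (a * b - a * w) - a ^+ 2 * (2 * p * D).
  by rewrite /bern /E; ring.
have h2 : 0 <= 2 * p ^+ 2 * (a * b - a * w).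
  by rewrite mulr_ge0 ?subr_ge0// mulr_ge0 ?sqr_ge0.
have p20 : 0 < p ^+ 2 by rewrite exprn_gt0.
(* The factor 12 in the hypothesis is made for this: it says 3 M t <= p / 4. *)
have E4 : `|E| <= p ^+ 2 / 4.
  apply: le_trans hE _; rewrite (_ : _ * t = p * (3 * (M * t))); last by ring.
  by rewrite expr2 -mulrA ler_wpM2l ?(ltW p0)//; lra.
have E2 : E ^+ 2 <= 9 * M ^+ 2 * t ^+ 2 * p ^+ 2.
  rewrite -real_normK ?num_real// (_ : _ * p ^+ 2 = (3 * M * p * t) ^+ 2); last by ring.
  by rewrite ler_sqr ?nnegrE// !mulr_ge0// ltW.
have h3 : E * (b - a) ^+ 2 <= p ^+ 2 / 4 * (b - a) ^+ 2.
  by rewrite ler_wpM2r ?sqr_ge0// (le_trans (ler_norm _) E4).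
have h4 : 2 * E * (a * (b - a)) <= p ^+ 2 / 4 * (b - a) ^+ 2 + 36 * M ^+ 2 * t ^+ 2 * a ^+ 2.
  have h5 : 4 * (E ^+ 2 / p ^+ 2) * a ^+ 2 <= 36 * M ^+ 2 * t ^+ 2 * a ^+ 2.
    rewrite ler_wpM2r ?sqr_ge0//.
    have : E ^+ 2 / p ^+ 2 <= 9 * M ^+ 2 * t ^+ 2 by rewrite ler_pdivrMr.
    lra.
  (* Young's inequality for the cross term; 36 is 4 times the 9 in the bound on [E ^+ 2]. *)
  have : 0 <= (p * (b - a) / 2 - 2 * (E / p) * a) ^+ 2 by exact: sqr_ge0.
  rewrite (_ : _ ^+ 2 = p ^+ 2 / 4 * (b - a) ^+ 2 - 2 * E * (a * (b - a)) +
    4 * (E ^+ 2 / p ^+ 2) * a ^+ 2); last by field; rewrite gt_eqF.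
  lra.
have -> : E * b ^+ 2 = E * a ^+ 2 + 2 * E * (a * (b - a)) + E * (b - a) ^+ 2 by ring.
have h6 : 0 <= p ^+ 2 * (b - a) ^+ 2 by rewrite mulr_ge0 ?sqr_ge0.
rewrite [leRHS](_ : _ = E * a ^+ 2 + 36 * M ^+ 2 * t ^+ 2 * a ^+ 2 - a ^+ 2 * (2 * p * D)); last by ring.
lra.
Qed.

End pointwise.

Section inner_region.
Variables (R : realType) (n : nat) (s lam Lam : R).
Hypotheses (hn : (0 < n)%N) (hs : 0 < s < 1) (hlam : 0 < lam) (hLam : lam <= Lam).
Variable M : R.
Hypothesis hM : 1 <= M.
Implicit Types (K : 'rV[R]_n -> \bar R) (eta : 'rV[R]_n -> R) (x : 'rV[R]_n) (r tau : R).

Let M0 : 0 <= M.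
Proof. exact: le_trans hM. Qed.

Definition drift eta x (z : 'rV[R]_n) : R := if 2^-1 < s then dot (grad eta x) z else 0.

Definition weight_ok eta : Prop :=
  [/\ forall x, differentiable eta x, forall x, 0 <= eta x <= M,
      forall x, enorm (grad eta x) <= M &
      forall x y, enorm (grad eta x - grad eta y) <= M * enorm (x - y)].

Lemma weight_continuous eta : weight_ok eta -> continuous eta.
Proof. by move=> [h _ _ _] x; exact: differentiable_continuous. Qed.

Lemma drift_le eta x z : weight_ok eta -> `|drift eta x z| <= M * enorm z.
Proof.
move=> [_ _ h _]; rewrite /drift; case: ifP => _; last first.
  by rewrite normr0 mulr_ge0 ?enorm_ge0.
by apply: le_trans (dot_le _ _) _; rewrite ler_wpM2r ?enorm_ge0.
Qed.

Lemma tame_drift eta x : tame (drift eta x).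
Proof.
rewrite /drift; case: (2^-1 < s); last exact: tame_cst.
exact: tame_dot.
Qed.

(** For s < 1/2 the first-order bound 6 M eta(x) |z| is integrable. For s >= 1/2 a second-order
    bound is needed and gives tau^(2-2s); one factor tau is traded for eta(x) by the smallness of
    [M * tau], so both cases end with the same power. *)
Lemma region_inner : exists2 C, 0 <= C & forall K eta x tau r,
  kernel_class s lam Lam K -> weight_ok eta -> 0 < r -> r < tau / 2 ->
  12 * (M * tau) <= eta x ->
  Iann r (tau / 2) (fun z => (36 * M ^+ 2 * enorm z ^+ 2 +
     (eta x ^+ 2 - eta (x - z) ^+ 2) - 2 * eta x * drift eta x z) * regk K z) <=
  C * eta x * tau `^ (1 - 2 * s).
Proof.
have [s0 s1] := andP hs.
have tq (eta : 'rV[R]_n -> R) x : weight_ok eta -> tame (fun z => 36 * M ^+ 2 * enorm z ^+ 2 +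
     (eta x ^+ 2 - eta (x - z) ^+ 2) - 2 * eta x * drift eta x z).
  move=> ok; apply: tameB; last by apply: tameZ; exact: tame_drift.
  apply: tameD; first by apply/tameZ/tameX/tame_continuous; exact: enorm_continuous.
  apply: tameB; first exact: tame_cst.
  by apply: tameX; apply: tame_comp_sub; exact: weight_continuous.
have tauM (eta : 'rV[R]_n -> R) x tau z : 12 * (M * tau) <= eta x -> enorm z < tau / 2 ->
    12 * (M * enorm z) <= eta x.
  move=> h1 h2; apply: le_trans h1; have : M * enorm z <= M * tau; last by lra.
  by rewrite ler_wpM2l//; have := enorm_ge0 z; lra.
have [s2|s2] := ltP s 2^-1.
- have [|C C0 hC] := @Iann_kernel_inner R n s lam Lam hn hs hlam hLam 1; first lra.
  exists (C * (6 * M)); first by rewrite !mulr_ge0.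
  move=> K eta x tau r hK ok r0 rt htau.
  have [de pe ge le] := ok.
  have /andP[p0 pM] := pe x.
  have tau0 : 0 < tau / 2 by exact: lt_trans rt.
  have B0 : 0 <= 6 * M * eta x by rewrite !mulr_ge0.
  apply: le_trans (ler_norm _) _.
  apply: le_trans (hC K _ (6 * M * eta x) r (tau / 2) hK (tq eta x ok) r0 tau0 B0 _) _.
    move=> z /andP[_ zt]; rewrite powRr1 ?enorm_ge0//.
    rewrite /drift ltNge (ltW s2)/= mulr0 subr0.
    have h12 := tauM _ _ _ _ _ htau zt.
    have h3 := weight_sq_diff M0 (enorm_ge0 z) h12 (weight_lip de ge x z).
    apply: le_trans (ler_normD _ _) _.
    have z0 : 0 <= M * enorm z by rewrite mulr_ge0 ?enorm_ge0.
    have : `|36 * M ^+ 2 * enorm z ^+ 2| <= 3 * M * eta x * enorm z.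
      rewrite ger0_norm ?mulr_ge0 ?sqr_ge0 ?enorm_ge0//.
      have : M * enorm z * (12 * (M * enorm z)) <= M * enorm z * eta x by rewrite ler_wpM2l.
      nra.
    lra.
  rewrite [leLHS](_ : _ = C * (6 * M) * eta x * (tau / 2) `^ (1 - 2 * s)); last by ring.
  rewrite ler_wpM2l ?mulr_ge0//.
  by apply: ge0_ler_powR; rewrite ?nnegrE; lra.
- have [|C C0 hC] := @Iann_kernel_inner R n s lam Lam hn hs hlam hLam 2; first lra.
  exists (C * (39 * M)); first by rewrite !mulr_ge0.
  move=> K eta x tau r hK ok r0 rt htau.
  have [de pe ge le] := ok.
  have /andP[p0 pM] := pe x.
  have tau0 : 0 < tau / 2 by exact: lt_trans rt.
  pose q1 z := 36 * M ^+ 2 * enorm z ^+ 2 +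
     (eta x ^+ 2 - eta (x - z) ^+ 2) - 2 * eta x * dot (grad eta x) z.
  have tq1 : tame q1.
    rewrite /q1; apply: tameB; last by apply: tameZ; exact: tame_dot.
    apply: tameD; first by apply/tameZ/tameX/tame_continuous; exact: enorm_continuous.
    apply: tameB; first exact: tame_cst.
    by apply: tameX; apply: tame_comp_sub; exact: weight_continuous.
  have tK := tame_regk hn hs hlam hLam hK.
  (* At s = 1/2 [drift] is 0, but the gradient term can be inserted because its integrals over
     annuli vanish. *)
  have -> : Iann r (tau / 2) (fun z => (36 * M ^+ 2 * enorm z ^+ 2 +
     (eta x ^+ 2 - eta (x - z) ^+ 2) - 2 * eta x * drift eta x z) * regk K z) =
     Iann r (tau / 2) (fun z => q1 z * regk K z).
    have [s3|s3] := ltP 2^-1 s; first by apply: eq_Iann => z _; rewrite /drift s3.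
    have E : s = 2^-1 by apply/le_anti; rewrite s3 s2.
    rewrite (@eq_Iann _ _ _ _ _ (fun z => q1 z * regk K z + 2 * eta x * (dot (grad eta x) z * regk K z))).
      have td : tame (fun z => dot (grad eta x) z * regk K z) by apply: tameM => //; exact: tame_dot.
      rewrite IannD//; [|exact: tameM|exact: tameZ].
      by rewrite IannZ// (regk_cancel hn hs hlam hLam hK _ _ E r0) mulr0 addr0.
    by move=> z _; rewrite /q1 /drift ltNge s3/=; ring.
  (* 39 = 36 + 2 + 1: the square term, the Taylor remainder times 2 eta(x) <= 2M, and the squared
     increment. *)
  have B0 : 0 <= 39 * M ^+ 2 by rewrite mulr_ge0 ?sqr_ge0.
  apply: le_trans (ler_norm _) _.
  apply: le_trans (hC K _ (39 * M ^+ 2) r (tau / 2) hK tq1 r0 tau0 B0 _) _.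
    move=> z /andP[_ zt]; rewrite (powR_mulrn 2) ?enorm_ge0//.
    have h1 := weight_lip de ge x z; have h2 := weight_taylor de ge le x z.
    rewrite /q1 (_ : _ - _ = 36 * M ^+ 2 * enorm z ^+ 2 +
      2 * eta x * (eta x - eta (x - z) - dot (grad eta x) z) - (eta x - eta (x - z)) ^+ 2); last by ring.
    apply: le_trans (ler_normB _ _) _.
    apply: le_trans (lerD (ler_normD _ _) (lexx _)) _.
    have : `|36 * M ^+ 2 * enorm z ^+ 2| = 36 * M ^+ 2 * enorm z ^+ 2.
      by rewrite ger0_norm// ?mulr_ge0 ?sqr_ge0 ?enorm_ge0.
    have : `|2 * eta x * (eta x - eta (x - z) - dot (grad eta x) z)| <= 2 * (M ^+ 2 * enorm z ^+ 2).
      rewrite normrM ger0_norm ?mulr_ge0// -mulrA ler_wpM2l// expr2 -mulrA.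
      by apply: ler_pM.
    have : `|(eta x - eta (x - z)) ^+ 2| <= M ^+ 2 * enorm z ^+ 2.
      by rewrite normrX -exprMn ler_sqr ?nnegrE// mulr_ge0 ?enorm_ge0.
    lra.
  have -> : (tau / 2) `^ (2 - 2 * s) = tau / 2 * (tau / 2) `^ (1 - 2 * s).
    by rewrite mulr_powR//; congr (_ `^ _); ring.
  have tp : 0 < tau by lra.
  have h4 : (tau / 2) `^ (1 - 2 * s) <= 2 * tau `^ (1 - 2 * s).
    rewrite powRM ?(ltW tp)// mulrC ler_wpM2r ?powR_ge0//.
    rewrite -powR_inv1// -powRrM mulN1r.
    rewrite -[leRHS](@powRr1 _ 2)//; apply: ler_powR; lra.
  rewrite [leLHS](_ : _ = C * (39 * M) * (M * tau / 2 * (tau / 2) `^ (1 - 2 * s))); last by ring.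
  rewrite -[leRHS]mulrA ler_wpM2l ?mulr_ge0//.
  apply: (@le_trans _ _ (M * tau / 2 * (2 * tau `^ (1 - 2 * s)))).
    by rewrite ler_wpM2l// !mulr_ge0 ?(ltW tp).
  rewrite [leLHS](_ : _ = M * tau * tau `^ (1 - 2 * s)); last by field.
  rewrite ler_wpM2r ?powR_ge0//.
  by have : 0 <= M * tau by [rewrite mulr_ge0 ?(ltW tp)]; lra.
Qed.

End inner_region.

Section outer_regions.
Variables (R : realType) (n : nat) (s lam Lam : R).
Hypotheses (hn : (0 < n)%N) (hs : 0 < s < 1) (hlam : 0 < lam) (hLam : lam <= Lam).
Implicit Types (K : 'rV[R]_n -> \bar R) (eta a w : 'rV[R]_n -> R) (x z : 'rV[R]_n).
Implicit Types (r tau M : R).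

Let tame1 : tame (fun _ : 'rV[R]_n => 1 : R).
Proof. exact: tame_cst. Qed.

Lemma region_mid : exists2 C, 0 <= C & forall K tau,
  kernel_class s lam Lam K -> 0 < tau ->
  Iann (tau / 2) tau (regk K) <= C * tau `^ (- (2 * s)).
Proof.
have [s0 s1] := andP hs.
have [|C C0 hC] := @Iann_kernel_outer R n s lam Lam hn hs hlam hLam 0; first lra.
exists (C * 2 `^ (2 * s)); first by rewrite mulr_ge0 ?powR_ge0.
move=> K tau hK t0; have t2 : 0 < tau / 2 by rewrite divr_gt0.
have h := hC K (fun=> 1) 1 (tau / 2) tau hK tame1 t2 ler01.
rewrite (@eq_Iann _ _ _ _ (regk K) (fun z => 1 * regk K z)); last by move=> z _; rewrite mul1r.
apply: le_trans (ler_norm _) _; apply: le_trans (h _) _.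
  by move=> z _; rewrite normr1 mul1r powRr0.
rewrite mulr1 subr0 (mulrC tau) powRM ?invr_ge0 ?(ltW t0)//.
rewrite -(powR_inv1 (ltW (ltr0Sn R 1))) -powRrM mulN1r opprK.
by rewrite mulrA.
Qed.

Lemma region_far : exists2 C, 0 <= C & forall K tau r,
  kernel_class s lam Lam K -> 0 < tau ->
  Iann tau r (fun z => (if 2^-1 < s then enorm z else 0) * regk K z) <=
  C * tau `^ (1 - 2 * s).
Proof.
have [s2|s2] := ltP 2^-1 s; last first.
  exists 0 => // K tau r _ _.
  rewrite (@eq_Iann _ _ _ _ _ (fun=> 0)); last by move=> z _; rewrite mul0r.
  by rewrite Iann_cst !mul0r.
have [|C C0 hC] := @Iann_kernel_outer R n s lam Lam hn hs hlam hLam 1; first lra.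
exists C => // K tau r hK t0.
have te := tame_continuous (@enorm_continuous R n).
apply: le_trans (ler_norm _) _.
apply: le_trans (hC K (@enorm R n) 1 tau r hK te t0 ler01 _) _.
  by move=> z _; rewrite ger0_norm ?enorm_ge0// mul1r powRr1 ?enorm_ge0.
by rewrite mulr1 opprB.
Qed.

(** The part tau <= |z| < 2 tau alone carries the lower bound, uniformly in r. *)
Lemma region_shell : exists2 c, 0 < c & forall K tau r,
  kernel_class s lam Lam K -> 0 < tau -> 2 * tau <= r ->
  c * tau `^ (- (2 * s)) <= Iann tau r (regk K).
Proof.
have [c c0 hc] := @Iann_powR_shell R n hn (- (2 * s)).
exists (lam * c); first exact: mulr_gt0.
move=> K tau r hK t0 tr; have tK := tame_regk hn hs hlam hLam hK.
have tP := tame_powR n (- (2 * s) - n%:R) : tame _.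
rewrite (@Iann_split _ _ tau (2 * tau) r)//; last lra.
rewrite -[leLHS]addr0; apply: lerD; last first.
  by apply: Iann_ge0 => z _; exact: regk_ge0 hK z.
rewrite -mulrA -hc// -IannZ//; apply: le_Iann => //; first exact: tameZ.
by move=> z _; exact: (regk_ge hn hs hK).
Qed.

(** The gain comes from |z| >= tau only. The sign condition on [a] and [w] serves for |z| < tau,
    where eta(x - z) is comparable to eta(x). *)
Lemma energy_cutoff M : 1 <= M -> exists2 C, 0 <= C & exists2 c, 0 < c &
  forall K eta a w x tau r r',
  kernel_class s lam Lam K -> weight_ok M eta -> continuous a -> continuous w ->
  (forall y, a x * w y <= a x * a y) ->
  0 < r -> r < tau / 2 -> 2 * tau <= r' -> 12 * (M * tau) <= eta x ->
  Iann r r' (fun z => (bern (eta x) (eta (x - z)) (a x) (a (x - z)) (w (x - z))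
       (drift s eta x z) - 2 * eta x ^+ 2 * a x * (cutoff tau z * w (x - z))) * regk K z)
  <= a x ^+ 2 * (C * eta x * tau `^ (1 - 2 * s) - c * eta x ^+ 2 * tau `^ (- (2 * s))).
Proof.
move=> M1; have M0 : 0 <= M by exact: le_trans M1.
have [C1 C10 h1] := region_inner hn hs hlam hLam M1.
have [C2 C20 h2] := region_mid.
have [C3 C30 h3] := region_far.
have [c c0 hc] := region_shell.
exists (C1 + 8 * M * C2 + 2 * M * C3); first by rewrite !addr_ge0 ?mulr_ge0.
exists c => // K eta a w x tau r r' hK ok ca cw aw r0 rt tr' ht.
have [de pe ge le] := ok; have /andP[p0 pM] := pe x.
have tau0 : 0 < tau by lra.
have px : 0 < eta x.
  by apply: lt_le_trans ht; rewrite mulr_gt0// mulr_gt0// (lt_le_trans ltr01).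
have tK := tame_regk hn hs hlam hLam hK.
have td := tame_drift s eta x.
have teta : tame (fun z => eta (x - z)) by apply: tame_comp_sub; exact: weight_continuous ok.
have ta : tame (fun z => a (x - z)) by exact: tame_comp_sub.
have tw : tame (fun z => w (x - z)) by exact: tame_comp_sub.
have tcu := tame_cutoff n tau.
set Q := fun z => _ * regk K z.
have tQ : tame Q.
  apply: tameM => //; apply: tameB; last by apply: tameZ; exact: tameM.
  rewrite /bern; apply: tameB; last by apply: tameZ; exact: tameZ.
  apply: tameD; last exact: tameZ.
  apply: tameB; first exact: tame_cst.
  by apply: tameM; exact: tameX.
have rt2 : tau / 2 <= r' by lra.
rewrite (Iann_split r0 (ltW rt) rt2 tQ).
have t2 : 0 < tau / 2 by rewrite divr_gt0.
have t2t : tau / 2 <= tau by lra.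
have tr1 : tau <= r' by lra.
rewrite (Iann_split t2 t2t tr1 tQ).
have a20 : 0 <= a x ^+ 2 by rewrite sqr_ge0.
have tmul z : enorm z <= tau -> 12 * (M * enorm z) <= eta x.
  by move=> zt; apply: le_trans ht; rewrite ler_wpM2l// ler_wpM2l.
have inn z : enorm z <= tau ->
    bern (eta x) (eta (x - z)) (a x) (a (x - z)) (w (x - z)) (drift s eta x z) <=
    a x ^+ 2 * (36 * M ^+ 2 * enorm z ^+ 2 + (eta x ^+ 2 - eta (x - z) ^+ 2)
       - 2 * eta x * drift s eta x z).
  move=> zt; apply: bern_inner => //; [exact: enorm_ge0|exact: tmul|].
  exact: weight_lip de ge x z.
have out z : bern (eta x) (eta (x - z)) (a x) (a (x - z)) (w (x - z)) (drift s eta x z)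
     - 2 * eta x ^+ 2 * a x * w (x - z) <= a x ^+ 2 * (- eta x ^+ 2 - 2 * eta x * drift s eta x z).
  exact: bern_outer.
have I1 : Iann r (tau / 2) Q <= a x ^+ 2 * (C1 * eta x * tau `^ (1 - 2 * s)).
  apply: (@le_trans _ _ (a x ^+ 2 * Iann r (tau / 2) (fun z => (36 * M ^+ 2 * enorm z ^+ 2 +
     (eta x ^+ 2 - eta (x - z) ^+ 2) - 2 * eta x * drift s eta x z) * regk K z))); last first.
    by rewrite ler_wpM2l// h1.
  have tq : tame (fun z => (36 * M ^+ 2 * enorm z ^+ 2 +
     (eta x ^+ 2 - eta (x - z) ^+ 2) - 2 * eta x * drift s eta x z) * regk K z).
    apply: tameM => //; apply: tameB; last exact: tameZ.
    apply: tameD; first by apply/tameZ/tameX/tame_continuous; exact: enorm_continuous.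
    by apply: tameB; [exact: tame_cst|exact: tameX].
  rewrite -IannZ//; apply: le_Iann => //; first exact: tameZ.
  move=> z /andP[_ zt]; rewrite /Q [leRHS]mulrA ler_wpM2r ?(regk_ge0 hn hs hlam hK)//.
  rewrite cutoff0 ?(ltW zt)// mul0r mulr0 subr0; apply: inn; lra.
have I2 : Iann (tau / 2) tau Q <= a x ^+ 2 * (8 * M * C2 * eta x * tau `^ (1 - 2 * s)).
  apply: (@le_trans _ _ (a x ^+ 2 * (8 * M * eta x * tau) * Iann (tau / 2) tau (regk K))).
    rewrite -IannZ//; apply: le_Iann => //; first exact: tameZ.
    move=> z /andP[z1 z2]; rewrite /Q ler_wpM2r ?(regk_ge0 hn hs hlam hK)//.
    have i1 := inn z (ltW z2); have o1 := out z.
    have k0 := cutoff_ge0 tau z; have k1 := cutoff_le1 tau z.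
    set B := bern _ _ _ _ _ _ in i1 o1 *; set k := cutoff tau z in k0 k1 *.
    set W := 2 * eta x ^+ 2 * a x * w (x - z) in o1 *.
    (* On the ramp the integrand is a convex combination of the inner and the outer ones, with the
       cutoff as weight; both obey the same bound. *)
    rewrite (_ : B - _ = (1 - k) * B + k * (B - W)); last by rewrite /W; ring.
    have z0 := enorm_ge0 z.
    have h36 : 36 * M ^+ 2 * enorm z ^+ 2 <= 3 * M * eta x * tau.
      have := tmul z (ltW z2) => h12.
      have : M * enorm z * (12 * (M * enorm z)) <= M * tau * eta x.
        apply: ler_pM => //; rewrite ?mulr_ge0//.
        by rewrite ler_wpM2l// ltW.
      nra.
    have hE : eta x ^+ 2 - eta (x - z) ^+ 2 <= 3 * M * eta x * tau.
      apply: le_trans (ler_norm _) _.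
      apply: le_trans (weight_sq_diff M0 z0 (tmul z (ltW z2)) (weight_lip de ge x z)) _.
      by rewrite ler_wpM2l ?(ltW z2)// !mulr_ge0.
    have hD : - (2 * eta x * drift s eta x z) <= 2 * M * eta x * tau.
      rewrite (_ : - _ = 2 * eta x * - drift s eta x z); last by ring.
      rewrite (_ : 2 * M * eta x * tau = 2 * eta x * (M * tau)); last by ring.
      rewrite ler_wpM2l ?mulr_ge0//; apply: (le_trans (ler_norm _)); rewrite normrN.
      apply: le_trans (drift_le s M1 x z ok) _.
      by rewrite ler_wpM2l// ltW.
    (* 8 = 3 + 3 + 2, from the three preceding bounds. *)
    set Met := 8 * M * eta x * tau.
    have b1 : B <= a x ^+ 2 * Met.
      by apply: le_trans i1 _; rewrite ler_wpM2l// /Met; lra.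
    have b2 : B - W <= a x ^+ 2 * Met.
      apply: le_trans o1 _; rewrite ler_wpM2l//.
      have : 0 <= eta x ^+ 2 by exact: sqr_ge0.
      have : 0 <= M * eta x * tau by rewrite !mulr_ge0// ltW.
      rewrite /Met; lra.
    have -> : a x ^+ 2 * Met = (1 - k) * (a x ^+ 2 * Met) + k * (a x ^+ 2 * Met) by ring.
    by apply: lerD; rewrite ler_wpM2l// subr_ge0.
  rewrite -mulrA ler_wpM2l//.
  apply: (@le_trans _ _ (8 * M * eta x * tau * (C2 * tau `^ (- (2 * s))))).
    by rewrite ler_wpM2l ?h2// !mulr_ge0// ltW.
  rewrite -mulr_powR// le_eqVlt; apply/orP; left; apply/eqP; ring.
have I3 : Iann tau r' Q <= a x ^+ 2 * (2 * M * C3 * eta x * tau `^ (1 - 2 * s)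
     - c * eta x ^+ 2 * tau `^ (- (2 * s))).
  have tf : tame (fun z : 'rV[R]_n => (if 2^-1 < s then enorm z else 0) * regk K z).
    apply: tameM => //; case: (2^-1 < s); last exact: tame_cst.
    by apply: tame_continuous; exact: enorm_continuous.
  apply: (@le_trans _ _ (a x ^+ 2 * (2 * M * eta x * Iann tau r' (fun z =>
     (if 2^-1 < s then enorm z else 0) * regk K z) - eta x ^+ 2 * Iann tau r' (regk K)))).
    rewrite -!IannZ// -IannB//; [|exact: tameZ|exact: tameZ].
    rewrite -IannZ//; last by apply: tameB; exact: tameZ.
    apply: le_Iann => //; first by apply: tameZ; apply: tameB; exact: tameZ.
    move=> z /andP[z1 _]; rewrite /Q cutoff1// mul1r.
    have K0 := regk_ge0 hn hs hlam hK z.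
    rewrite [leRHS](_ : _ = a x ^+ 2 * (2 * M * eta x * (if 2^-1 < s then enorm z else 0)
       - eta x ^+ 2) * regk K z); last by ring.
    rewrite ler_wpM2r//; apply: le_trans (out z) _; rewrite ler_wpM2l//.
    rewrite addrC lerD2r.
    rewrite (_ : - _ = 2 * eta x * - drift s eta x z); last by ring.
    rewrite (_ : 2 * M * eta x * _ = 2 * eta x * (M * (if 2^-1 < s then enorm z else 0))); last by ring.
    rewrite ler_wpM2l ?mulr_ge0//; apply: (le_trans (ler_norm _)); rewrite normrN.
    have := drift_le s M1 x z ok; rewrite /drift; case: ifP => // _ _.
    by rewrite normr0 mulr0.
  rewrite ler_wpM2l//; apply: lerB.
    rewrite (_ : 2 * M * C3 * _ * _ = 2 * M * eta x * (C3 * tau `^ (1 - 2 * s))); last by ring.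
    by rewrite ler_wpM2l ?h3// !mulr_ge0.
  rewrite (_ : c * _ * _ = eta x ^+ 2 * (c * tau `^ (- (2 * s)))); last by ring.
  by rewrite ler_wpM2l ?sqr_ge0// hc.
move: I1 I2 I3; set X1 := Iann _ _ _; set X2 := Iann _ _ _; set X3 := Iann _ _ _.
move=> I1 I2 I3; apply: le_trans (lerD I1 (lerD I2 I3)) _.
rewrite le_eqVlt; apply/orP; left; apply/eqP; ring.
Qed.

End outer_regions.

Section truncated_inequality.
Variables (R : realType) (n : nat) (s lam Lam : R).
Hypotheses (hn : (0 < n)%N) (hs : 0 < s < 1) (hlam : 0 < lam) (hLam : lam <= Lam).
Implicit Types (K : 'rV[R]_n -> \bar R) (eta a w u : 'rV[R]_n -> R) (x z e b : 'rV[R]_n).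
Implicit Types (r tau M del : R).

(* Young's inequality: |A| |u x - u y| / t <= del A^2 / t^2 + (u x - u y)^2 / del. *)
Lemma young_parts : exists2 C, 0 <= C & exists2 C', 0 <= C' &
  forall K u x e Mu A del tau r r', kernel_class s lam Lam K -> enorm e = 1 ->
  (forall y, differentiable u y) -> continuous ('D_e u) ->
  (forall y, `|u y| <= Mu) -> 0 < del -> 0 < r -> r < tau / 4 -> tau <= r' ->
  A * Iann r r' (fun z => cutoff tau z * 'D_e u (x - z) * regk K z) <=
  del * A ^+ 2 * C * tau `^ (- (2 + 2 * s)) +
  (del * lam)^-1 * Iann r r' (fun z => (u (x - z) - u x) ^+ 2 * regk K z) +
  `|A| * C' * Mu * r' `^ (- (1 + 2 * s)).
Proof.
have [s0 s1] := andP hs.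
have [C1 C10 h1] := cutoff_parts hn hs hlam hLam.
have q0 : 0 < 2 + 2 * s by lra.
have [C2 C20 h2] := Iann_powR_outer hn q0.
pose cl := c_lip n s Lam; have cl0 : 0 <= cl := c_lip_ge0 n s hlam hLam.
exists (cl ^+ 2 * (C2 * 4 `^ (2 + 2 * s))).
  by rewrite !mulr_ge0 ?powR_ge0.
exists C1 => // K u x e Mu A del tau r r' hK e1 du cw uM d0 r0 rt tr'.
have tau0 : 0 < tau by lra.
have cu : continuous u by move=> y; exact: differentiable_continuous.
have tu := tame_comp_sub x cu; have tw := tame_comp_sub x cw.
have tK := tame_regk hn hs hlam hLam hK.
have tc := tame_cutoff n tau.
have tU : tame (fun z => u (x - z) - u x) by apply: tameB => //; exact: tame_cst.
have tP p : tame (fun z : 'rV[R]_n => enorm z `^ p) by exact: tame_powR.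
have t4 : 0 < tau / 4 by rewrite divr_gt0.
have tw' : tame (fun z => cutoff tau z * 'D_e u (x - z) * regk K z).
  by apply: tameM => //; exact: tameM.
have rt2 : r <= tau / 2 by lra.
have t2r : tau / 2 <= r' by lra.
have E1 : Iann r r' (fun z => cutoff tau z * 'D_e u (x - z) * regk K z) =
   Iann (tau / 2) r' (fun z => 'D_e u (x - z) * (cutoff tau z * regk K z)).
  rewrite (Iann_split r0 rt2 t2r tw').
  rewrite (@eq_Iann _ _ r _ _ (fun=> 0)); last first.
    by move=> z /andP[_ zt]; rewrite cutoff0 ?mul0r// ltW.
  rewrite Iann_cst mul0r add0r; apply: eq_Iann => z _; ring.
apply: (le_trans (ler_norm _)); rewrite E1 normrM.
apply: (@le_trans _ _ (`|A| * (cl * Iann (tau / 4) r' (fun z => `|u (x - z) - u x| * enorm z `^ (- (1 + 2 * s) - n%:R))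
  + C1 * Mu * r' `^ (- (1 + 2 * s))))).
  by rewrite ler_wpM2l//; exact: h1.
rewrite mulrDr; apply: lerD; last first.
  by rewrite le_eqVlt; apply/orP; left; apply/eqP; ring.
have U20 z : 0 <= (u (x - z) - u x) ^+ 2 * regk K z.
  by rewrite mulr_ge0 ?sqr_ge0// (regk_ge0 hn hs hlam hK).
have tUK : tame (fun z => (u (x - z) - u x) ^+ 2 * regk K z).
  by apply: tameM => //; exact: tameX.
have tau4r : tau / 4 <= r' by lra.
have tUP : tame (fun z => `|u (x - z) - u x| * enorm z `^ (- (1 + 2 * s) - n%:R)).
  by apply: tameM => //; exact: tame_norm.
apply: (@le_trans _ _ (del * A ^+ 2 * cl ^+ 2 * Iann (tau / 4) r' (fun z : 'rV[R]_n => enorm z `^ (- (2 + 2 * s) - n%:R))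
   + (del * lam)^-1 * Iann (tau / 4) r' (fun z => (u (x - z) - u x) ^+ 2 * regk K z))).
  rewrite mulrA -!IannZ// -IannD//; [|exact: tameZ|exact: tameZ].
  apply: le_Iann => //; [exact: tameZ|by apply: tameD; exact: tameZ|].
  move=> z /andP[z1 _]; have z0 : 0 < enorm z by lra.
  set Y := `|u (x - z) - u x|; set P := enorm z `^ (- (2 * s) - n%:R).
  have P0 : 0 < P by exact: powR_gt0.
  have -> : enorm z `^ (- (1 + 2 * s) - n%:R) = (enorm z)^-1 * P.
    rewrite -powR_inv1 ?enorm_ge0// mul_powR//; congr (_ `^ _); ring.
  have -> : enorm z `^ (- (2 + 2 * s) - n%:R) = (enorm z)^-1 ^+ 2 * P.
    rewrite expr2 -mulrA -powR_inv1 ?enorm_ge0// mul_powR// mul_powR//; congr (_ `^ _); ring.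
  apply: (@le_trans _ _ (del * A ^+ 2 * cl ^+ 2 * ((enorm z)^-1 ^+ 2 * P) + del^-1 * Y ^+ 2 * P)).
    set X := `|A| * cl * (enorm z)^-1.
    have -> : `|A| * cl * (Y * ((enorm z)^-1 * P)) = X * Y * P by rewrite /X; ring.
    have -> : del * A ^+ 2 * cl ^+ 2 * ((enorm z)^-1 ^+ 2 * P) = del * X ^+ 2 * P.
      by rewrite /X !exprMn real_normK ?num_real//; ring.
    rewrite -mulrDl ler_wpM2r ?(ltW P0)//.
    have dK : del^-1 * del = 1 by rewrite mulVf// gt_eqF.
    have X20 : 0 <= (X ^+ 2) by exact: sqr_ge0.
    (* Expanded, this is 2 X Y <= del X^2 + Y^2 / del. *)
    have h : 0 <= del^-1 * (del * X - Y) ^+ 2 by rewrite mulr_ge0 ?sqr_ge0 ?invr_ge0 ?(ltW d0).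
    rewrite [_ * _ ^+ 2](_ : _ = (del^-1 * del) * del * X ^+ 2 - 2 * (del^-1 * del) * X * Y + del^-1 * Y ^+ 2) in h; last by ring.
    rewrite dK in h.
    have h' : 0 <= del * X ^+ 2 by rewrite mulr_ge0// ltW.
    have h'' : 0 <= del^-1 * Y ^+ 2 by rewrite mulr_ge0 ?sqr_ge0 ?invr_ge0 ?(ltW d0).
    lra.
  rewrite lerD2l (_ : (u (x - z) - u x) ^+ 2 = Y ^+ 2); last by rewrite real_normK ?num_real.
  (* The lower kernel bound turns the power of |z| back into the kernel; hence [lam] in [sigma0]. *)
  rewrite [leRHS](_ : _ = del^-1 * Y ^+ 2 * (lam^-1 * regk K z)); last by rewrite invfM; ring.
  rewrite ler_wpM2l ?mulr_ge0 ?sqr_ge0 ?invr_ge0 ?(ltW d0) ?normr_ge0//.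
  by rewrite ler_pdivlMl// (regk_ge hn hs hK).
apply: lerD.
  rewrite [leRHS](_ : _ = del * A ^+ 2 * cl ^+ 2 *
    (C2 * (4 `^ (2 + 2 * s) * tau `^ (- (2 + 2 * s))))); last by ring.
  have pos : 0 <= del * A ^+ 2 * cl ^+ 2.
    by apply: mulr_ge0; [apply: mulr_ge0; [exact: ltW|exact: sqr_ge0]|exact: sqr_ge0].
  rewrite ler_wpM2l//; apply: le_trans (h2 _ _ t4) _.
  rewrite ler_wpM2l// mulrC powRM ?invr_ge0 ?(ltW tau0)//.
  by rewrite -(powR_inv1 (ltW (ltr0Sn R 3))) -powRrM mulN1r opprK.
rewrite ler_wpM2l ?invr_ge0 ?mulr_ge0 ?(ltW d0) ?(ltW hlam)//.
rewrite (Iann_split r0 (ltW rt) tau4r tUK) lerDr.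
by apply: Iann_ge0 => z _.
Qed.

(** The minimum of three explicit scales: one keeps tau = k eta(x) small relative to the weight, the
    others absorb the variation of the weight and the drift. [C + 1] and [Cb + 1] avoid division by
    zero. *)
Lemma small_scale (C c Cb M : R) : 0 <= C -> 0 < c -> 0 <= Cb -> 1 <= M ->
  exists k, [/\ 0 < k, 12 * (M * k) <= 1, C * k <= c / 4 & 2 * Cb * k `^ (2 * s) <= c / 4].
Proof.
have [s0 s1] := andP hs.
move=> C0 c0 Cb0 M1; pose k1 := c / (4 * (C + 1)); pose k2 := (12 * M)^-1.
pose k3 := (c / (8 * (Cb + 1))) `^ (2 * s)^-1.
have s20 : 0 < 2 * s by lra.
have k10 : 0 < k1 by rewrite divr_gt0//; lra.
have k20 : 0 < k2 by rewrite invr_gt0; lra.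
have b0 : 0 < c / (8 * (Cb + 1)) by rewrite divr_gt0//; lra.
have k30 : 0 < k3 by rewrite powR_gt0.
pose k := Num.min k1 (Num.min k2 k3).
have k0 : 0 < k by rewrite !lt_min k10 k20 k30.
have [l1 l2 l3] : [/\ k <= k1, k <= k2 & k <= k3].
  by split; rewrite /k !ge_min lexx ?orbT.
exists k; split => //.
- apply: (@le_trans _ _ (12 * M * k2)); last by rewrite mulfV//; lra.
  by rewrite mulrA ler_wpM2l//; lra.
- apply: (@le_trans _ _ ((C + 1) * k1)); first by apply: ler_pM => //; lra.
  by rewrite /k1 le_eqVlt; apply/orP; left; apply/eqP; field; lra.
- apply: (@le_trans _ _ (2 * (Cb + 1) * k3 `^ (2 * s))).
    apply: ler_pM; [lra|exact: powR_ge0|lra|].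
    by apply: ge0_ler_powR; rewrite ?nnegrE ?(ltW s20) ?(ltW k0) ?(ltW k30).
  rewrite /k3 -powRrM mulVf ?gt_eqF// powRr1 ?(ltW b0)//.
  by rewrite le_eqVlt; apply/orP; left; apply/eqP; field; lra.
Qed.

(** The order of choices matters: [sigma0] and [C'] precede the kernel, the weight and the point,
    and only [tau] depends on x. *)
Lemma truncated_inequality (M M2 : R) : 1 <= M -> exists2 sigma0, 0 < sigma0 &
  exists2 C', 0 <= C' & forall K eta b u x e Mu a sigma,
  kernel_class s lam Lam K -> weight_ok M eta -> enorm b <= Lam ->
  (forall y z, `|eta y `^ (2 * s) - eta z `^ (2 * s)| <= M2 * enorm (y - z)) ->
  enorm e = 1 -> (forall y, differentiable u y) -> continuous ('D_e u) ->
  (forall y, `|u y| <= Mu) -> continuous a ->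
  (forall y, a x * 'D_e u y <= a x * a y) -> sigma0 <= sigma ->
  exists2 tau, 0 < tau & forall r r', 0 < r -> r < tau / 4 -> 2 * tau <= r' ->
  Iann r r' (fun z => bern (eta x) (eta (x - z)) (a x) (a (x - z)) ('D_e u (x - z))
     (drift s eta x z) * regk K z)
  - sigma * Iann r r' (fun z => (u (x - z) - u x) ^+ 2 * regk K z)
  + 2 * eta x * 'D_b eta x * a x ^+ 2
  <= `|2 * eta x ^+ 2 * a x| * C' * Mu * r' `^ (- (1 + 2 * s)).
Proof.
have [s0 s1] := andP hs.
move=> M1; have [C C0 [c c0 hE]] := energy_cutoff hn hs hlam hLam M1.
have [C6 C60 [C7 C70 hY]] := young_parts.
have Lam0 : 0 < Lam by exact: lt_le_trans hLam.
pose Cb := `|M2| * Lam / (2 * s).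
have Cb0 : 0 <= Cb by rewrite divr_ge0 ?mulr_ge0 ?(ltW Lam0) ?(ltW s0).
(* The cutoff radius is k * eta x; each of the three error terms is a quarter of the gain
   c * eta x ^+ 2 * tau `^ (- (2 * s)). *)
have [k [k0 kM kC kb]] := small_scale C0 c0 Cb0 M1.
(* Makes Young's loss [4 * del * C6 * (k ^+ 2)^-1] at most [c / 4]. *)
pose del := c * k ^+ 2 / (16 * (C6 + 1)).
have del0 : 0 < del by rewrite divr_gt0 ?mulr_gt0 ?exprn_gt0//; lra.
exists (del * lam)^-1; first by rewrite invr_gt0 mulr_gt0.
exists C7 => // K eta b u x e Mu a sigma hK ok hb hl e1 du cw uM ca aw hsig.
have [de pe ge le] := ok; have /andP[p0 pM] := pe x.
have sig0 : 0 <= sigma by apply: le_trans hsig; rewrite invr_ge0 mulr_ge0// ltW.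
have Mu0 : 0 <= Mu by apply: le_trans (uM 0).
have cu : continuous u by move=> y; exact: differentiable_continuous.
have tK := tame_regk hn hs hlam hLam hK.
have U20 r r' : 0 <= Iann r r' (fun z => (u (x - z) - u x) ^+ 2 * regk K z).
  by apply: Iann_ge0 => z _; rewrite mulr_ge0 ?sqr_ge0// (regk_ge0 hn hs hlam hK).
have td := tame_drift s eta x.
have teta : tame (fun z => eta (x - z)) by apply: tame_comp_sub; exact: weight_continuous ok.
have ta : tame (fun z => a (x - z)) by exact: tame_comp_sub.
have tw := tame_comp_sub x cw.
have tb : tame (fun z => bern (eta x) (eta (x - z)) (a x) (a (x - z)) ('D_e u (x - z))
     (drift s eta x z)).
  rewrite /bern; apply: tameB; last by apply: tameZ; exact: tameZ.
  apply: tameD; last exact: tameZ.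
  apply: tameB; first exact: tame_cst.
  by apply: tameM; exact: tameX.
have err0 r' : 0 <= `|2 * eta x ^+ 2 * a x| * C7 * Mu * r' `^ (- (1 + 2 * s)).
  by rewrite !mulr_ge0 ?powR_ge0.
(* On the zero set of eta the integrand is at most 0 and the drift term vanishes; the radius 1 is
   arbitrary. *)
have [px|px] := eqVneq (eta x) 0.
  exists 1 => // r r' r0 _ _; apply: le_trans (err0 r').
  have : Iann r r' (fun z => bern (eta x) (eta (x - z)) (a x) (a (x - z)) ('D_e u (x - z))
     (drift s eta x z) * regk K z) <= Iann r r' (fun _ : 'rV[R]_n => 0).
    apply: le_Iann => //; [exact: tameM|exact: tame_cst|].
    move=> z _; apply: mulr_le0_ge0; last exact: (regk_ge0 hn hs hlam hK).
    rewrite /bern px.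
    have : 0 <= eta (x - z) ^+ 2 * a (x - z) ^+ 2 by rewrite mulr_ge0 ?sqr_ge0.
    clear; lra.
  rewrite Iann_cst mul0r px; have := U20 r r' => U h.
  have := mulr_ge0 sig0 U; move: h; clear; lra.
have {}px : 0 < eta x by rewrite lt_neqAle eq_sym px.
pose p := eta x; pose tau := k * p.
have tau0 : 0 < tau by rewrite mulr_gt0.
have ht : 12 * (M * tau) <= eta x.
  rewrite (_ : _ * _ = 12 * (M * k) * eta x); last by rewrite /tau /p; ring.
  by rewrite -[leRHS]mul1r ler_wpM2r.
exists tau => // r r' r0 rt tr'.
pose A := 2 * p ^+ 2 * a x.
pose Q := fun z => (bern p (eta (x - z)) (a x) (a (x - z)) ('D_e u (x - z))
  (drift s eta x z) - 2 * p ^+ 2 * a x * (cutoff tau z * 'D_e u (x - z))) * regk K z.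
have rt2 : r < tau / 2 by move: tau0 rt; clear; lra.
have hQ : Iann r r' Q <= a x ^+ 2 * (C * p * tau `^ (1 - 2 * s) - c * p ^+ 2 * tau `^ (- (2 * s))).
  exact: (hE K eta a ('D_e u) x tau r r' hK ok ca cw aw r0 rt2 tr' ht).
have tr1 : tau <= r' by move: tau0 tr'; clear; lra.
have hA := hY K u x e Mu A del tau r r' hK e1 du cw uM del0 r0 rt tr1.
have tc := tame_cutoff n tau.
have tw' : tame (fun z => cutoff tau z * 'D_e u (x - z) * regk K z).
  by apply: tameM => //; exact: tameM.
rewrite (@eq_Iann _ _ _ _ _ (fun z => Q z + A * (cutoff tau z * 'D_e u (x - z) * regk K z))); last first.
  by move=> z _; rewrite /Q /A -/p; ring.
rewrite IannD//; last 2 first.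
- by apply: tameM => //; apply: tameB => //; apply: tameZ; exact: tameM.
- exact: tameZ.
rewrite IannZ//.
set E := Iann r r' (fun z => (u (x - z) - u x) ^+ 2 * regk K z) in hA *.
have E0 : 0 <= E by exact: U20.
have hsE : (del * lam)^-1 * E <= sigma * E by rewrite ler_wpM2r.
(* The common unit: up to [a x ^+ 2], gain and losses are controlled by multiples of it whose
   coefficients do not involve eta(x). *)
pose Z := p ^+ 2 * tau `^ (- (2 * s)).
have Z0 : 0 <= Z by rewrite mulr_ge0 ?sqr_ge0 ?powR_ge0.
have z1 : p * tau `^ (1 - 2 * s) = k * Z.
  rewrite -mulr_powR// /Z /tau; ring.
have k20 : 0 < k ^+ 2 by rewrite exprn_gt0.
have z2 : A ^+ 2 * tau `^ (- (2 + 2 * s)) = 4 * a x ^+ 2 * (k ^+ 2)^-1 * Z.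
  have -> : - (2 + 2 * s) = - 1 + (- 1 + - (2 * s)) by ring.
  rewrite -!mul_powR// powR_inv1 ?(ltW tau0)// /Z /A /tau; field.
  by rewrite !gt_eqF.
(* The right-hand side is eta(x)^(2-2s), the size of the drift term. *)
have z3 : k `^ (2 * s) * Z = p * p `^ (1 - 2 * s).
  rewrite /Z /tau (powRM _ (ltW k0) (ltW px)).
  rewrite (_ : _ * _ = k `^ (2 * s) * k `^ (- (2 * s)) * (p * (p * p `^ (- (2 * s))))); last by ring.
  by rewrite mul_powR// addrN powRr0 mul1r mulr_powR.
have hdel : 4 * del * C6 * (k ^+ 2)^-1 <= c / 4.
  rewrite (_ : _ * _ = c / 4 * (C6 / (C6 + 1))); last first.
    by rewrite /del; field; rewrite !gt_eqF ?ltr_wpDl.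
  by rewrite ler_piMr ?divr_ge0 ?(ltW c0)// ler_pdivrMr ?ltr_wpDl// mul1r lerDl.
have hdrift : 2 * p * 'D_b eta x * a x ^+ 2 <= a x ^+ 2 * (2 * Cb * k `^ (2 * s) * Z).
  rewrite mulrC ler_wpM2l ?sqr_ge0//.
  have := weight_drift b s0 (de x) hl px; rewrite -/p => hw.
  have hw2 : p `^ (2 * s - 1) * `|'D_b eta x| <= Cb.
    apply: le_trans hw _; rewrite /Cb ler_wpM2r ?invr_ge0 ?mulr_ge0 ?(ltW s0)//.
    apply: (@le_trans _ _ (`|M2| * enorm b)); last by rewrite ler_wpM2l.
    by rewrite ler_wpM2r ?enorm_ge0// ler_norm.
  rewrite -(mulrA 2) -(mulrA (2 * Cb)) z3 -(mulrA 2) ler_wpM2l//.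
  apply: (@le_trans _ _ (p * `|'D_b eta x|)); first by rewrite ler_wpM2l ?ler_norm// ltW.
  rewrite mulrCA ler_wpM2l ?(ltW px)//.
  have -> : `|'D_b eta x| = p `^ (2 * s - 1) * `|'D_b eta x| * p `^ (1 - 2 * s).
    rewrite mulrAC mul_powR// (_ : _ + _ = 0); last by ring.
    by rewrite powRr0 mul1r.
  by rewrite ler_wpM2r ?powR_ge0.
have a20 : 0 <= a x ^+ 2 by exact: sqr_ge0.
have aZ : 0 <= a x ^+ 2 * Z by exact: mulr_ge0.
have q1 : C * k * (a x ^+ 2 * Z) <= c / 4 * (a x ^+ 2 * Z) by rewrite ler_wpM2r.
have q2 : 4 * del * C6 * (k ^+ 2)^-1 * (a x ^+ 2 * Z) <= c / 4 * (a x ^+ 2 * Z) by rewrite ler_wpM2r.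
have q3 : 2 * Cb * k `^ (2 * s) * (a x ^+ 2 * Z) <= c / 4 * (a x ^+ 2 * Z) by rewrite ler_wpM2r.
have e2 : del * A ^+ 2 * C6 * tau `^ (- (2 + 2 * s)) = 4 * del * C6 * (k ^+ 2)^-1 * (a x ^+ 2 * Z).
  rewrite (_ : _ * _ = del * C6 * (A ^+ 2 * tau `^ (- (2 + 2 * s)))); last by ring.
  by rewrite z2; ring.
have e3 : a x ^+ 2 * (C * p * tau `^ (1 - 2 * s) - c * p ^+ 2 * tau `^ (- (2 * s))) =
    C * k * (a x ^+ 2 * Z) - c * (a x ^+ 2 * Z).
  rewrite -(mulrA C) z1 /Z; ring.
have e4 : a x ^+ 2 * (2 * Cb * k `^ (2 * s) * Z) = 2 * Cb * k `^ (2 * s) * (a x ^+ 2 * Z) by ring.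
rewrite e3 in hQ; rewrite e2 in hA; rewrite e4 in hdrift.
have caZ : 0 <= c * (a x ^+ 2 * Z) by rewrite mulr_ge0// ltW.
rewrite -/p -/A.
set W := A * Iann _ _ _ in hA *; set IQ := Iann r r' Q in hQ *.
set ERR := `|A| * C7 * Mu * _ in hA *.
clear -hA hQ hdrift hsE q1 q2 q3 caZ; lra.
Qed.

End truncated_inequality.

(** * Passage to the limit *)

Section limits.
Variables (R : realType) (n : nat) (s lam Lam : R).
Hypotheses (hn : (0 < n)%N) (hs : 0 < s < 1) (hlam : 0 < lam) (hLam : lam <= Lam).
Variable K : 'rV[R]_n -> \bar R.
Hypothesis hK : kernel_class s lam Lam K.
Implicit Types (eta a w u f g : 'rV[R]_n -> R) (x z e b v : 'rV[R]_n) (al r : R).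

Let tK : tame (regk K).
Proof. exact: tame_regk hn hs hlam hLam hK. Qed.

(** Tameness is included because additivity of the truncated integrals calls for it. *)
Definition cvg_origin g : Prop := tame g /\
  exists l : R, Iann r 1 (fun z => g z * regk K z) @[r --> 0^'+] --> l.

Definition cvg_infinity g : Prop := tame g /\
  exists l : R, Iann 1 r (fun z => g z * regk K z) @[r --> +oo] --> l.

Let tgK g : tame g -> tame (fun z => g z * regk K z).
Proof. by move=> tg; exact: tameM. Qed.

Lemma cvg_originD f g : cvg_origin f -> cvg_origin g -> cvg_origin (fun z => f z + g z).
Proof.
move=> [tf [l hl]] [tg [m hm]]; split; first exact: tameD.
exists (l + m).
have h : (Iann r 1 (fun z => f z * regk K z) + Iann r 1 (fun z => g z * regk K z))
    @[r --> 0^'+] --> l + m by exact: cvgD.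
apply: cvg_trans h; apply: near_eq_cvg; near=> r.
have r0 : 0 < r by near: r; exact: nbhs_right_gt.
rewrite -IannD; [|exact: r0|exact: tgK|exact: tgK].
by apply: eq_Iann => z _; rewrite mulrDl.
Unshelve. all: by end_near. Qed.

Lemma cvg_originZ c g : cvg_origin g -> cvg_origin (fun z => c * g z).
Proof.
move=> [tg [m hm]]; split; first exact: tameZ.
exists (c * m).
have h : (c * Iann r 1 (fun z => g z * regk K z)) @[r --> 0^'+] --> c * m by exact: cvgMr.
apply: cvg_trans h; apply: near_eq_cvg; near=> r.
have r0 : 0 < r by near: r; exact: nbhs_right_gt.
rewrite -IannZ; [|exact: r0|exact: tgK].
by apply: eq_Iann => z _; rewrite mulrA.
Unshelve. all: by end_near. Qed.

Lemma cvg_infinityD f g : cvg_infinity f -> cvg_infinity g -> cvg_infinity (fun z => f z + g z).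
Proof.
move=> [tf [l hl]] [tg [m hm]]; split; first exact: tameD.
exists (l + m).
have h : (Iann 1 r (fun z => f z * regk K z) + Iann 1 r (fun z => g z * regk K z))
    @[r --> +oo] --> l + m by exact: cvgD.
apply: cvg_trans h; apply: near_eq_cvg; apply: nearW => r.
rewrite -IannD; [|exact: ltr01|exact: tgK|exact: tgK].
by apply: eq_Iann => z _; rewrite mulrDl.
Qed.

Lemma cvg_infinityZ c g : cvg_infinity g -> cvg_infinity (fun z => c * g z).
Proof.
move=> [tg [m hm]]; split; first exact: tameZ.
exists (c * m).
have h : (c * Iann 1 r (fun z => g z * regk K z)) @[r --> +oo] --> c * m by exact: cvgMr.
apply: cvg_trans h; apply: near_eq_cvg; apply: nearW => r.
rewrite -IannZ; [|exact: ltr01|exact: tgK].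
by apply: eq_Iann => z _; rewrite mulrA.
Qed.

Lemma cvg_origin_ext f g : (forall z, f z = g z) -> cvg_origin f -> cvg_origin g.
Proof. by move=> /funext ->. Qed.

Lemma cvg_infinity_ext f g : (forall z, f z = g z) -> cvg_infinity f -> cvg_infinity g.
Proof. by move=> /funext ->. Qed.

Lemma cvg_origin_bound g al C : tame g -> 2 * s < al -> 0 <= C ->
  (forall z, enorm z <= 1 -> `|g z| <= C * enorm z `^ al) -> cvg_origin g.
Proof.
move=> tg hal C0 hg; split => //.
have [D D0 hD] := Iann_kernel_inner hn hs hlam hLam hal.
apply: (@cvg_Iann_inner _ _ _ (D * C) (al - 2 * s)); [exact: tgK|by rewrite subr_gt0|].
move=> r r' r0 rr' r'1; apply: hD => //; first exact: lt_trans rr'.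
by move=> z /andP[_ zr]; apply: hg; exact: le_trans (ltW zr) r'1.
Qed.

(** The truncated integrals vanish identically, so the principal value exists without absolute
    convergence. *)
Lemma cvg_origin_cancel v : s = 2^-1 -> cvg_origin (dot v).
Proof.
move=> s2; split; first exact: tame_dot.
exists 0; have h : (0 : R) @[r --> (0:R)^'+] --> (0 : R) by exact: cvg_cst.
apply: cvg_trans h; apply: near_eq_cvg; near=> r.
have r0 : 0 < r by near: r; exact: nbhs_right_gt.
by rewrite (regk_cancel hn hs hlam hLam hK).
Unshelve. all: by end_near. Qed.

Lemma cvg_infinity_bound g al C : tame g -> al < 2 * s -> 0 <= C ->
  (forall z, 1 <= enorm z -> `|g z| <= C * enorm z `^ al) -> cvg_infinity g.
Proof.
move=> tg hal C0 hg; split => //.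
have [D D0 hD] := Iann_kernel_outer hn hs hlam hLam hal.
apply: (@cvg_Iann_outer _ _ _ (D * C) (2 * s - al)); [exact: tgK|by rewrite subr_gt0|].
move=> r r' r1 rr'; apply: hD => //; first exact: lt_le_trans r1.
by move=> z /andP[rz _]; apply: hg; exact: le_trans rz.
Qed.

Lemma cvg_infinity_bounded g C : tame g -> 0 <= C ->
  (forall z, `|g z| <= C) -> cvg_infinity g.
Proof.
have [s0 s1] := andP hs.
move=> tg C0 hg; apply: (@cvg_infinity_bound g 0 C) => //; first lra.
by move=> z _; rewrite powRr0 mulr1.
Qed.

Lemma cvg_infinity_linear v : cvg_infinity (fun z => if 2^-1 < s then dot v z else 0).
Proof.
have [s2|s2] := ltP 2^-1 s; last first.
  by apply: (@cvg_infinity_bounded _ 0) => //; [exact: tame_cst|move=> z; rewrite normr0].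
apply: (@cvg_infinity_bound _ 1 (enorm v)); [exact: tame_dot|lra|exact: enorm_ge0|].
by move=> z _; rewrite powRr1 ?enorm_ge0// dot_le.
Qed.

(** The derivative may be unbounded; smallness of its tails comes from [tail_parts], with rate
    r^(-1-2s). *)
Lemma cvg_infinity_derive u e x (Mu : R) : enorm e = 1 -> C1 u -> (forall y, `|u y| <= Mu) ->
  cvg_infinity (fun z => 'D_e u (x - z)).
Proof.
have [s0 s1] := andP hs.
move=> e1 C1u uM; have cw := C1_dir_continuous (e := e) C1u; have [du _] := C1u.
split; first exact: (tame_comp_sub x cw).
have [C C0 hC] := tail_parts hn hs hlam hLam.
apply: (@cvg_Iann_outer _ _ _ (C * Mu) (1 + 2 * s)); [by apply: tgK; exact: (tame_comp_sub x cw)|lra|].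
by move=> r r' r1 rr'; apply: hC => //; exact: lt_le_trans r1.
Qed.

(** Unlike in [Lint], the gradient is subtracted at s = 1/2 too; there the difference has vanishing
    integrals. *)
Definition inner_regular f x : Prop := exists al C, [/\ 2 * s < al, 0 <= C &
  forall z, enorm z <= 1 ->
    `|f x - f (x - z) - (if 2^-1 <= s then dot (grad f x) z else 0)| <= C * enorm z `^ al].

Lemma cvg_origin_Lint f x : continuous f -> inner_regular f x -> cvg_origin (Lint s f x).
Proof.
move=> cf [al [C [hal C0 h]]].
have tf : tame (fun z => f x - f (x - z)).
  by apply: tameB; [exact: tame_cst|exact: tame_comp_sub].
pose g z := f x - f (x - z) - (if 2^-1 <= s then dot (grad f x) z else 0).
have tg : tame g.
  by rewrite /g; apply: tameB => //; case: (2^-1 <= s); [exact: tame_dot|exact: tame_cst].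
have cg : cvg_origin g by exact: cvg_origin_bound hal C0 h.
have [E|E] := eqVneq s 2^-1.
  apply: (cvg_origin_ext _ (cvg_originD cg (cvg_origin_cancel (grad f x) E))) => z.
  by rewrite /g /Lint E lexx ltxx; ring.
apply: (cvg_origin_ext _ cg) => z; rewrite /g /Lint.
by rewrite le_eqVlt eq_sym (negbTE E)/=; case: ifP => // _; rewrite subr0.
Qed.

Lemma cvg_L f x : continuous f -> cvg_origin (Lint s f x) -> cvg_infinity (Lint s f x) ->
  exists l : R, [/\ L_finite s K f x, L s K f x = l%:E &
   Iann p.1 p.2 (fun z => Lint s f x z * regk K z) @[p --> @L_filter R] --> l].
Proof.
move=> cf [tf [l hl]] [_ [m hm]]; exists (l + m).
have h := cvg_Iann_fin (tgK tf) hl hm.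
have [h1 h2] := L_cvg hn hs hlam hLam hK cf h.
split => //; first by split => //; rewrite h2.
exact: (fine_cvg h).
Qed.

(** At infinity [Lint] is a function with convergent integrals minus f(x - z) >= 0, whose integrals
    increase with the radius. The limit thus exists, possibly as -oo, with no growth condition on
    f. *)
Lemma cvg_L_energy f x : continuous f -> (forall y, 0 <= f y) -> cvg_origin (Lint s f x) ->
  exists l : \bar R, [/\ L_exists s K f x, L s K f x = l &
   (Iann p.1 p.2 (fun z => Lint s f x z * regk K z))%:E @[p --> @L_filter R] --> l].
Proof.
move=> cf f0 [tf [l hl]].
have tfx : tame (fun z => f (x - z)) by exact: tame_comp_sub.
pose g z := f x - (if 2^-1 < s then dot (grad f x) z else 0).
have tg : tame g.
  by rewrite /g; apply: tameB; [exact: tame_cst|case: (2^-1 < s); [exact: tame_dot|exact: tame_cst]].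
have [_ [m hm]] : cvg_infinity g.
  apply: (cvg_infinity_ext (f := fun z => f x + (-1) * (if 2^-1 < s then dot (grad f x) z else 0))).
    by move=> z; rewrite mulN1r.
  apply: cvg_infinityD; last by apply: cvg_infinityZ; exact: cvg_infinity_linear.
  by apply: (@cvg_infinity_bounded _ `|f x|) => //; exact: tame_cst.
have [k k0 hk] := @cvg_Iann_nonneg R n (fun z => f (x - z) * regk K z) (tgK tfx)
  (fun z => mulr_ge0 (f0 _) (regk_ge0 hn hs hlam hK z)).
have hinf : (Iann 1 r (fun z => Lint s f x z * regk K z))%:E @[r --> +oo] --> (m%:E - k)%E.
  have hm' : (Iann 1 r (fun z => g z * regk K z))%:E @[r --> +oo] --> m%:E.
    by apply: cvg_EFin; first exact: nearW.
  have ad : (m%:E +? - k)%E by [].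
  have h : ((Iann 1 r (fun z => g z * regk K z))%:E - (Iann 1 r (fun z => f (x - z) * regk K z))%:E)%E
      @[r --> +oo] --> (m%:E - k)%E := cvgeB ad hm' hk.
  suff E : (fun r => (Iann 1 r (fun z => Lint s f x z * regk K z))%:E) =
      (fun r => (Iann 1 r (fun z => g z * regk K z))%:E -
        (Iann 1 r (fun z => f (x - z) * regk K z))%:E)%E.
  by rewrite E; exact: h.
  apply/funext => r; rewrite -EFinN -EFinD -IannB; [|exact: ltr01|exact: tgK|exact: tgK].
  congr EFin; apply: eq_Iann => z _; rewrite -mulrBl /g /Lint; congr (_ * _).
  by case: ifP => _; rewrite ?subr0// addrAC.
have h := cvg_Iann_ereal (tgK tf) hl hinf.
have [h1 h2] := L_cvg hn hs hlam hLam hK cf h.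
by exists (l%:E + (m%:E - k))%E.
Qed.

End limits.

Section solution_regularity.
Variables (R : realType) (n : nat) (s eps : R) (u : 'rV[R]_n -> R).
Hypotheses (hs : 0 < s < 1) (heps : 0 < eps).
Hypothesis hu : holder_loc (1 + 2 * s + eps) u.
Implicit Types (x e : 'rV[R]_n).

Lemma inner_regular_solution x : inner_regular s u x.
Proof.
have [s0 s1] := andP hs.
have C1u := holder_loc_C1 hs heps hu.
have [s2|s2] := ltP s 2^-1.
  have [C C0 hC] := C1_lip x C1u; exists 1, C; split => //; first lra.
  by move=> z z1; rewrite (leNgt 2^-1) s2/= subr0; exact: hC.
have [C1d _] := holder_loc_high hs heps hu 0 s2.
have [|C C0 hC] := @taylor1 R n u x 1 ler01 C1u.1.
  by move=> i; exact: C1_lip.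
exists (1 + 1), C; split => //; first lra.
by move=> z z1; rewrite s2; exact: hC.
Qed.

Lemma inner_regular_derivative e x : inner_regular s ('D_e u) x.
Proof.
have [s0 s1] := andP hs.
have [s2|s2] := ltP s 2^-1.
  have [al /andP[hal _] [C C0 hC]] := holder_loc_low hs heps hu e x s2.
  exists al, C; split => //.
  by move=> z z1; rewrite (leNgt 2^-1) s2/= subr0; exact: hC.
have [_ [al [hal al0] [[dw _] hw]]] := holder_loc_high hs heps hu e s2.
have [C C0 hC] := taylor1 al0 dw (hw x).
exists (1 + al), C; split => //.
by move=> z z1; rewrite s2; exact: hC.
Qed.

(** [s < gam] makes squared increments of the derivative integrable at the origin, and
    [2 * s < 1 + gam] does so for their products with Lipschitz increments. *)
Lemma holder_derivative e x :
  exists2 gam, s < gam /\ 2 * s < 1 + gam & holder_at gam ('D_e u) x.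
Proof.
have [s0 s1] := andP hs.
have [s2|s2] := ltP s 2^-1.
  have [al /andP[h1 h2] h] := holder_loc_low hs heps hu e x s2.
  by exists al => //; split; lra.
have [_ [al _ [C1w _]]] := holder_loc_high hs heps hu e s2.
by exists 1; [split; lra|exact: C1_lip].
Qed.

Lemma derivable_derivative e x v : 2^-1 < s -> derivable ('D_e u) x v.
Proof.
move=> s2; have [_ [al _ [[dw _] _]]] := holder_loc_high hs heps hu e (ltW s2).
exact: diff_derivable.
Qed.

End solution_regularity.

(** * Both inequalities at a point, through a common notion of truncation *)

Section bernstein.
Variables (R : realType) (n : nat) (s lam Lam : R).
Hypotheses (hn : (0 < n)%N) (hs : 0 < s < 1) (hlam : 0 < lam) (hLam : lam <= Lam).

(* What the two inequalities have in common: a = w in the first one and a = w_+ in the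
   second one, so that w = a - d with d >= 0 and a d = 0 at each point. *)
Record truncation (w a : 'rV[R]_n -> R) : Prop := {
  truncation_le : forall x y, a x * w y <= a x * a y ;
  truncation_sq : forall x, a x * w x = a x ^+ 2 ;
  truncation_lip : forall x y, `|a x - a y| <= `|w x - w y| ;
  truncation_gap : forall x y, a x * (a y - w y) <= (w x - w y) ^+ 2 ;
  truncation_derive : forall x v d, is_derive x v w d ->
    is_derive x v (fun y => a y ^+ 2) (2 * a x * d) }.

Lemma truncation_id w : truncation w w.
Proof.
split => // [x y|x v d].
- by rewrite subrr mulr0 sqr_ge0.
- exact: is_derive_sq.
Qed.

(** The gap can be nonzero only if w(x) > 0 > w(y), where it equals - w(x) w(y), at most (w(x) -
    w(y))^2. *)
Lemma truncation_pos w : truncation w (fun y => Num.max (w y) 0).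
Proof.
split => [x y|x|x y|x y|x v d].
- by apply: ler_wpM2l; rewrite le_max lexx ?orbT.
- by case: leP => h; rewrite ?mul0r ?expr0n// expr2.
- by rewrite ![Num.max _ 0]maxC max0_lip.
- case: (leP (w x) 0) => hx; first by rewrite mul0r sqr_ge0.
  case: (leP (w y) 0) => hy; last by rewrite subrr mulr0 sqr_ge0.
  have : 0 <= w x * - w y by rewrite mulr_ge0 ?oppr_ge0 ?(ltW hx).
  have := sqr_ge0 (w x); have := sqr_ge0 (w y).
  nra.
- exact: is_derive_pos_sq.
Qed.

Lemma truncation_continuous w a : truncation w a -> continuous w -> continuous a.
Proof.
move=> ta cw x; apply/(@cvgrPdist_lt _ _ _ (nbhs (x : 'rV[R]_n)) (nbhs_filter _)) => e e0.
have /(@cvgrPdist_lt _ _ _ (nbhs (x : 'rV[R]_n)) (nbhs_filter _)) /(_ e e0) := cw x.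
by apply: filterS => y; apply: le_lt_trans; exact: truncation_lip.
Qed.

Section at_point.
Variables (M sigma : R) (K : 'rV[R]_n -> \bar R) (eta u a : 'rV[R]_n -> R).
Variables (eps Mu : R) (b e x : 'rV[R]_n).
Hypotheses (hM : 1 <= M) (hsig : 0 <= sigma).
Hypotheses (hK : kernel_class s lam Lam K) (ok : weight_ok M eta).
Hypotheses (heps : 0 < eps) (hu : holder_loc (1 + 2 * s + eps) u).
Hypotheses (he : enorm e = 1) (hMu : forall y, `|u y| <= Mu).
Hypothesis (ta : truncation ('D_e u) a).
Hypothesis (hb : derivable ('D_e u) x b).

Let w := 'D_e u.
Let F y := eta y ^+ 2 * a y ^+ 2 + sigma * u y ^+ 2.

Let C1u : C1 u.
Proof. exact: holder_loc_C1 hs heps hu. Qed.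
Let cu : continuous u.
Proof. exact: C1_continuous. Qed.
Let cw : continuous w.
Proof. exact: C1_dir_continuous. Qed.
Let ca : continuous a.
Proof. exact: truncation_continuous ta cw. Qed.
Let ceta : continuous eta.
Proof. exact: weight_continuous ok. Qed.

Let cX (f : 'rV[R]_n -> R) : continuous f -> continuous (fun y => f y ^+ 2).
Proof.
move=> cf y; apply: (@continuous_comp _ _ _ f (fun t => t ^+ 2)); first exact: cf.
exact: exprn_continuous.
Qed.

Let cF : continuous F.
Proof.
move=> y; apply: (@continuousD _ _ _ (fun y => eta y ^+ 2 * a y ^+ 2) (fun y => sigma * u y ^+ 2)).
  by apply: (@continuousM _ _ (fun y => eta y ^+ 2) (fun y => a y ^+ 2)); exact: cX.
apply: (@continuousM _ _ (fun=> sigma) (fun y => u y ^+ 2)); last exact: cX.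
exact: cst_continuous.
Qed.

Let derive_F v : derivable w x v -> 'D_v F x =
  2 * eta x * 'D_v eta x * a x ^+ 2 + 2 * eta x ^+ 2 * a x * 'D_v w x + 2 * sigma * u x * 'D_v u x.
Proof.
move=> dw; have [de _ _ _] := ok.
apply: (@derive_energy R n eta (fun y => a y ^+ 2) u x v sigma (a x)).
- by apply: derivableP; exact: diff_derivable.
- by apply: truncation_derive ta _ _ _ _; exact: derivableP.
- by apply: derivableP; apply: diff_derivable; exact: C1u.1.
Qed.

Let B z := bern (eta x) (eta (x - z)) (a x) (a (x - z)) (w (x - z)) (drift s eta x z).

(** The value terms combine because [a x * w x] is [a x ^+ 2]; for s > 1/2 the gradient of [F]
    splits in the same pattern, by [derive_F]. *)
Let Lint_F z : Lint s F x z = 2 * eta x ^+ 2 * a x * Lint s w x z +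
  2 * sigma * u x * Lint s u x z + B z - sigma * (u (x - z) - u x) ^+ 2.
Proof.
have sq := truncation_sq ta x; rewrite -/w in sq.
rewrite /Lint /B /bern /drift; case: ifP => s2; last first.
  rewrite /F.
  transitivity (eta x ^+ 2 * a x ^+ 2 + sigma * u x ^+ 2 - (eta (x - z) ^+ 2 * a (x - z) ^+ 2 + sigma * u (x - z) ^+ 2)
     + 2 * eta x ^+ 2 * (a x * w x - a x ^+ 2)); last by ring.
  by rewrite sq; ring.
have -> : dot (grad F x) z = 2 * eta x * a x ^+ 2 * dot (grad eta x) z +
   2 * eta x ^+ 2 * a x * dot (grad w x) z + 2 * sigma * u x * dot (grad u x) z.
  rewrite -!dotZl -!dotDl; congr (dot _ z); apply/rowP => i; rewrite !mxE.
  rewrite derive_F; last exact: derivable_derivative hs heps hu _ _ _ s2.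
  by ring.
rewrite /F.
transitivity (eta x ^+ 2 * a x ^+ 2 + sigma * u x ^+ 2 - (eta (x - z) ^+ 2 * a (x - z) ^+ 2 + sigma * u (x - z) ^+ 2)
     + 2 * eta x ^+ 2 * (a x * w x - a x ^+ 2) - (2 * eta x * a x ^+ 2 * dot (grad eta x) z +
   2 * eta x ^+ 2 * a x * dot (grad w x) z + 2 * sigma * u x * dot (grad u x) z)); last by ring.
by rewrite sq; ring.
Qed.

Let te : tame (fun z => eta (x - z)).
Proof. exact: tame_comp_sub. Qed.
Let tu : tame (fun z => u (x - z)).
Proof. exact: tame_comp_sub. Qed.
Let tw : tame (fun z => w (x - z)).
Proof. exact: (tame_comp_sub x cw). Qed.
Let taa : tame (fun z => a (x - z)).
Proof. exact: tame_comp_sub. Qed.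

Let U2_zero : cvg_origin K (fun z => (u (x - z) - u x) ^+ 2).
Proof.
have [s0 s1] := andP hs.
have [C C0 hC] := C1_lip x C1u.
apply: (@cvg_origin_bound R n s lam Lam hn hs hlam hLam K hK _ 2 (C ^+ 2)).
- by apply: tameX; apply: tameB => //; exact: tame_cst.
- lra.
- exact: sqr_ge0.
move=> z z1; rewrite normrX distrC (powR_mulrn 2) ?enorm_ge0// -exprMn.
rewrite ler_sqr ?nnegrE ?mulr_ge0 ?enorm_ge0//.
by have := hC z z1; rewrite powRr1 ?enorm_ge0.
Qed.

Let weight_sq_bound z : `|eta x ^+ 2 - eta (x - z) ^+ 2| <= 2 * M ^+ 2 * enorm z.
Proof.
have [de pe ge le] := ok.
have M0 : 0 <= M by move: hM => ?; lra.
have /andP[? ?] := pe x; have /andP[? ?] := pe (x - z).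
rewrite subr_sqr normrM (_ : 2 * _ * _ = M * enorm z * (2 * M)); last by ring.
apply: ler_pM => //; first exact: weight_lip de ge x z.
by rewrite ger0_norm; lra.
Qed.

Let weight_zero : cvg_origin K (fun z => (eta x ^+ 2 - eta (x - z) ^+ 2) - 2 * eta x * drift s eta x z).
Proof.
have [s0 s1] := andP hs.
have [de pe ge le] := ok.
have M0 : 0 <= M by move: hM => ?; lra.
have /andP[p0 pM] := pe x.
have tE : tame (fun z => eta x ^+ 2 - eta (x - z) ^+ 2).
  by apply: tameB; [exact: tame_cst|exact: tameX].
have td := tame_drift s eta x.
have [s2|s2] := ltP s 2^-1.
  apply: (@cvg_origin_bound R n s lam Lam hn hs hlam hLam K hK _ 1 (2 * M ^+ 2)).
  - by apply: tameB => //; exact: tameZ.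
  - lra.
  - by rewrite mulr_ge0 ?sqr_ge0.
  move=> z _; rewrite /drift ltNge (ltW s2)/= mulr0 subr0 powRr1 ?enorm_ge0//.
have main : cvg_origin K (fun z => (eta x ^+ 2 - eta (x - z) ^+ 2) - 2 * eta x * dot (grad eta x) z).
  apply: (@cvg_origin_bound R n s lam Lam hn hs hlam hLam K hK _ 2 (3 * M ^+ 2)).
  - by apply: tameB => //; apply: tameZ; exact: tame_dot.
  - lra.
  - by rewrite mulr_ge0 ?sqr_ge0.
  move=> z _; rewrite (powR_mulrn 2) ?enorm_ge0//.
  have h1 := weight_lip de ge x z; have h2 := weight_taylor de ge le x z.
  rewrite (_ : _ - _ = 2 * eta x * (eta x - eta (x - z) - dot (grad eta x) z)
    - (eta x - eta (x - z)) ^+ 2); last by ring.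
  apply: le_trans (ler_normB _ _) _.
  have : `|2 * eta x * (eta x - eta (x - z) - dot (grad eta x) z)| <= 2 * (M ^+ 2 * enorm z ^+ 2).
    rewrite normrM ger0_norm ?mulr_ge0// -mulrA ler_wpM2l// (expr2 M) -mulrA.
    by apply: ler_pM.
  have : `|(eta x - eta (x - z)) ^+ 2| <= M ^+ 2 * enorm z ^+ 2.
    by rewrite normrX -exprMn ler_sqr ?nnegrE// mulr_ge0 ?enorm_ge0.
  lra.
have [E|E] := eqVneq s 2^-1.
  apply: (cvg_origin_ext _ (cvg_originD hn hs hlam hLam hK main
    (cvg_originZ hn hs hlam hLam hK (2 * eta x) (cvg_origin_cancel hn hs hlam hLam hK (grad eta x) E)))) => z.
  by rewrite /drift E ltxx; ring.
apply: (cvg_origin_ext _ main) => z.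
by rewrite /drift lt_neqAle eq_sym E s2.
Qed.

(** [B] is regrouped into four terms: the squared increment of a and the gap, of order 2 gam; the
    product of the increments of eta^2 and a^2, of order 1 + gam; and a(x)^2 times the integrand of
    [weight_zero]. *)
Let B_zero : cvg_origin K B.
Proof.
have [s0 s1] := andP hs.
have M0 : 0 <= M by move: hM => ?; lra.
have [gam [g1 g2] [C C0 hC]] := holder_derivative hs heps hu e x.
have g0 : 0 < gam by exact: lt_trans g1.
have tB f g : tame f -> tame g -> tame (fun z : 'rV[R]_n => f z - g z) by exact: tameB.
have hw z : enorm z <= 1 -> `|w x - w (x - z)| ^+ 2 <= C ^+ 2 * enorm z `^ (2 * gam).
  move=> z1; rewrite (_ : enorm z `^ (2 * gam) = (enorm z `^ gam) ^+ 2).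
    rewrite -exprMn ler_sqr ?nnegrE ?mulr_ge0 ?powR_ge0//; exact: hC.
  by rewrite mulrC powRrM (powR_mulrn 2) ?powR_ge0.
have [Ma Ma0 hMa] := continuous_ball_bound (enorm x + 1) ca.
have p1 : cvg_origin K (fun z => (a x - a (x - z)) ^+ 2).
  apply: (@cvg_origin_bound R n s lam Lam hn hs hlam hLam K hK _ (2 * gam) (C ^+ 2)).
  - by apply: tameX; apply: tameB => //; exact: tame_cst.
  - lra.
  - exact: sqr_ge0.
  move=> z z1; rewrite normrX; apply: le_trans (hw z z1).
  by rewrite ler_sqr ?nnegrE//; exact: truncation_lip.
have p2 : cvg_origin K (fun z => a x * a (x - z) - a x * w (x - z)).
  apply: (@cvg_origin_bound R n s lam Lam hn hs hlam hLam K hK _ (2 * gam) (C ^+ 2)).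
  - by apply: tameB; exact: tameZ.
  - lra.
  - exact: sqr_ge0.
  move=> z z1; rewrite ger0_norm; last by rewrite subr_ge0; exact: truncation_le.
  rewrite -mulrBr; apply: le_trans (truncation_gap ta x (x - z)) _.
  by rewrite -real_normK ?num_real//; exact: hw.
have p3 : cvg_origin K (fun z => (eta x ^+ 2 - eta (x - z) ^+ 2) * (a (x - z) ^+ 2 - a x ^+ 2)).
  apply: (@cvg_origin_bound R n s lam Lam hn hs hlam hLam K hK _ (1 + gam) (2 * M ^+ 2 * (C * (2 * Ma)))).
  - apply: tameM; apply: tameB; try exact: tame_cst; exact: tameX.
  - exact: g2.
  - by rewrite !mulr_ge0 ?sqr_ge0.
  move=> z z1; have [->|z0] := eqVneq z 0.
    by rewrite subr0 !subrr mulr0 normr0 mulr_ge0 ?powR_ge0// !mulr_ge0 ?sqr_ge0.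
  rewrite -mulr_powR ?enorm_gt0// normrM.
  rewrite [leRHS](_ : _ = 2 * M ^+ 2 * enorm z * (C * enorm z `^ gam * (2 * Ma))); last by ring.
  apply: ler_pM => //.
  rewrite subr_sqr normrM; apply: ler_pM => //.
    by rewrite distrC; apply: le_trans (truncation_lip ta _ _) _; exact: hC.
  apply: le_trans (ler_normD _ _) _.
  have : `|a x| <= Ma by apply: hMa; rewrite lerDl.
  have : `|a (x - z)| <= Ma.
    by apply: hMa; apply: le_trans (enormD _ _) _; rewrite enormN lerD2l.
  lra.
have S1 := cvg_originZ hn hs hlam hLam hK (- eta x ^+ 2) p1.
have S2 := cvg_originZ hn hs hlam hLam hK (- (2 * eta x ^+ 2)) p2.
have S3 := cvg_originZ hn hs hlam hLam hK (a x ^+ 2) weight_zero.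
apply: (cvg_origin_ext _ (cvg_originD hn hs hlam hLam hK (cvg_originD hn hs hlam hLam hK S1 S2)
   (cvg_originD hn hs hlam hLam hK p3 S3))) => z.
rewrite /B /bern; ring.
Qed.

Let F_ge0 y : 0 <= F y.
Proof. by rewrite addr_ge0// mulr_ge0// sqr_ge0. Qed.

Let tK : tame (regk K).
Proof. exact: tame_regk hn hs hlam hLam hK. Qed.

Let tB : tame B.
Proof. by case: B_zero. Qed.

Let tU2 : tame (fun z => (u (x - z) - u x) ^+ 2).
Proof. by case: U2_zero. Qed.

Let Lint_infinity f (tf : cvg_infinity K (fun z => f (x - z))) : cvg_infinity K (Lint s f x).
Proof.
have h1 : cvg_infinity K (fun _ : 'rV[R]_n => f x).
  by apply: (@cvg_infinity_bounded R n s lam Lam hn hs hlam hLam K hK _ `|f x|) => //; exact: tame_cst.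
have h2 := cvg_infinity_linear hn hs hlam hLam hK (grad f x).
have h3 := cvg_infinityD hn hs hlam hLam hK (cvg_infinityD hn hs hlam hLam hK h1
  (cvg_infinityZ hn hs hlam hLam hK (-1) tf)) (cvg_infinityZ hn hs hlam hLam hK (-1) h2).
apply: (cvg_infinity_ext _ h3) => z; rewrite /Lint; case: ifP => _; ring.
Qed.

(** The operators of u and of its derivative have real limits and the error vanishes as r' grows, so
    the truncated inequality passes to the limit and keeps the limit for [F] below +oo. *)
Lemma bernstein_at (E tau : R) : 0 < tau ->
  (forall r r', 0 < r -> r < tau / 4 -> 2 * tau <= r' ->
    Iann r r' (fun z => B z * regk K z)
    - sigma * Iann r r' (fun z => (u (x - z) - u x) ^+ 2 * regk K z)
    + 2 * eta x * 'D_b eta x * a x ^+ 2 <= E * r' `^ (- (1 + 2 * s))) ->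
  [/\ L_exists s K F x, L_finite s K w x, L_finite s K u x &
   (Lb s K b F x <= (2 * eta x ^+ 2)%:E * Lb s K b w x * (a x)%:E +
      (2 * sigma)%:E * Lb s K b u x * (u x)%:E)%E].
Proof.
have [s0 s1] := andP hs.
move=> tau0 htr.
have w0 := cvg_origin_Lint hn hs hlam hLam hK cw (inner_regular_derivative hs heps hu e x).
have u0 := cvg_origin_Lint hn hs hlam hLam hK cu (inner_regular_solution hs heps hu x).
have winf : cvg_infinity K (Lint s w x).
  by apply: Lint_infinity; exact: (@cvg_infinity_derive R n s lam Lam hn hs hlam hLam K hK u e x Mu he C1u hMu).
have uinf : cvg_infinity K (Lint s u x).
  apply: Lint_infinity.
  apply: (@cvg_infinity_bounded R n s lam Lam hn hs hlam hLam K hK _ Mu) => //.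
  exact: le_trans (hMu 0).
have [lw [fw Lw cvw]] := cvg_L hn hs hlam hLam hK cw w0 winf.
have [lu [fu Lu cvu]] := cvg_L hn hs hlam hLam hK cu u0 uinf.
have F0 : cvg_origin K (Lint s F x).
  apply: (cvg_origin_ext _ (cvg_originD hn hs hlam hLam hK (cvg_originD hn hs hlam hLam hK
    (cvg_originZ hn hs hlam hLam hK (2 * eta x ^+ 2 * a x) w0)
    (cvg_originZ hn hs hlam hLam hK (2 * sigma * u x) u0))
    (cvg_originD hn hs hlam hLam hK B_zero (cvg_originZ hn hs hlam hLam hK (- sigma) U2_zero)))) => z.
  by rewrite Lint_F; ring.
have [lF [eF LF cvF]] := cvg_L_energy hn hs hlam hLam hK cF F_ge0 F0.
split => //.
rewrite /Lb LF Lw Lu (derive_F hb).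
set D := 2 * eta x * 'D_b eta x * a x ^+ 2.
have key : (lF <= (2 * eta x ^+ 2 * a x * lw + 2 * sigma * u x * lu - D)%:E)%E.
  have cve : (E * p.2 `^ (- (1 + 2 * s))) @[p --> @L_filter R] --> (0 : R).
    have q0 : 0 < 1 + 2 * s by lra.
    exact: (cvg_comp _ _ (@cvg_snd _ _ _ _ _) (cvg_powRN E q0)).
  pose T (p : R * R) := 2 * eta x ^+ 2 * a x * Iann p.1 p.2 (fun z => Lint s w x z * regk K z) +
      2 * sigma * u x * Iann p.1 p.2 (fun z => Lint s u x z * regk K z) +
      (E * p.2 `^ (- (1 + 2 * s)) - D).
  have cvr : T p @[p --> @L_filter R] -->
      2 * eta x ^+ 2 * a x * lw + 2 * sigma * u x * lu + (0 - D).
    apply: cvgD; first by apply: cvgD; apply: cvgMr.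
    by apply: cvgB => //; exact: cvg_cst.
  rewrite sub0r in cvr.
  have cvr' : (T p)%:E @[p --> @L_filter R] -->
      (2 * eta x ^+ 2 * a x * lw + 2 * sigma * u x * lu - D)%:E.
    by apply: cvg_EFin; [exact: nearW|exact: cvr].
  apply: (lee_cvg_to cvF cvr').
  have t4 : 0 < tau / 4 by rewrite divr_gt0.
  apply: filterS (near_L_filter (2 * tau) t4) => -[r r'] /= [r0 [rt tr']].
  rewrite lee_fin /T/=.
  have tw' : tame (Lint s w x) by case: w0.
  have tu' : tame (Lint s u x) by case: u0.
  rewrite (@eq_Iann _ _ _ _ (fun z => Lint s F x z * regk K z)
    (fun z => 2 * eta x ^+ 2 * a x * (Lint s w x z * regk K z) +
      2 * sigma * u x * (Lint s u x z * regk K z) +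
      (B z * regk K z - sigma * ((u (x - z) - u x) ^+ 2 * regk K z)))); last first.
    by move=> z _; rewrite Lint_F; ring.
  have m1 := tameM tw' tK; have m2 := tameM tu' tK.
  have m3 := tameM tB tK; have m4 := tameM tU2 tK.
  rewrite IannD//; [|by apply: tameD; exact: tameZ|by apply: tameB => //; exact: tameZ].
  rewrite IannD//; [|exact: tameZ|exact: tameZ].
  rewrite IannB//; last exact: tameZ.
  rewrite !IannZ// lerD2l lerBrDr.
  exact: htr (ltW tr').
(* [key] excludes +oo, and for -oo the left-hand side is -oo. *)
case: lF LF cvF key => [l||] LF cvF key.
- rewrite -!EFinD lee_fin; rewrite lee_fin in key.
  rewrite -/w; move: key; set dw := 'D_b w x; set du := 'D_b u x; lra.
- by move: key; rewrite leye_eq.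
- by rewrite addNye leNye.
Qed.

End at_point.
End bernstein.

Lemma bounded_funP (R : realType) (n : nat) (u : 'rV[R]_n -> R) :
  bounded_fun u -> exists M, forall y, `|u y| <= M.
Proof. by move=> [M [_ hM]]; exists (M + 1) => y; apply: hM; rewrite ?ltrDl. Qed.

Theorem theorem7p6 (R : realType) (n : nat) (hn : (0 < n)%N)
    (s lam Lam : R) (hs : 0 < s < 1) (hlam : 0 < lam) (hLam : lam <= Lam)
    (M1 M2 : R) :
  exists2 sigma0 : R, 0 < sigma0 &
  forall (K : 'rV[R]_n -> \bar R) (b : 'rV[R]_n) (eta : 'rV[R]_n -> R),
    kernel_class s lam Lam K ->
    enorm b <= Lam ->
    C11 eta -> (forall x, 0 <= eta x) -> C01 (fun x => eta x `^ (2 * s)) ->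
    C11_norm eta = M1%:E -> C01_norm (fun x => eta x `^ (2 * s)) = M2%:E ->
  forall (sigma : R) (e : 'rV[R]_n), sigma0 <= sigma -> enorm e = 1 ->
  forall (eps : R) (u v : 'rV[R]_n -> R), 0 < eps ->
    holder_loc (1 + 2 * s + eps) u -> bounded_fun u ->
    holder_loc (1 + 2 * s + eps) v -> bounded_fun v ->
  (forall x, derivable ('D_e u) x b ->
    let F := fun y => eta y ^+ 2 * ('D_e u y) ^+ 2 + sigma * u y ^+ 2 in
    [/\ L_exists s K F x, L_finite s K ('D_e u) x, L_finite s K u x &
      (Lb s K b F x <=
         (2 * eta x ^+ 2)%:E * Lb s K b ('D_e u) x * ('D_e u x)%:E
         + (2 * sigma)%:E * Lb s K b u x * (u x)%:E)%E]) /\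
  (forall x, derivable ('D_e v) x b ->
    let G := fun y => eta y ^+ 2 * (Num.max ('D_e v y) 0) ^+ 2
                      + sigma * v y ^+ 2 in
    [/\ L_exists s K G x, L_finite s K ('D_e v) x, L_finite s K v x &
      (Lb s K b G x <=
         (2 * eta x ^+ 2)%:E * Lb s K b ('D_e v) x
           * (Num.max ('D_e v x) 0)%:E
         + (2 * sigma)%:E * Lb s K b v x * (v x)%:E)%E]).
Proof.
(* The norm of eta may be below 1, while the estimates assume [1 <= M]. *)
pose M := `|M1| + 1.
have hM : 1 <= M by rewrite lerDr.
have [sigma0 sig0 [C' C'0 main]] := truncated_inequality hn hs hlam hLam M2 hM.
exists sigma0 => // K b eta hK hb [de _] eta0 _ hM1 hM2 sigma e hsig he eps u v heps hu bu hv bv.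
have [b1 b2 b3] := C11_bounds hn hM1.
have M1M : M1 <= M by rewrite /M; apply: le_trans (ler_norm _) _; rewrite lerDl.
have ok : weight_ok M eta.
  split => // [x|x|x y].
  - by rewrite eta0/= -(ger0_norm (eta0 x)); apply: le_trans (b1 x) M1M.
  - exact: le_trans (b2 x) M1M.
  - by apply: le_trans (b3 x y) _; rewrite ler_wpM2r ?enorm_ge0.
have hl := C01_lip hM2.
have sig : 0 <= sigma by apply: le_trans hsig; exact: ltW.
(* Applied to u with a the derivative itself, and to v with a its positive part. *)
have core (f a : 'rV[R]_n -> R) : holder_loc (1 + 2 * s + eps) f -> bounded_fun f ->
    truncation ('D_e f) a -> forall x, derivable ('D_e f) x b ->
    [/\ L_exists s K (fun y => eta y ^+ 2 * a y ^+ 2 + sigma * f y ^+ 2) x,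
      L_finite s K ('D_e f) x, L_finite s K f x &
      (Lb s K b (fun y => eta y ^+ 2 * a y ^+ 2 + sigma * f y ^+ 2)%R x <=
         (2 * eta x ^+ 2)%:E * Lb s K b ('D_e f) x * (a x)%:E
         + (2 * sigma)%:E * Lb s K b f x * (f x)%:E)%E].
  move=> hf bf ta x hb'.
  have [Mf hMf] := bounded_funP bf.
  have C1f := holder_loc_C1 hs heps hf.
  have cw := C1_dir_continuous (e := e) C1f.
  have ca := truncation_continuous ta cw.
  have [tau tau0 htr] := main K eta b f x e Mf a sigma hK ok hb hl he C1f.1 cw hMf ca
    (truncation_le ta x) hsig.
  exact: (bernstein_at hn hs hlam hLam hM sig hK ok heps hf he hMf ta hb' tau0 htr).
split => x hx.
  exact: (core u _ hu bu (truncation_id _)).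
exact: (core v _ hv bv (truncation_pos _)).
Qed.
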